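(* For $l\ge0$ let $A^{(l)}$ be a single chain with $l$ interior vertices and let $$a(l,i):=\sum_{W\subseteq\{1,\dots,l\},\ |W|=i}|\mathcal{PPT}_W(A^{(l)})|.$$ Let $C_n=\frac1{n+1}\binom{2n}{n}$ be the Catalan numbers. Then for every $l\ge 1$: (1) $a(l,0)=C_l$ and $a(l,1)=(l+1)\,C_l$. (2) For every $i\ge 2$, $$a(l,i)=\binom{l+1}{i} C_l-a(l-1,i-2).$$
   Context: All point sets are finite planar sets in general position (no three points collinear). A pseudo-triangle is a planar simple polygon with exactly three convex vertices (internal angle less than $\pi$). A pseudo-triangulation of a point set $A$ is a partition of $\operatorname{conv}(A)$ into pseudo-triangles whose vertex set is exactly $A$. A vertex is pointed if it has an incident angle greater than $\pi$; a pseudo-triangulation is pointed if all its vertices are pointed. A single chain with $l$ interior vertices is a set $A$ of $l+3$ points: $l+2$ points labelled $0,1,\dots,l,l+1$ forming (in this cyclic order) a convex $(l+2)$-gon, plus a point $p$ (the tip) exterior to this polygon and seeing all edges of it except the edge $(0,l+1)$ (for $l=0$, $A$ is just a triangle). Its convex hull vertices are $p,0,l+1$ and its interior points are $1,\dots,l$. For $W\subseteq \{1,\dots,l\}$, $\mathcal{PPT}_W(A)$ is the set of pointed pseudo-triangulations of $A$ in which, for each $i\in \{1,\dots,l\}$, $p$ is joined to $i$ by an edge if and only if $i\in W$. An empty sum is $0$, so $a(l,i)=0$ for $i>l$. *)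

(* Defs.v *)
(* The real plane is 'rV[R]_2 over R : realType. *)
From mathcomp Require Import all_boot all_order all_algebra.
From mathcomp Require Import boolp reals.
Set Implicit Arguments.
Unset Strict Implicit.
Unset Printing Implicit Defensive.

Import Order.TTheory GRing.Theory Num.Theory.
Local Open Scope ring_scope.

Section PlanePoints.
Variables (R : realType).
Implicit Types (u v w q : 'rV[R]_2).

Definition xco q : R := q 0 0.
Definition yco q : R := q 0 1.

(* Twice the signed area of the triangle u v w: positive iff it turns left. *)
Definition orient u v w : R :=
  (xco v - xco u) * (yco w - yco u) - (yco v - yco u) * (xco w - xco u).

Definition on_segment u v q : Prop :=
  exists2 t : R, 0 <= t <= 1 & q = (1 - t) *: u + t *: v.

End PlanePoints.

(* A finite point set is a family a : I -> 'rV[R]_2 over a finite label type.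
   Edges are two-element sets of labels; a polygon is the set of its edges,
   which determines it without choosing a starting vertex or a direction; a
   subdivision is a set of polygons. *)
Section PseudoTriangulations.
Variables (R : realType) (I : finType) (a : I -> 'rV[R]_2).
Implicit Types (v : I) (X : {set I}) (P E : {set {set I}}).
Implicit Types (T : {set {set {set I}}}) (q : 'rV[R]_2).

Definition general_position : Prop :=
  forall i j k : I, i != j -> j != k -> i != k ->
    orient (a i) (a j) (a k) != 0.

Definition conv X q : Prop :=
  exists w : I -> R,
    [/\ forall i, 0 <= w i, forall i, i \notin X -> w i = 0,
        \sum_i w i = 1 & q = \sum_i w i *: a i].

Definition simple_polygon P : Prop :=
  exists s : seq I,
    [/\ uniq s, (2 < size s)%N, P = [set [set x; next s x] | x in s] &
        forall e f q, e \in P -> f \in P -> e != f -> conv e q -> conv f q ->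
          exists2 i, i \in e :&: f & q = a i].

Definition boundary P q : Prop := exists2 e, e \in P & conv e q.

(* The edge e meets the open upward vertical ray from q; the half-open
   condition on abscissas shifts the ray infinitesimally to the right, so that
   rays through a vertex and vertical edges are counted correctly. *)
Definition crosses_ray q (e : {set I}) : bool :=
  [exists i in e, exists j in e,
    (xco (a i) <= xco q < xco (a j)) && (orient (a i) (a j) q < 0)].

(* Open interior of a simple polygon, by the even-odd rule. *)
Definition inside P q : Prop :=
  ~ boundary P q /\ odd #|[set e in P | crosses_ray q e]|.

Definition region P q : Prop := boundary P q \/ inside P q.

Definition vertices P : {set I} := cover P.

(* The internal angle of P at v is less than pi: near v, the convex wedge
   spanned by the two edges of P at v is the one filled by the interior. *)
Definition convex_vertex P v : Prop :=
  exists u w : I,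
    [/\ u != w, [set v; u] \in P, [set v; w] \in P &
        exists2 eps : R, 0 < eps & forall x y : R,
          0 < x < eps -> 0 < y < eps ->
          inside P (a v + x *: (a u - a v) + y *: (a w - a v))].

Definition pseudo_triangle P : Prop :=
  simple_polygon P /\ #|[set v : I | `[< convex_vertex P v >]]| = 3.

Definition edges T : {set {set I}} := cover T.

(* Since the points are in general position, no vertex lies in the relative
   interior of an edge, so such a subdivision is automatically edge to edge. *)
Definition pseudo_triangulation T : Prop :=
  [/\ forall P, P \in T -> pseudo_triangle P,
      forall q, conv [set: I] q <-> exists2 P, P \in T & region P q,
      forall P Q q, P \in T -> Q \in T -> P != Q -> ~ (inside P q /\ inside Q q) &
      \bigcup_(P in T) vertices P = [set: I]].

(* The direction from a v to a k lies strictly inside the angle at a v swept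
   counterclockwise from a i to a j (assuming a v, a i, a j not collinear). *)
Definition in_ccw_angle v i j k : bool :=
  if 0 < orient (a v) (a i) (a j)
  then (0 < orient (a v) (a i) (a k)) && (0 < orient (a v) (a k) (a j))
  else (0 < orient (a v) (a i) (a k)) || (0 < orient (a v) (a k) (a j)).

(* Some angle between counterclockwise consecutive edges at v exceeds pi.  At a
   convex hull vertex this angle may be the one containing the outer face. *)
Definition pointed E v : Prop :=
  exists i j : I,
    [/\ [set v; i] \in E, [set v; j] \in E,
        forall k, [set v; k] \in E -> ~~ in_ccw_angle v i j k &
        orient (a v) (a i) (a j) < 0].

Definition pointed_pseudo_triangulation T : Prop :=
  pseudo_triangulation T /\ forall v, pointed (edges T) v.

End PseudoTriangulations.

(* Labels of a single chain with l interior vertices: Some k is the chain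
   point k, for 0 <= k <= l + 1, and None is the tip. *)
Section SingleChain.
Variables (R : realType) (l : nat).
Local Notation label := (option 'I_l.+2).
Implicit Types (a : label -> 'rV[R]_2) (W : {set 'I_l.+2}).

Definition chain : {set label} := [set Some k | k : 'I_l.+2].

Definition convex_position a : Prop :=
  (forall i j k : 'I_l.+2, (i < j < k)%N ->
     0 < orient (a (Some i)) (a (Some j)) (a (Some k))) \/
  (forall i j k : 'I_l.+2, (i < j < k)%N ->
     orient (a (Some i)) (a (Some j)) (a (Some k)) < 0).

(* From the tip, the line of sight to every point of the edge reaches the
   polygon spanned by the chain points at that point only. *)
Definition sees a (e : {set label}) : Prop :=
  forall q x, conv a e q -> on_segment (a None) q x -> conv a chain x -> x = q.

Definition single_chain a : Prop :=
  general_position a /\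
  ((0 < l)%N ->
   [/\ convex_position a,
       ~ conv a chain (a None),
       forall i j : 'I_l.+2, j = i.+1 :> nat -> sees a [set Some i; Some j] &
       ~ sees a [set Some ord0; Some ord_max]]).

Definition chain_interior : {set 'I_l.+2} := [set k : 'I_l.+2 | 0 < k <= l]%N.

Definition PPT a W : {set {set {set {set label}}}} :=
  [set T : {set {set {set label}}} |
    `[< pointed_pseudo_triangulation a T >] &&
    [forall k in chain_interior,
       ([set None; Some k] \in edges T) == (k \in W)]].

Definition num_PPT a (i : nat) : nat :=
  \sum_(W : {set 'I_l.+2} | (W \subset chain_interior) && (#|W| == i)) #|PPT a W|.

End SingleChain.

Definition catalan (n : nat) : nat := ('C(n.*2, n) %/ n.+1)%N.

(* Main.v *)
Require Import Defs.
From HB Require Import structures.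
From mathcomp Require Import all_boot all_order all_algebra.
From mathcomp Require Import boolp reals zify ring lra.

(** The pointed pseudo-triangulations of a single chain are encoded by plane
    trees, the type dissection, and the trees are counted with a generating
    function.

    Let p be the tip.  A pseudo-triangle that avoids p has three corners and no
    reflex vertex, so it is a triangle on three chain points
    (chain_polygon).  A pseudo-triangle at p has two neighbours u < v of p; all
    chain points between u and v lie on it, and with only three corners, one of
    them p, its boundary is forced to be p, u, [k], u+1, ..., v-1, [k'], v with
    at most one extra corner k < u and at most one extra corner k' > v
    (tip_shape).  Now look across a chord (x, y) that is an edge, to the side
    of p.  The tile found there is a triangle (x, k, y), or a pseudo-triangle
    at p that has the chord among its sides.  In the second case x or y or both
    are extra corners of it, and one or two chords that span fewer chain steps
    remain below (step_holds).  Starting from the hull edge (0, l+1) this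
    decodes a pseudo-triangulation into a dissection of width l+1 (realize).
    Each edge from p to an interior chain point, here a spoke, is recorded once,
    and pointedness says that a spoke has chords on one side only
    (pointed_obstruction); hence the recorded data determine all tiles at p
    (tips_realized).

    Conversely the tiles read off from any dissection of width l+1 form a
    pointed pseudo-triangulation (tiles_pseudo_triangulation, tiles_pointed), and
    the dissection can be recovered from its chords (chords_inj).  So the number
    of pointed pseudo-triangulations with i spokes is the number of dissections
    of width l+1 with tip degree i (num_PPT_dissections).

    All geometry passes through one reduction.  By the even-odd rule, a generic
    point q is inside a polygon exactly when an odd number of the edges (i, j)
    of the polygon between chain points have q in the triangle p, i, j
    (parity_crossing): the crossings with the edges at p cancel.  Whether a
    polygon covers the points close to a vertex, and whether its angle there is
    convex, then becomes parity counting on intervals of integers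
    (crossings_tip, encloses_corner, fan_step), and that the tiles of a
    dissection cover the hull exactly once is an induction on the tree
    (cover_count).

    For the count, let P_n(X) be the sum of X^(tip degree) over the dissections
    of width n.  The five constructors give
      P_n = [n = 1] + sum_k P_k P_(n-k) + 2 X P_(n-1) + X^2 sum_k P_k P_(n-1-k),
    and B_n = P_n + X^2 P_(n-1) + [n = 1] X then satisfies
      B_n = [n = 1] (1 + X) + sum_k B_k B_(n-k),
    the Catalan recurrence, so B_(l+1) = (1 + X)^(l+1) C_l (tilt_catalan).
    Comparing coefficients of X^i is the theorem. *)

Set Implicit Arguments.
Unset Strict Implicit.
Unset Printing Implicit Defensive.
Import Order.TTheory GRing.Theory Num.Theory.
Local Open Scope ring_scope.

(** * Dissections and their enumeration *)

Lemma catalan_central n : (n.+1 * catalan n = 'C(n.*2, n))%N.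
Proof.
rewrite /catalan mulnC divnK //.
have h : (n.+1 * 'C(n.*2, n.+1) = n * 'C(n.*2, n))%N.
  by rewrite mul_bin_left -addnn addnK.
rewrite -(@Gauss_dvdr _ n) ?coprimeSn //.
by rewrite -h dvdn_mulr.
Qed.

Lemma catalanS n : (n.+2 * catalan n.+1 = (4 * n + 2) * catalan n)%N.
Proof.
have h1 := catalan_central n; have h2 := catalan_central n.+1.
have h3 : (n.+1 * 'C(n.*2.+2, n.+1) = n.*2.+2 * 'C(n.*2.+1, n))%N by rewrite -mul_bin_diag.
have h4 : (n.+1 * 'C(n.*2.+1, n) = n.*2.+1 * 'C(n.*2, n))%N.
  have := mul_bin_down n.*2.+1 n; rewrite /= (_ : n.*2.+1 - n = n.+1)%N; last by lia.
  by move=> ->.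
rewrite doubleS in h2.
apply/eqP; rewrite -(eqn_pmul2l (ltn0Sn n)) -(eqn_pmul2l (ltn0Sn n)); apply/eqP.
rewrite h2 h3; nia.
Qed.

Lemma catalan0 : catalan 0 = 1%N. Proof. by []. Qed.

(** With S the convolution and T the convolution weighted by k+1, the
    symmetry k <-> n-k gives 2T = (n+2)S, while the two-term recurrence for
    Catalan numbers relates consecutive T; together they determine S. *)
Lemma catalan_conv n :
  catalan n.+1 = (\sum_(k < n.+1) catalan k * catalan (n - k))%N.
Proof.
pose S n := (\sum_(k < n.+1) catalan k * catalan (n - k))%N.
pose T n := (\sum_(k < n.+1) k.+1 * (catalan k * catalan (n - k)))%N.
have hT m : (2 * T m = m.+2 * S m)%N.
  rewrite mul2n -addnn {2}/T (reindex_inj rev_ord_inj) /= -big_split /= /S big_distrr /=.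
  apply: eq_bigr => k _; rewrite subSS.
  have hk : (k <= m)%N by rewrite -ltnS.
  rewrite subKn // (mulnC (catalan (m - k))) -mulnDl; congr (_ * _)%N; lia.
have hrec m : (T m.+1 + 2 * S m = catalan m.+1 + 4 * T m)%N.
  rewrite /T big_ord_recl /= subn0 mul1n catalan0 mul1n -addnA; congr (_ + _)%N.
  rewrite /S !big_distrr -big_split /=; apply: eq_bigr => k _.
  rewrite /bump /= add1n subSS !mulnA catalanS -!mulnA; nia.
elim: n => [|n IH]; first by rewrite big_ord1.
have h1 := hT n.+1; have h2 := hT n; have h3 := hrec n; have h4 := catalanS n.+1.
have hS : S n = catalan n.+1 by rewrite IH.
rewrite -/(S n.+1); apply/eqP.
rewrite -(eqn_pmul2l (ltn0Sn n.+2)); apply/eqP; rewrite -h1 h4.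
by rewrite hS in h2 h3; nia.
Qed.

(** What a pointed pseudo-triangulation looks like on the tip side of a
    chord (a, b) between chain points.  Edge: the chord is a side
    of the chain, b = a+1.  Triangle: the tile there is a triangle with apex between
    a and b.  In the other cases the tile has the tip as a vertex:
    in OpenLeft it contains the path a, b, a+1 with a+1 joined to the tip, so
    that (a+1, b) remains; OpenRight is the mirror image, with the path
    b-1, a, b and b-1 joined to the tip; in OpenMiddle it contains
    u, a, b, u+1 with u and u+1 joined to the tip, and (a, u) and (u+1, b)
    remain. *)
Inductive dissection : Type :=
| Edge
| Triangle of dissection & dissection
| OpenLeft of dissection
| OpenRight of dissection
| OpenMiddle of dissection & dissection.

Fixpoint dissection_code (d : dissection) : GenTree.tree unit :=
  match d with
  | Edge => GenTree.Node 0 [::]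
  | Triangle d1 d2 => GenTree.Node 1 [:: dissection_code d1; dissection_code d2]
  | OpenLeft d1 => GenTree.Node 2 [:: dissection_code d1]
  | OpenRight d1 => GenTree.Node 3 [:: dissection_code d1]
  | OpenMiddle d1 d2 => GenTree.Node 4 [:: dissection_code d1; dissection_code d2]
  end.

Fixpoint dissection_decode (c : GenTree.tree unit) : option dissection :=
  match c with
  | GenTree.Node 0 [::] => Some Edge
  | GenTree.Node 1 [:: c1; c2] =>
      if (dissection_decode c1, dissection_decode c2) is (Some d1, Some d2)
      then Some (Triangle d1 d2) else None
  | GenTree.Node 2 [:: c1] => omap OpenLeft (dissection_decode c1)
  | GenTree.Node 3 [:: c1] => omap OpenRight (dissection_decode c1)
  | GenTree.Node 4 [:: c1; c2] =>
      if (dissection_decode c1, dissection_decode c2) is (Some d1, Some d2)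
      then Some (OpenMiddle d1 d2) else None
  | _ => None
  end.

Lemma dissection_codeK : pcancel dissection_code dissection_decode.
Proof. by elim=> //= [d -> e -> | d -> | d -> | d -> e ->]. Qed.

HB.instance Definition _ := Equality.copy dissection (pcan_type dissection_codeK).

Fixpoint width (d : dissection) : nat :=
  match d with
  | Edge => 1
  | Triangle d1 d2 => width d1 + width d2
  | OpenLeft d1 | OpenRight d1 => (width d1).+1
  | OpenMiddle d1 d2 => (width d1 + width d2).+1
  end.

(** The number of spokes: a one-sided opening creates one edge at the tip,
    OpenMiddle two. *)
Fixpoint tip_degree (d : dissection) : nat :=
  match d with
  | Edge => 0
  | Triangle d1 d2 => tip_degree d1 + tip_degree d2
  | OpenLeft d1 | OpenRight d1 => (tip_degree d1).+1
  | OpenMiddle d1 d2 => (tip_degree d1 + tip_degree d2).+2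
  end.

Fixpoint depth (d : dissection) : nat :=
  match d with
  | Edge => 1
  | OpenLeft d1 | OpenRight d1 => (depth d1).+1
  | Triangle d1 d2 | OpenMiddle d1 d2 => (maxn (depth d1) (depth d2)).+1
  end.

Lemma width_gt0 d : (0 < width d)%N.
Proof. by elim: d => //= *; lia. Qed.

Lemma depth_width d : (depth d <= width d)%N.
Proof.
elim: d => //= [d1 h1 d2 h2|d1 h1 d2 h2]; have := width_gt0 d1; have := width_gt0 d2; lia.
Qed.

(** Locked, since simplification would otherwise unfold the recursive
    enumeration below. *)
Definition splits (f : dissection -> dissection -> dissection)
    (E : nat -> seq dissection) (n : nat) : seq dissection :=
  locked [seq d | k <- iota 0 n.+1, d <- [seq f d1 d2 | d1 <- E k, d2 <- E (n - k)%N]].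

(** The first argument bounds the depth and makes the recursion
    structural; as the depth is at most the width, dissections n n lists every
    dissection of width n. *)
Fixpoint dissections (m n : nat) : seq dissection :=
  if m is m'.+1 then
    if n is n'.+1 then
    nseq (n == 1)%N Edge ++ splits Triangle (dissections m') n ++
    [seq OpenLeft d | d <- dissections m' n'] ++
    [seq OpenRight d | d <- dissections m' n'] ++
    splits OpenMiddle (dissections m') n'
    else [::]
  else [::].

Lemma dissectionsS m n : dissections m.+1 n.+1 =
  nseq (n == 0)%N Edge ++ splits Triangle (dissections m) n.+1 ++
  [seq OpenLeft d | d <- dissections m n] ++ [seq OpenRight d | d <- dissections m n] ++
  splits OpenMiddle (dissections m) n.
Proof. by []. Qed.

Arguments splits : simpl never.
Arguments dissections : simpl never.

Lemma mem_splits f E n d :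
  reflect (exists d1 d2 k, [/\ (k <= n)%N, d1 \in E k, d2 \in E (n - k)%N & d = f d1 d2])
          (d \in splits f E n).
Proof.
rewrite /splits -lock; apply: (iffP allpairsPdep) => [[k [e [hk /allpairsP[[d1 d2] /= [h1 h2 ->]] ->]]]|].
  by exists d1, d2, k; split=> //; rewrite mem_iota in hk; lia.
move=> [d1 [d2 [k [hk h1 h2 ->]]]]; exists k, (f d1 d2).
by rewrite mem_iota add0n ltnS hk; split=> //; apply/allpairsP; exists (d1, d2).
Qed.

Lemma mem_dissections m n d :
  (d \in dissections m n) = (width d == n) && (depth d <= m)%N.
Proof.
elim: m n d => [|m IH] [|n] d.
- by rewrite in_nil; case: d => *; rewrite andbC.
- by rewrite in_nil; case: d => *; rewrite andbC.
- by rewrite in_nil; have := width_gt0 d; lia.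
have hf f e : (forall d1 d2, f d1 d2 != e) -> forall k, e \notin splits f (dissections m) k.
  move=> hne k; apply/negP => /mem_splits[d1 [d2 [j [_ _ _ he]]]].
  by have := hne d1 d2; rewrite he eqxx.
have hm (f : dissection -> dissection) e :
    (forall d1, f d1 != e) -> forall s : seq dissection, e \notin map f s.
  by move=> hne s; apply/negP => /mapP[d1 _ he]; have := hne d1; rewrite he eqxx.
rewrite dissectionsS !mem_cat mem_nseq.
case: d => [|d1 d2|d1|d1|d1 d2] /=.
- by rewrite !(negPf (hf _ _ _ _)) // !(negPf (hm _ _ _ _)) // orbF eqxx; case: n.
- rewrite !(negPf (hm _ _ _ _)) // (negPf (hf OpenMiddle _ _ _)) // !orbF andbF /=.
  apply/mem_splits/idP => [[e1 [e2 [k [hk]]]]|h].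
    by rewrite !IH => h1 h2 [-> ->]; lia.
  exists d1, d2, (width d1); have := width_gt0 d2; rewrite !IH => ?; split=> //; lia.
- rewrite (negPf (hm OpenRight _ _ _)) // !(negPf (hf _ _ _ _)) // !orbF andbF /=.
  by rewrite mem_map ?IH // => x y [].
- rewrite (negPf (hm OpenLeft _ _ _)) // !(negPf (hf _ _ _ _)) // !orbF andbF /=.
  by rewrite mem_map ?IH // => x y [].
- rewrite !(negPf (hm _ _ _ _)) // (negPf (hf Triangle _ _ _)) // andbF /=.
  apply/mem_splits/idP => [[e1 [e2 [k [hk]]]]|h].
    by rewrite !IH => h1 h2 [-> ->]; lia.
  exists d1, d2, (width d1); have := width_gt0 d2; rewrite !IH => ?; split=> //; lia.
Qed.

Lemma splits_uniq f m n :
  (forall d1 d2 e1 e2, f d1 d2 = f e1 e2 -> d1 = e1 /\ d2 = e2) ->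
  (forall k, uniq (dissections m k)) -> uniq (splits f (dissections m) n).
Proof.
move=> finj hu; rewrite /splits -lock; apply: allpairs_uniq_dep => [|k _|].
- exact: iota_uniq.
- by apply: allpairs_uniq => // -[d1 d2] [e1 e2] _ _ /= /finj[-> ->].
move=> _ _ /allpairsPdep[k [d [_ hd ->]]] /allpairsPdep[k' [d' [_ hd' ->]]] /= e.
move: hd hd'; rewrite -{d'}e => /allpairsP[[d1 d2] /= [h1 _ hd]] /allpairsP[[e1 e2] /= [h1' _ hd']].
move: hd' h1 h1'; rewrite hd => /finj[-> _]; rewrite !mem_dissections.
by move=> /andP[/eqP-> _] /andP[/eqP-> _].
Qed.

Lemma dissections_uniq m n : uniq (dissections m n).
Proof.
elim: m n => [|m IH] [|n] //.
have hT : uniq (splits Triangle (dissections m) n.+1) by apply: splits_uniq => // ? ? ? ? [].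
have hM : uniq (splits OpenMiddle (dissections m) n) by apply: splits_uniq => // ? ? ? ? [].
have hL : uniq [seq OpenLeft d | d <- dissections m n] by rewrite map_inj_uniq // => ? ? [].
have hR : uniq [seq OpenRight d | d <- dissections m n] by rewrite map_inj_uniq // => ? ? [].
rewrite dissectionsS !cat_uniq hT hM hL hR !andbT /=.
apply/and5P; split; first by case: eqP.
all: apply/hasPn => d; rewrite ?mem_cat.
- rewrite mem_nseq => h; apply/negP => /andP[_ /eqP e]; move: h; rewrite e.
  case/or4P => [/mem_splits[? [? [? []]]]|/mapP[]|/mapP[]|/mem_splits[? [? [? []]]]] //.
- move=> h; apply/negP => /mem_splits[? [? [? [_ _ _ e]]]]; move: h; rewrite e.
  by case/or3P => [/mapP[]|/mapP[]|/mem_splits[? [? [? []]]]].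
- move=> h; apply/negP => /mapP[? _ e]; move: h; rewrite e.
  by case/orP => [/mapP[]|/mem_splits[? [? [? []]]]].
- by move=> h; apply/negP => /mapP[? _ e]; move: h; rewrite e => /mem_splits[? [? [? []]]].
Qed.

Definition tip_poly (n : nat) : {poly int} := \sum_(d <- dissections n n) 'X^(tip_degree d).

Lemma tip_poly_fuel m n : (n <= m)%N ->
  \sum_(d <- dissections m n) 'X^(tip_degree d) = tip_poly n.
Proof.
move=> hnm; apply/perm_big/uniq_perm; rewrite ?dissections_uniq // => d.
by rewrite !mem_dissections; have := depth_width d; case: eqP => //=; lia.
Qed.

Lemma tip_poly0 : tip_poly 0 = 0.
Proof. by rewrite /tip_poly big_nil. Qed.

Lemma sum_splits f m n c :
  (forall d1 d2, tip_degree (f d1 d2) = tip_degree d1 + tip_degree d2 + c)%N ->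
  (n <= m)%N ->
  \sum_(d <- splits f (dissections m) n) 'X^(tip_degree d) =
  'X^c * \sum_(k < n.+1) tip_poly k * tip_poly (n - k) :> {poly int}.
Proof.
move=> hf hnm; rewrite /splits -lock big_allpairs_dep.
rewrite -[iota 0 n.+1]/(index_iota 0 n.+1) big_mkord big_distrr /=.
apply: eq_bigr => k _; rewrite big_allpairs_dep /=.
rewrite -!(tip_poly_fuel (m := m)); [|lia|have := ltn_ord k; lia].
rewrite big_distrlr /= big_distrr; apply: eq_bigr => d1 _; rewrite big_distrr /=.
by apply: eq_bigr => d2 _; rewrite hf !exprD mulrC.
Qed.

(** One summand for each constructor at the root. *)
Lemma tip_poly_rec n : tip_poly n.+1 = (n == 0)%:R +
  \sum_(k < n.+2) tip_poly k * tip_poly (n.+1 - k) + 2%:R * 'X * tip_poly n +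
  'X^2 * \sum_(k < n.+1) tip_poly k * tip_poly (n - k).
Proof.
rewrite -(@tip_poly_fuel n.+2) // dissectionsS !big_cat /=.
rewrite (sum_splits (c := 0)) ?(sum_splits (c := 2)) //; last 2 first.
  by move=> d1 d2 /=; rewrite addn2.
  by move=> d1 d2 /=; rewrite addn0.
have hmap f : (forall d, tip_degree (f d) = (tip_degree d).+1) ->
    \sum_(d <- map f (dissections n.+1 n)) 'X^(tip_degree d) = 'X * tip_poly n :> {poly int}.
  move=> hf; rewrite big_map -(@tip_poly_fuel n.+1) // big_distrr /=.
  by apply: eq_bigr => d _; rewrite hf exprS.
rewrite !hmap // expr0 mul1r.
have -> : \sum_(d <- nseq (n == 0)%N Edge) 'X^(tip_degree d) = (n == 0)%:R :> {poly int}.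
  by case: (n) => [|n']; rewrite ?big_nil // big_cons big_nil /= addr0 expr0.
ring.
Qed.

Section ConvolutionSolution.
Variables (p : nat -> {poly int}) (x : {poly int}).
Hypothesis p0 : p 0 = 0.
Hypothesis p_rec : forall n, p n.+1 = (n == 0)%:R +
  \sum_(k < n.+2) p k * p (n.+1 - k) + 2%:R * x * p n +
  x ^+ 2 * \sum_(k < n.+1) p k * p (n - k).

(** In terms of generating functions in t, this is the substitution
    B = P + x^2 t P + x t, which completes the quadratic equation of P to
    B = B^2 + (1 + x) t. *)
Definition tilt (n : nat) : {poly int} := p n + (if n is n'.+1 then x ^+ 2 * p n' else 0) + (n == 1)%:R * x.

Lemma tilt_conv n : tilt n =
  (n == 1)%:R * (1 + x) + \sum_(k < n.+1) tilt k * tilt (n - k).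
Proof.
pose P : {poly {poly int}} := \poly_(i < n.+1) p i.
have cP i : (i <= n)%N -> P`_i = p i by move=> hi; rewrite coef_poly ltnS hi.
pose B := P + x%:P ^+ 2 * ('X * P) + x%:P * 'X.
have cB i : (i <= n)%N -> B`_i = tilt i.
  move=> hi; rewrite /B /tilt !coefD -rmorphXn !coefCM coefXM coefX cP //.
  case: i hi => [|i] hi /=; first by rewrite !mulr0 mul0r.
  by rewrite cP ?(ltnW hi) // eqSS [x * _]mulrC.
(* the defect in the equation of the truncated series vanishes up to degree n *)
pose E := P - P ^+ 2 - 2%:R * x%:P * ('X * P) - x%:P ^+ 2 * ('X * P ^+ 2) - 'X.
have cE i : (i <= n)%N -> E`_i = 0.
  move=> hi; rewrite /E -[2%:R]/(1 + 1) -[1 : {poly {poly int}}]/(1%:P) -polyCD -polyCM.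
  rewrite -rmorphXn !coefB !coefCM !coefXM coefX cP //.
  have c2 j : (j <= n)%N -> (P ^+ 2)`_j = \sum_(k < j.+1) p k * p (j - k).
    move=> hj; rewrite expr2 coefM; apply: eq_bigr => k _.
    by rewrite !cP //; have := ltn_ord k; lia.
  rewrite c2 //; case: i hi => [|i] hi /=.
    by rewrite big_ord1 p0 !mulr0 !subr0.
  rewrite c2 ?cP ?(ltnW hi) // eqSS p_rec.
  move: (\sum_(k < i.+2) _) (\sum_(k < i.+1) _) => S S'.
  by case: (i) => [|j] /=; ring.
have hB : B = B ^+ 2 + (1 + x)%:P * 'X + (1 + x%:P ^+ 2 * 'X) * E.
  by rewrite /B /E polyCD polyC1; ring.
have := congr1 (fun q : {poly {poly int}} => q`_n) hB.
have hE : ((1 + x%:P ^+ 2 * 'X) * E)`_n = 0.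
  rewrite mulrDl mul1r -mulrA -rmorphXn coefD coefCM coefXM cE // add0r.
  by case: ifP => _; rewrite ?cE ?mulr0 // leq_pred.
rewrite cB // coefD hE addr0 coefD coefCM coefX => ->.
rewrite expr2 coefM addrC [_ * (1 + x)]mulrC; congr (_ + _).
by apply: eq_bigr => k _; rewrite !cB //; have := ltn_ord k; lia.
Qed.

(** The solution of B = B^2 + (1 + x) t is the Catalan series in
    (1 + x) t. *)
Lemma tilt_catalan n : tilt n.+1 = (1 + x) ^+ n.+1 * (catalan n)%:R.
Proof.
elim/ltn_ind: n => n IH.
have t0 : tilt 0 = 0 by rewrite /tilt p0 mul0r !addr0.
rewrite tilt_conv big_ord_recl subn0 t0 mul0r add0r big_ord_recr /= subnn t0 mulr0 addr0.
case: n IH => [|n] IH; first by rewrite big_ord0 addr0 mul1r catalan0 expr1 mulr1.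
rewrite mul0r add0r catalan_conv natr_sum big_distrr; apply: eq_bigr => k _ /=.
have hk := ltn_ord k; rewrite /bump /= add1n IH; last by lia.
rewrite (_ : (n.+2 - k.+1 = (n - k).+1)%N); last by lia.
rewrite IH; last by lia.
rewrite natrM (_ : n.+2 = k.+1 + (n - k).+1)%N; last by lia.
by rewrite exprD; ring.
Qed.

End ConvolutionSolution.

Definition dissection_count (n i : nat) : nat :=
  size [seq d <- dissections n n | tip_degree d == i].

Lemma coef_tip_poly n i : (tip_poly n)`_i = (dissection_count n i)%:R.
Proof.
rewrite /tip_poly coef_sum /dissection_count size_filter -sum1_count natr_sum.
rewrite [RHS]big_mkcond; apply: eq_bigr => d _; rewrite coefXn eq_sym.
by case: ifP.
Qed.

Lemma coef_exprD1X n i : ((1 + 'X : {poly int}) ^+ n)`_i = ('C(n, i))%:R.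
Proof.
rewrite exprDn coef_sum; under eq_bigr => k _ do rewrite expr1n mul1r coefMn coefXn.
have [hi|hi] := ltnP i n.+1.
  rewrite (bigD1 (Ordinal hi)) //= eqxx big1 ?addr0 // => k.
  by rewrite -val_eqE /= eq_sym => /negPf->; rewrite mul0rn.
rewrite bin_small ?big1 // => k _.
by rewrite gtn_eqF ?mul0rn // (leq_trans (ltn_ord k)).
Qed.

Lemma dissection_count_rec l i : (0 < l)%N ->
  (dissection_count l.+1 i + (if i is i'.+2 then dissection_count l i' else 0) =
   'C(l.+1, i) * catalan l)%N.
Proof.
move=> hl.
have := congr1 (fun q : {poly int} => q`_i) (tilt_catalan tip_poly0 tip_poly_rec l).
rewrite /tilt eqSS (gtn_eqF hl) /= mul0r addr0 coefD coefXnM mulr_natr coefMn coef_exprD1X.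
rewrite !coef_tip_poly -mulrnA.
by case: i => [|[|i]] /=; rewrite ?addr0 ?addn0 ?subn2 /= -?natrD => /eqP; rewrite eqr_nat => /eqP.
Qed.

Local Open Scope nat_scope.

(** * Spokes, triangles and chords of a dissection *)

(** An edge from the tip to an interior chain point w, its foot, is stored as
    (w, k, k'): the boundary of the tile to the right of the spoke leaves w
    towards k < w, and that of the tile to the left leaves w towards k' > w.
    A genuine spoke has exactly one of the two; when both are absent the triple
    stands for a hull edge or for a position without spoke. *)
Definition spoke : Type := (nat * option nat * option nat)%type.
Definition foot (x : spoke) : nat := x.1.1.
Definition plain (k : nat) : spoke := (k, None, None).

Fixpoint spokes (d : dissection) (a : nat) : seq spoke :=
  match d with
  | Edge => [::]
  | Triangle d1 d2 => spokes d1 a ++ spokes d2 (a + width d1)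
  | OpenLeft d1 => (a.+1, None, Some (a + (width d1).+1)) :: spokes d1 a.+1
  | OpenRight d1 => rcons (spokes d1 a) (a + width d1, Some a, None)
  | OpenMiddle d1 d2 =>
      spokes d1 a ++ (a + width d1, Some a, None) ::
      (a + (width d1).+1, None, Some (a + (width d1 + width d2).+1)) ::
      spokes d2 (a + (width d1).+1)
  end.

Fixpoint triangles (d : dissection) (a : nat) : seq (nat * nat * nat) :=
  match d with
  | Edge => [::]
  | Triangle d1 d2 => (a, a + width d1, a + (width d1 + width d2)) ::
      triangles d1 a ++ triangles d2 (a + width d1)
  | OpenLeft d1 => triangles d1 a.+1
  | OpenRight d1 => triangles d1 a
  | OpenMiddle d1 d2 => triangles d1 a ++ triangles d2 (a + (width d1).+1)
  end.

(** The boundary, without the tip, of the tile between two consecutive edges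
    w, w' at the tip, with optional extra corners k < w and k' > w'. *)
Definition gap_path (w w' : nat) (k k' : option nat) : seq nat :=
  w :: seq_of_opt k ++ iota w.+1 (w' - w).-1 ++ seq_of_opt k' ++ [:: w'].

Definition tile_path (x y : spoke) : seq nat := gap_path (foot x) (foot y) x.1.2 y.2.

(** The tiles at the tip lie between consecutive spokes, the outermost ones
    being bounded by the hull edges at the tip. *)
Definition tips (d : dissection) (a : nat) : seq (seq nat) :=
  pairmap tile_path (plain a) (rcons (spokes d a) (plain (a + width d))).

Definition links (s : seq nat) : seq (nat * nat) :=
  if s is x :: s' then pairmap pair x s' else [::].

Fixpoint chords (d : dissection) (a : nat) : seq (nat * nat) :=
  match d with
  | Edge => [:: (a, a.+1)]
  | Triangle d1 d2 => (a, a + (width d1 + width d2)) :: chords d1 a ++ chords d2 (a + width d1)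
  | OpenLeft d1 => (a, a + (width d1).+1) :: chords d1 a.+1
  | OpenRight d1 => (a, a + (width d1).+1) :: chords d1 a
  | OpenMiddle d1 d2 => (a, a + (width d1 + width d2).+1) ::
      chords d1 a ++ chords d2 (a + (width d1).+1)
  end.

Lemma size_spokes d a : size (spokes d a) = tip_degree d.
Proof.
elim: d a => //= [d1 h1 d2 h2|d h|d h|d1 h1 d2 h2] a.
- by rewrite size_cat h1 h2.
- by rewrite h.
- by rewrite size_rcons h.
- by rewrite size_cat /= h1 h2; lia.
Qed.

Lemma spokes_path d a : path ltn a (rcons (map foot (spokes d a)) (a + width d)).
Proof.
elim: d a => [|d1 h1 d2 h2|d h|d h|d1 h1 d2 h2] a /=; first by lia.
- rewrite map_cat rcons_cat cat_path addnA.
  have := h1 a; rewrite rcons_path => /andP[-> /= hl].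
  by apply: path_le (h2 _) => //; apply: ltn_trans.
- by rewrite ltnSn -addSnnS; apply: h.
- rewrite map_rcons rcons_path h /= last_rcons /foot /=; lia.
- rewrite map_cat rcons_cat cat_path /= /foot /=.
  have := h1 a; rewrite rcons_path => /andP[-> /= ->] /=.
  rewrite addnS ltnSn /= (_ : a + (width d1 + width d2).+1 = (a + width d1).+1 + width d2); last by lia.
  exact: h2.
Qed.

Lemma foot_bound d a x : x \in spokes d a -> a < foot x < a + width d.
Proof.
elim: d a => //= [d1 h1 d2 h2|d h|d h|d1 h1 d2 h2] a.
- by rewrite mem_cat => /orP[/h1|/h2]; lia.
- have := width_gt0 d; rewrite inE => ? /orP[/eqP->|/h]; rewrite /foot /=; lia.
- have := width_gt0 d; rewrite mem_rcons inE => ? /orP[/eqP->|/h]; rewrite /foot /=; lia.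
- have := width_gt0 d1; have := width_gt0 d2.
  by rewrite mem_cat !inE => ? ? /or4P[/h1|/eqP->|/eqP->|/h2]; rewrite /foot /=; lia.
Qed.

Lemma triangles_bound d a i k j :
  (i, k, j) \in triangles d a -> [/\ a <= i, i < k, k < j & j <= a + width d].
Proof.
elim: d a => //= [d1 h1 d2 h2|d h|d h|d1 h1 d2 h2] a.
- have := width_gt0 d1; have := width_gt0 d2.
  rewrite inE mem_cat => ? ? /or3P[/eqP[-> -> ->]|/h1[]|/h2[]] *; split; lia.
- by move=> /h[] *; split; lia.
- by move=> /h[] *; split; lia.
- by rewrite mem_cat => /orP[/h1[]|/h2[]] *; split; lia.
Qed.

Lemma chords_bound d a i j : (i, j) \in chords d a -> [/\ a <= i, i < j & j <= a + width d].
Proof.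
elim: d a => /= [|d1 h1 d2 h2|d h|d h|d1 h1 d2 h2] a.
- by rewrite inE => /eqP[-> ->]; split; lia.
- have := width_gt0 d1.
  by rewrite inE mem_cat => ? /or3P[/eqP[-> ->]|/h1[]|/h2[]] *; split; lia.
- by rewrite inE => /orP[/eqP[-> ->]|/h[]] *; split; lia.
- by rewrite inE => /orP[/eqP[-> ->]|/h[]] *; split; lia.
- by rewrite inE mem_cat => /or3P[/eqP[-> ->]|/h1[]|/h2[]] *; split; lia.
Qed.

Lemma chords_root d a : (a, a + width d) \in chords d a.
Proof. by case: d => /= [|d1 d2|d1|d1|d1 d2]; rewrite inE ?addn1 ?eqxx. Qed.

Lemma links_cat s1 x s2 : links (s1 ++ x :: s2) = links (rcons s1 x) ++ links (x :: s2).
Proof.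
case: s1 => [|y s1] //=; rewrite -cat1s catA cats1 pairmap_cat last_rcons.
by case: s2 => //=; rewrite !cats0.
Qed.

(** A vertex strictly between two consecutive feet cuts the path as an
    extra plain spoke would, which is how the tile below a chord is split at
    the apex of a Triangle. *)
Lemma tile_path_split x y m : foot x < m < foot y ->
  links (tile_path x y) = links (tile_path x (plain m)) ++ links (tile_path (plain m) y).
Proof.
case: x y => [[w k1] k2] [[w' k1'] k2'] /=; rewrite /foot /= => hm.
rewrite /tile_path /gap_path /foot /=.
have -> : iota w.+1 (w' - w).-1 = iota w.+1 (m - w).-1 ++ m :: iota m.+1 (w' - m).-1.
  have -> : (w' - w).-1 = (m - w).-1 + (w' - m).-1.+1 by lia.
  by rewrite iotaD (_ : w.+1 + (m - w).-1 = m) //; lia.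
transitivity (links ((w :: seq_of_opt k1 ++ iota w.+1 (m - w).-1) ++
  m :: iota m.+1 (w' - m).-1 ++ seq_of_opt k2' ++ [:: w'])).
  by rewrite /= -!catA.
by rewrite links_cat -cats1 /= -catA.
Qed.

Section Covering.
Variables (n : nat) (B : nat -> nat -> bool).
Hypothesis B_mono : forall i a b j, i <= a -> a < b -> b <= j -> j <= n -> B a b -> B i j.
Hypothesis B_disj : forall i k j, i < k -> k < j -> j <= n -> B i k -> B k j -> False.

Definition hit (e : nat * nat) : bool := B (minn e.1 e.2) (maxn e.1 e.2).
Definition odd_path (s : seq nat) : bool := odd (count hit (links s)).
Definition odd_triangle (t : nat * nat * nat) : bool :=
  B t.1.1 t.1.2 (+) B t.1.2 t.2 (+) B t.1.1 t.2.

(** For a fixed point q of the plane, B i j will say that q lies in the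
    triangle on the tip and the chord (i, j).  The tiles on the tip side of the
    chord (a, b) and the triangle p, a, b then cover q equally often: each
    constructor replaces B a b by the parity of one tile plus the values of B
    for the chords that remain. *)
Lemma cover_count d a : a + width d <= n ->
  count odd_path (tips d a) + count odd_triangle (triangles d a) = B a (a + width d).
Proof.
have hitE u v : u < v -> hit (u, v) = B u v.
  by move=> h; rewrite /hit /= (minn_idPl (ltnW h)) (maxn_idPr (ltnW h)).
have hitE' u v : u < v -> hit (v, u) = B u v.
  by move=> h; rewrite /hit /= (minn_idPr (ltnW h)) (maxn_idPl (ltnW h)).
have pairmap_rcons x s y :
    pairmap tile_path x (rcons s y) = rcons (pairmap tile_path x s) (tile_path (last x s) y).
  by rewrite -cats1 pairmap_cat cats1.
elim: d a => [|d1 h1 d2 h2|d h|d h|d1 h1 d2 h2] a /= hn.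
- rewrite /tips /= /odd_path /tile_path /gap_path /foot /= addn1 subSn // subnn /=.
  by rewrite hitE // !addn0; case: B.
- have {}h1 := h1 a ltac:(lia); have {}h2 := h2 (a + width d1) ltac:(lia).
  have g1 := width_gt0 d1; have g2 := width_gt0 d2.
  move: h1; rewrite /tips /= pairmap_rcons -cats1 count_cat /= addn0 => h1.
  move: h2; rewrite /tips /= => h2; rewrite rcons_cat pairmap_cat (addnA a).
  set m := a + width d1 in h1 h2 *; set b := m + width d2 in h2 *.
  set X := last _ (spokes d1 a) in h1 *.
  have hX : foot X < m.
    by have := spokes_path d1 a; rewrite rcons_path -[a in last a _]/(foot (plain a)) last_map => /andP[].
  have [y [s [hs hy]]] : exists y s, rcons (spokes d2 m) (plain b) = y :: s /\ m < foot y.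
    have := spokes_path d2 m; rewrite -/b -[b in rcons _ b]/(foot (plain b)) -map_rcons.
    by case: rcons (size_rcons (spokes d2 m) (plain b)) => // y s _ /= /andP[hy _]; exists y, s.
  move: h2; rewrite hs /= => h2.
  have e : odd_path (tile_path X y) = odd_path (tile_path X (plain m)) (+) odd_path (tile_path (plain m) y).
    by rewrite /odd_path (@tile_path_split _ _ m) ?hX // count_cat oddD.
  rewrite !count_cat /= e {e}.
  move: h1 h2; set c2 := count _ (pairmap _ y s); set c1 := count _ (pairmap _ _ _).
  set t1 := count _ _; set t2 := count _ _.
  rewrite /odd_triangle /=.
  have d12 : B a m -> B m b -> False by apply: B_disj; lia.
  have m1 : B a m -> B a b by apply: B_mono; lia.
  have m2 : B m b -> B a b by apply: B_mono; lia.
  case: (odd_path _); case: (odd_path _); move: d12 m1 m2;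
   case: (B a m); case: (B m b); case: (B a b) => //= d12 m1 m2;
   try (by case: d12); try (by have := m1 isT); try (by have := m2 isT); lia.
- have g := width_gt0 d.
  have {}h := h a.+1 ltac:(lia); move: h.
  rewrite /tips /= addSnnS; set b := a + (width d).+1.
  set y := (_, _, _).
  have -> : pairmap tile_path y (rcons (spokes d a.+1) (plain b)) =
            pairmap tile_path (plain a.+1) (rcons (spokes d a.+1) (plain b)).
    by case: (spokes d a.+1).
  have -> : odd_path (tile_path (plain a) y) = B a b (+) B a.+1 b.
    rewrite /odd_path /tile_path /gap_path /y /foot /= subSn // subnn /=.
    by rewrite hitE ?hitE' /b; try lia; rewrite addn0 oddD !oddb.
  have m1 : B a.+1 b -> B a b by apply: B_mono; lia.
  by move=> h; rewrite -addnA h; move: m1; case: (B a b); case: (B a.+1 b) => // /(_ isT).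
- have g := width_gt0 d.
  have {}h := h a ltac:(lia); move: h; rewrite /tips /= => h.
  rewrite pairmap_rcons last_rcons.
  have -> : pairmap tile_path (plain a) (rcons (spokes d a) (a + width d, Some a, None)) =
            pairmap tile_path (plain a) (rcons (spokes d a) (plain (a + width d))).
    by rewrite !pairmap_rcons.
  set y := (_, _, _); rewrite -(cats1 _ (tile_path y _)) count_cat /= addn0.
  have -> : odd_path (tile_path y (plain (a + (width d).+1))) = B a (a + width d) (+) B a (a + (width d).+1).
    rewrite /odd_path /tile_path /gap_path /y /foot /= (_ : (a + (width d).+1 - _).-1 = 0) /=; last by lia.
    by rewrite (hitE' a) ?(hitE a); try lia; rewrite addn0 oddD !oddb.
  have m1 : B a (a + width d) -> B a (a + (width d).+1) by apply: B_mono; lia.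
  rewrite addnAC h; move: m1.
  by case: (B a (a + width d)); case: (B a (a + (width d).+1)) => // /(_ isT).
- have {}h1 := h1 a ltac:(lia); have {}h2 := h2 (a + (width d1).+1) ltac:(lia).
  have g1 := width_gt0 d1; have g2 := width_gt0 d2.
  move: h1 h2; rewrite /tips /= (_ : a + (width d1).+1 + width d2 = a + (width d1 + width d2).+1); last by lia.
  set m := a + width d1; set b := a + (width d1 + width d2).+1; rewrite addnS -/m.
  set y := (m, Some a, None); set z := (m.+1, None, Some b) => h1 h2.
  rewrite rcons_cat pairmap_cat /= !count_cat /=.
  have -> : pairmap tile_path z (rcons (spokes d2 m.+1) (plain b)) =
            pairmap tile_path (plain m.+1) (rcons (spokes d2 m.+1) (plain b)).
    by case: (spokes d2 m.+1).
  move: h1; rewrite pairmap_rcons -cats1 count_cat /= addn0.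
  have -> : tile_path (last (plain a) (spokes d1 a)) y =
            tile_path (last (plain a) (spokes d1 a)) (plain m) by [].
  have -> : odd_path (tile_path y z) = B a m (+) B a b (+) B m.+1 b.
    rewrite /odd_path /tile_path /gap_path /y /z /foot /= subSn // subnn /=.
    by rewrite (hitE' a) ?(hitE a) ?(hitE' m.+1) /b /m; try lia; rewrite addn0 !oddD !oddb addbA.
  have [am mb bn] : [/\ a < m, m.+1 < b & b <= n] by rewrite /m /b; split; lia.
  have d12 : B a m -> B m.+1 b -> False.
    move=> u v; have w : B m b by apply: B_mono v; rewrite ?leqnSn.
    by apply: (B_disj am _ bn u w); apply: ltnW.
  have m1 : B a m -> B a b by apply: B_mono; lia.
  have m2 : B m.+1 b -> B a b by apply: B_mono; lia.
  move: h2 d12 m1 m2; case: (B a m); case: (B m.+1 b); case: (B a b) => //= h2 d12 m1 m2;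
   try (by case: d12); try (by have := m1 isT); try (by have := m2 isT); lia.
Qed.

End Covering.

(** Each constructor other than Triangle uses up the interior points that it
    separates as feet of spokes. *)
Lemma triangle_apex d a v : a < v < a + width d -> v \notin map foot (spokes d a) ->
  exists i j, (i, v, j) \in triangles d a.
Proof.
elim: d a => /= [|d1 h1 d2 h2|d h|d h|d1 h1 d2 h2] a; first by lia.
- rewrite map_cat mem_cat negb_or => hv /andP[n1 n2].
  have [e|ne] := eqVneq v (a + width d1).
    by exists a, (a + (width d1 + width d2)); rewrite -e mem_head.
  case: (ltnP v (a + width d1)) => c.
    have [|i [j hij]] := h1 a _ n1; first by lia.
    by exists i, j; rewrite inE mem_cat hij orbT.
  have [|i [j hij]] := h2 (a + width d1) _ n2; first by lia.
  by exists i, j; rewrite inE mem_cat hij !orbT.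
- by rewrite inE negb_or /foot /= => hv /andP[n1]; apply: h; lia.
- by rewrite map_rcons mem_rcons inE negb_or /foot /= => hv /andP[n1]; apply: h; lia.
- rewrite map_cat mem_cat /= !inE !negb_or /foot /= => hv /and4P[n1 n3 n4 n2].
  case: (ltnP v (a + width d1)) => c.
    have [|i [j hij]] := h1 a _ n1; first by lia.
    by exists i, j; rewrite mem_cat hij.
  have [|i [j hij]] := h2 (a + (width d1).+1) _ n2; first by lia.
  by exists i, j; rewrite mem_cat hij orbT.
Qed.

Lemma triangle_chords d a i k j : (i, k, j) \in triangles d a ->
  [/\ (i, k) \in chords d a, (k, j) \in chords d a & (i, j) \in chords d a].
Proof.
elim: d a => //= [d1 h1 d2 h2|d h|d h|d1 h1 d2 h2] a; rewrite ?inE ?mem_cat.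
- case/or3P => [/eqP[-> -> ->]|/h1[-> -> ->]|/h2[-> -> ->]]; rewrite ?orbT //.
  split; rewrite ?inE ?mem_cat ?eqxx // ?chords_root ?orbT //.
  by rewrite addnA chords_root !orbT.
- by case/h => -> -> ->; rewrite !orbT.
- by case/h => -> -> ->; rewrite !orbT.
- by case/orP => [/h1[-> -> ->]|/h2[-> -> ->]]; rewrite ?orbT //.
Qed.

(** All chords at the foot of a spoke lie on one side; this is what makes
    the foot pointed. *)
Definition left_spoke d a w k : Prop :=
  [/\ a <= k, k < w, (k, w) \in chords d a & forall j, (w, j) \notin chords d a].
Definition right_spoke d a w k : Prop :=
  [/\ w < k, k <= a + width d, (w, k) \in chords d a & forall i, (i, w) \notin chords d a].

Lemma spoke_sides d a x : x \in spokes d a ->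
  exists k, (x = (foot x, Some k, None) /\ left_spoke d a (foot x) k) \/
            (x = (foot x, None, Some k) /\ right_spoke d a (foot x) k).
Proof.
have nb d' a' i j : [|| i < a', j <= i | a' + width d' < j] -> (i, j) \notin chords d' a'.
  by move=> h; apply/negP => /chords_bound[]; lia.
elim: d a => //= [d1 h1 d2 h2|d h|d h|d1 h1 d2 h2] a.
- rewrite mem_cat; have g1 := width_gt0 d1; have g2 := width_gt0 d2.
  case/orP => hx; have := foot_bound hx => fb.
    have [k [[e [b1 b2 b3 b4]]|[e [b1 b2 b3 b4]]]] := h1 _ hx; exists k; [left|right]; split=> //.
      split=> //=; rewrite ?inE ?mem_cat ?b3 ?orbT // => j.
      by rewrite inE mem_cat !negb_or b4 xpair_eqE nb ?andbT /=; lia.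
    split=> //=; rewrite ?inE ?mem_cat ?b3 ?orbT //; try lia; move=> j.
    by rewrite inE mem_cat !negb_or b4 xpair_eqE nb ?andbT /=; lia.
  have [k [[e [b1 b2 b3 b4]]|[e [b1 b2 b3 b4]]]] := h2 _ hx; exists k; [left|right]; split=> //.
    split=> //=; rewrite ?inE ?mem_cat ?b3 ?orbT //; try lia; move=> j.
    by rewrite inE mem_cat !negb_or b4 xpair_eqE nb ?andbT /=; lia.
  split=> //=; rewrite ?inE ?mem_cat ?b3 ?orbT //; try lia; move=> j.
  by rewrite inE mem_cat !negb_or b4 xpair_eqE nb ?andbT /=; lia.
- have g := width_gt0 d; rewrite inE => /orP[/eqP->|hx].
    exists (a + (width d).+1); right; split=> //; rewrite /foot /=; split=> /=.
    + by lia.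
    + by lia.
    + by rewrite inE -addSnnS chords_root orbT.
    + by move=> i; rewrite inE xpair_eqE negb_or nb ?andbT; lia.
  have := foot_bound hx => fb.
  have [k [[e [b1 b2 b3 b4]]|[e [b1 b2 b3 b4]]]] := h _ hx; exists k; [left|right]; split=> //.
    split=> //=; rewrite ?inE ?b3 ?orbT //; try lia; move=> j.
    by rewrite inE xpair_eqE negb_or b4 andbT; lia.
  split=> //=; rewrite ?inE ?b3 ?orbT //; try lia; move=> j.
  by rewrite inE xpair_eqE negb_or b4 andbT; lia.
- have g := width_gt0 d; rewrite mem_rcons inE => /orP[/eqP->|hx].
    exists a; left; split=> //; rewrite /foot /=; split=> /=.
    + by lia.
    + by lia.
    + by rewrite inE chords_root orbT.
    + by move=> i; rewrite inE xpair_eqE negb_or nb ?andbT; lia.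
  have := foot_bound hx => fb.
  have [k [[e [b1 b2 b3 b4]]|[e [b1 b2 b3 b4]]]] := h _ hx; exists k; [left|right]; split=> //.
    split=> //=; rewrite ?inE ?b3 ?orbT //; try lia; move=> j.
    by rewrite inE xpair_eqE negb_or b4 andbT; lia.
  split=> //=; rewrite ?inE ?b3 ?orbT //; try lia; move=> j.
  by rewrite inE xpair_eqE negb_or b4 andbT; lia.
- have g1 := width_gt0 d1; have g2 := width_gt0 d2.
  rewrite mem_cat !inE => /or4P[hx|/eqP->|/eqP->|hx].
  + have := foot_bound hx => fb.
    have [k [[e [b1 b2 b3 b4]]|[e [b1 b2 b3 b4]]]] := h1 _ hx; exists k; [left|right]; split=> //.
      split=> //=; rewrite ?inE ?mem_cat ?b3 ?orbT // => j.
      by rewrite inE mem_cat !negb_or b4 xpair_eqE nb ?andbT /=; lia.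
    split=> //=; rewrite ?inE ?mem_cat ?b3 ?orbT //; try lia; move=> j.
    by rewrite inE mem_cat !negb_or b4 xpair_eqE nb ?andbT /=; lia.
  + exists a; left; split=> //; rewrite /foot /=; split=> /=; try lia.
      by rewrite inE mem_cat chords_root !orbT.
    by move=> j; rewrite inE mem_cat !negb_or xpair_eqE !nb ?andbT /=; lia.
  + exists (a + (width d1 + width d2).+1); right; split=> //; rewrite /foot /=; split=> /=; try lia.
      rewrite inE mem_cat (_ : a + (width d1 + width d2).+1 = a + (width d1).+1 + width d2); last by lia.
      by rewrite chords_root !orbT.
    by move=> j; rewrite inE mem_cat !negb_or xpair_eqE !nb ?andbT /=; lia.
  + have := foot_bound hx => fb.
    have [k [[e [b1 b2 b3 b4]]|[e [b1 b2 b3 b4]]]] := h2 _ hx; exists k; [left|right]; split=> //.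
      split=> //=; rewrite ?inE ?mem_cat ?b3 ?orbT //; try lia; move=> j.
      by rewrite inE mem_cat !negb_or b4 xpair_eqE nb ?andbT /=; lia.
    split=> //=; rewrite ?inE ?mem_cat ?b3 ?orbT //; try lia; move=> j.
    by rewrite inE mem_cat !negb_or b4 xpair_eqE nb ?andbT /=; lia.
Qed.

Lemma consecutive_spokes (T : eqType) (f : spoke -> spoke -> T) (x0 : spoke) (s : seq spoke) t :
  path ltn (foot x0) (map foot s) -> t \in pairmap f x0 s ->
  exists x y, [/\ t = f x y, foot x < foot y, x \in x0 :: s, y \in s &
    forall z, z \in x0 :: s -> foot z <= foot x \/ foot y <= foot z].
Proof.
elim: s x0 => //= y s IH x0 /andP[hxy hp]; rewrite inE => /orP[/eqP->|ht].
  exists x0, y; rewrite !mem_head; split=> // z; rewrite inE => /orP[/eqP->|]; first by left.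
  rewrite inE => /orP[/eqP->|hz]; right=> //; apply: ltnW.
  have tr : transitive ltn by move=> ? ? ?; apply: ltn_trans.
  by move/(order_path_min tr)/allP: hp; apply; apply: map_f.
have [x [y' [e h hx hy' hz]]] := IH y hp ht.
exists x, y'; split=> //; [by rewrite inE hx orbT|by rewrite inE hy' orbT|].
move=> z; rewrite inE => /orP[/eqP->|]; last exact: hz.
left; move: hx; rewrite inE => /orP[/eqP->|hx]; first exact: ltnW.
have tr : transitive ltn by move=> ? ? ?; apply: ltn_trans.
have : path ltn (foot x0) (map foot (y :: s)) by rewrite /= hxy.
by move/(order_path_min tr)/allP => h'; apply: ltnW (h' _ _); apply: map_f; rewrite inE hx orbT.
Qed.

Lemma spokes_walk d a :
  path ltn (foot (plain a)) (map foot (rcons (spokes d a) (plain (a + width d)))).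
Proof. by rewrite map_rcons; apply: spokes_path. Qed.

Lemma tips_spokes d a s : s \in tips d a ->
  exists x y, [/\ s = tile_path x y, foot x < foot y,
    x = plain a \/ x \in spokes d a, y = plain (a + width d) \/ y \in spokes d a &
    forall z, z \in spokes d a -> foot z <= foot x \/ foot y <= foot z].
Proof.
move=> hs; have [x [y [e h hx hy hz]]] := consecutive_spokes (spokes_walk d a) hs.
exists x, y; split=> //.
- move: hx; rewrite inE mem_rcons inE => /or3P[/eqP|/eqP ex|]; [by left| |by right].
  move: hy h; rewrite ex mem_rcons inE => /orP[/eqP->|/foot_bound]; rewrite /foot /=; lia.
- by move: hy; rewrite mem_rcons inE => /orP[/eqP|]; [left|right].
- by move=> z hz'; apply: hz; rewrite inE mem_rcons inE hz' !orbT.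
Qed.

Lemma tips_cover d a v : a <= v <= a + width d ->
  exists x y, tile_path x y \in tips d a /\ foot x <= v <= foot y.
Proof.
rewrite /tips => /andP[hv1 hv2].
have : v <= foot (last (plain a) (rcons (spokes d a) (plain (a + width d)))).
  by rewrite last_rcons.
have : rcons (spokes d a) (plain (a + width d)) != [::] by case: (spokes d a).
move: hv1; rewrite -{1}[a]/(foot (plain a)).
move: (rcons _ _) (plain a) => s; elim: s {hv2} => //= y s IH x hx _ hv.
case: (leqP v (foot y)) => hy; first by exists x, y; rewrite inE eqxx hx hy.
case: s IH hv => [|z s] IH hv; first by move: hv; rewrite /= leqNgt hy.
have [x' [y' [h1 h2]]] := IH y (ltnW hy) isT hv.
by exists x', y'; rewrite inE h1 orbT.
Qed.

(** The links of all tiles at the tip, listed by recursion on the dissection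
    so that they can be compared with the chords. *)
Fixpoint tip_links (d : dissection) (a : nat) : seq (nat * nat) :=
  match d with
  | Edge => [:: (a, a.+1)]
  | Triangle d1 d2 => tip_links d1 a ++ tip_links d2 (a + width d1)
  | OpenLeft d1 => [:: (a, a + (width d1).+1); (a + (width d1).+1, a.+1)] ++ tip_links d1 a.+1
  | OpenRight d1 => tip_links d1 a ++ [:: (a + width d1, a); (a, a + (width d1).+1)]
  | OpenMiddle d1 d2 => tip_links d1 a ++
      [:: (a + width d1, a); (a, a + (width d1 + width d2).+1);
          (a + (width d1 + width d2).+1, a + (width d1).+1)] ++ tip_links d2 (a + (width d1).+1)
  end.

Arguments tile_path : simpl never.
Arguments links : simpl never.

Lemma tips_links d a : flatten (map links (tips d a)) = tip_links d a.
Proof.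
have pairmap_rcons x s y :
    pairmap tile_path x (rcons s y) = rcons (pairmap tile_path x s) (tile_path (last x s) y).
  by rewrite -cats1 pairmap_cat cats1.
have fr s t : flatten (map links (rcons s t)) = flatten (map links s) ++ links t.
  by rewrite map_rcons -cats1 flatten_cat /= cats0.
elim: d a => [|d1 h1 d2 h2|d h|d h|d1 h1 d2 h2] a /=.
- by rewrite /tips /= /links /tile_path /gap_path /foot /= addn1 subSn // subnn.
- rewrite -h1 -h2 /tips /=.
  have g1 := width_gt0 d1; have g2 := width_gt0 d2.
  rewrite rcons_cat pairmap_cat (addnA a) [pairmap _ _ (rcons (spokes d1 a) _)]pairmap_rcons fr.
  set m := a + width d1; set b := m + width d2.
  set X := last _ (spokes d1 a).
  have hX : foot X < m.
    by have := spokes_path d1 a; rewrite rcons_path -[a in last a _]/(foot (plain a)) last_map => /andP[].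
  have [y [s [hs hy]]] : exists y s, rcons (spokes d2 m) (plain b) = y :: s /\ m < foot y.
    have := spokes_path d2 m; rewrite -/b -[b in rcons _ b]/(foot (plain b)) -map_rcons.
    by case: rcons (size_rcons (spokes d2 m) (plain b)) => // y s _ /= /andP[hy _]; exists y, s.
  rewrite hs /= map_cat flatten_cat /=. rewrite (@tile_path_split _ _ m) ?hX // -!catA.
  by rewrite -/X.
- rewrite -h /tips /= -addSnnS.
  set b := a.+1 + width d; set y := (_, _, _).
  have -> : pairmap tile_path y (rcons (spokes d a.+1) (plain b)) =
            pairmap tile_path (plain a.+1) (rcons (spokes d a.+1) (plain b)).
    by case: (spokes d a.+1).
  by rewrite /links /tile_path /gap_path /y /foot /= subSn // subnn.
- rewrite -h /tips /= pairmap_rcons last_rcons fr; congr (_ ++ _).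
    by rewrite !pairmap_rcons.
  by rewrite /links /tile_path /gap_path /foot /= (_ : (a + (width d).+1 - _).-1 = 0) //; lia.
- rewrite -h1 -h2 /tips /= (_ : a + (width d1).+1 + width d2 = a + (width d1 + width d2).+1); last by lia.
  set m := a + width d1; set b := a + (width d1 + width d2).+1; rewrite addnS -/m.
  set y := (m, Some a, None); set z := (m.+1, None, Some b).
  rewrite rcons_cat pairmap_cat [pairmap _ _ (rcons (spokes d1 a) _)]pairmap_rcons fr /= map_cat flatten_cat /=.
  have -> : pairmap tile_path z (rcons (spokes d2 m.+1) (plain b)) =
            pairmap tile_path (plain m.+1) (rcons (spokes d2 m.+1) (plain b)).
    by case: (spokes d2 m.+1).
  by rewrite /links /tile_path /gap_path /y /z /foot /= subSn // subnn /= -catA.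
Qed.

Definition ordered (e : nat * nat) : nat * nat := (minn e.1 e.2, maxn e.1 e.2).

Lemma tip_links_chords d a e : e \in tip_links d a -> ordered e \in chords d a.
Proof.
have o1 u v : u < v -> ordered (u, v) = (u, v).
  by move=> h; rewrite /ordered /= (minn_idPl (ltnW h)) (maxn_idPr (ltnW h)).
have o2 u v : u < v -> ordered (v, u) = (u, v).
  by move=> h; rewrite /ordered /= (minn_idPr (ltnW h)) (maxn_idPl (ltnW h)).
elim: d a => /= [|d1 h1 d2 h2|d h|d h|d1 h1 d2 h2] a.
- by rewrite inE => /eqP->; rewrite o1 // mem_head.
- by rewrite mem_cat => /orP[/h1|/h2] h; rewrite inE mem_cat h ?orbT.
- have g := width_gt0 d.
  rewrite !inE => /or3P[/eqP->|/eqP->|/h ->]; rewrite ?orbT // ?(o1 a) ?(o2 a.+1) ?eqxx //; try lia.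
  by rewrite -addSnnS chords_root orbT.
- have g := width_gt0 d.
  rewrite mem_cat !inE => /or3P[/h ->|/eqP->|/eqP->]; rewrite ?orbT // ?(o1 a) ?(o2 a) ?eqxx //; try lia.
  by rewrite chords_root orbT.
- have g1 := width_gt0 d1; have g2 := width_gt0 d2.
  rewrite mem_cat !inE mem_cat => /or3P[/h1->|/eqP->|/or3P[/eqP->|/eqP->|/h2->]]; rewrite ?orbT //.
  + by rewrite o2 ?chords_root ?orbT //; lia.
  + by rewrite o1 ?eqxx //; lia.
  + rewrite o2; last by lia.
    by rewrite (_ : a + (width d1 + width d2).+1 = a + (width d1).+1 + width d2) ?chords_root ?orbT //; lia.
Qed.

(** Every chord is a side of the tile on its tip side. *)
Lemma chords_tip_links d a i j : (i, j) \in chords d a ->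
  [\/ (i, j) \in tip_links d a, (j, i) \in tip_links d a |
      exists u k v, (u, k, v) \in triangles d a /\ (i, j) \in [:: (u, k); (k, v); (u, v)]].
Proof.
elim: d a => /= [|d1 h1 d2 h2|d h|d h|d1 h1 d2 h2] a.
- by move=> h; apply: Or31.
- rewrite inE mem_cat => /or3P[/eqP[-> ->]|/h1|/h2].
  + apply: Or33; exists a, (a + width d1), (a + (width d1 + width d2)).
    by rewrite !inE !eqxx !orbT.
  + case=> [hh|hh|[u [k [v [h h']]]]]; [by apply: Or31; rewrite mem_cat hh|by apply: Or32; rewrite mem_cat hh|].
    by apply: Or33; exists u, k, v; rewrite inE mem_cat h orbT.
  + case=> [hh|hh|[u [k [v [h h']]]]]; [by apply: Or31; rewrite mem_cat hh orbT|by apply: Or32; rewrite mem_cat hh orbT|].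
    by apply: Or33; exists u, k, v; rewrite inE mem_cat h !orbT.
- rewrite inE => /orP[/eqP[-> ->]|/h]; first by apply: Or31; rewrite mem_head.
  case=> [h'|h'|[u [k [v [h1 h2]]]]]; [by apply: Or31; rewrite !inE h' !orbT|by apply: Or32; rewrite !inE h' !orbT|].
  by apply: Or33; exists u, k, v.
- rewrite inE => /orP[/eqP[-> ->]|/h]; first by apply: Or31; rewrite mem_cat !inE eqxx !orbT.
  case=> [h'|h'|[u [k [v [h1 h2]]]]]; [by apply: Or31; rewrite mem_cat h'|by apply: Or32; rewrite mem_cat h'|].
  by apply: Or33; exists u, k, v.
- rewrite inE mem_cat => /or3P[/eqP[-> ->]|/h1|/h2].
  + by apply: Or31; rewrite mem_cat !inE eqxx !orbT.
  + case=> [h'|h'|[u [k [v [h3 h4]]]]]; [by apply: Or31; rewrite mem_cat h'|by apply: Or32; rewrite mem_cat h'|].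
    by apply: Or33; exists u, k, v; rewrite mem_cat h3.
  + case=> [h'|h'|[u [k [v [h3 h4]]]]]; [by apply: Or31; rewrite mem_cat !inE h' !orbT|by apply: Or32; rewrite mem_cat !inE h' !orbT|].
    by apply: Or33; exists u, k, v; rewrite mem_cat h3 orbT.
Qed.


(** The last neighbour of the left end a before b, and the first neighbour
    of the right end b after a, along the chords.  By apexesP both can be read
    off from the chords, and together they reveal the constructor at the root
    and where it splits. *)
Definition apexes (d : dissection) (a : nat) : option nat * option nat :=
  match d with
  | Edge => (None, None)
  | Triangle d1 _ => (Some (a + width d1), Some (a + width d1))
  | OpenLeft _ => (None, Some a.+1)
  | OpenRight d1 => (Some (a + width d1), None)
  | OpenMiddle d1 _ => (Some (a + width d1), Some (a + (width d1).+1))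
  end.

Definition is_extremum (le : rel nat) (S : pred nat) (o : option nat) : Prop :=
  if o is Some m then S m /\ (forall k, S k -> le k m) else forall k, ~~ S k.

Lemma is_extremum_inj le S S' o o' : antisymmetric le -> S =1 S' ->
  is_extremum le S o -> is_extremum le S' o' -> o = o'.
Proof.
move=> ale eS; case: o => [m|] /=; case: o' => [m'|] //=.
- move=> [h1 h2] [h3 h4]; congr Some; apply: ale.
  by rewrite h4 ?h2 // -?eS // eS.
- by move=> [h1 _] h2; move: (h2 m); rewrite -eS h1.
- by move=> h2 [h1 _]; move: (h2 m'); rewrite eS h1.
Qed.

Lemma apexesP d a :
  is_extremum leq (fun k => (k < a + width d) && ((a, k) \in chords d a)) (apexes d a).1 /\
  is_extremum geq (fun k => (a < k) && ((k, a + width d) \in chords d a)) (apexes d a).2.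
Proof.
have nb d0 a' i j : [|| i < a', j <= i | a' + width d0 < j] -> ((i, j) \in chords d0 a') = false.
  by move=> h; apply/negbTE/negP => /chords_bound[]; lia.
case: d => [|d1 d2|d1|d1|d1 d2] /=; try (have g1 := width_gt0 d1); try (have g2 := width_gt0 d2).
- by split=> k; rewrite inE xpair_eqE; lia.
- rewrite !inE !mem_cat chords_root addnA chords_root !orbT; split; split; try lia; move=> k.
    rewrite inE mem_cat xpair_eqE (nb d2); last by lia.
    by case: (boolP (_ \in _)) => [/chords_bound[]|]; lia.
  rewrite inE mem_cat xpair_eqE (nb d1); last by lia.
  by case: (boolP (_ \in _)) => [/chords_bound[]|]; lia.
- split.
    by move=> k; rewrite inE xpair_eqE (nb d1); lia.
  rewrite inE -addSnnS chords_root orbT; split; first by lia.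
  by move=> k; rewrite inE xpair_eqE /geq /=; lia.
- split; last by move=> k; rewrite inE xpair_eqE (nb d1); lia.
  rewrite inE chords_root orbT; split; first by lia.
  move=> k; rewrite inE xpair_eqE.
  by case: (boolP (_ \in _)) => [/chords_bound[]|]; lia.
- rewrite !inE !mem_cat chords_root (_ : a + (width d1 + width d2).+1 = a + (width d1).+1 + width d2); last by lia.
  rewrite chords_root !orbT; split; split; try lia; move=> k.
    rewrite inE mem_cat xpair_eqE (nb d2); last by lia.
    by case: (boolP (_ \in _)) => [/chords_bound[]|]; lia.
  rewrite inE mem_cat xpair_eqE (nb d1); last by lia.
  by case: (boolP (_ \in _)) => [/chords_bound[]|]; rewrite /geq /=; lia.
Qed.

Lemma apexes_ext d d' a : width d = width d' -> chords d a =i chords d' a ->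
  apexes d a = apexes d' a.
Proof.
move=> hw hc; have [l1 r1] := apexesP d a; have [l2 r2] := apexesP d' a.
rewrite [LHS]surjective_pairing [RHS]surjective_pairing; congr pair.
  by apply: is_extremum_inj l1 l2 => [|k]; rewrite ?hw ?hc //; apply: anti_leq.
apply: is_extremum_inj r1 r2 => [x y|k]; last by rewrite hw hc.
by rewrite /geq /= andbC; apply: anti_leq.
Qed.

(** The root constructor and its split point are read off from apexes, and
    the chords of each part are the ones inside its interval. *)
Lemma chords_inj d d' a : width d = width d' -> chords d a =i chords d' a -> d = d'.
Proof.
have bd d0 a' i j : (i, j) \in chords d0 a' -> [&& a' <= i, i < j & j <= a' + width d0].
  by move/chords_bound=> [-> -> ->].
have sub d1 d1' a' (P : pred (nat * nat)) : (forall e, P e -> (e \in chords d1 a') = (e \in chords d1' a')) ->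
    (forall e, e \in chords d1 a' -> P e) -> (forall e, e \in chords d1' a' -> P e) ->
    chords d1 a' =i chords d1' a'.
  by move=> h p1 p2 e; apply/idP/idP => he; [rewrite -h ?p1|rewrite h ?p2].
elim: d d' a => [|d1 h1 d2 h2|d h|d h|d1 h1 d2 h2] d' a hw hc;
  have := apexes_ext hw hc; case: d' hw hc => [|e1 e2|e|e|e1 e2] //=;
  try (have g1 := width_gt0 d1); try (have g2 := width_gt0 d2);
  try (have g3 := width_gt0 e1); try (have g4 := width_gt0 e2);
  try (have g5 := width_gt0 d); try (have g6 := width_gt0 e); move=> hw hc //=;
  try (by lia); try (by case; lia).
- case=> e0; have e : width d1 = width e1 by lia.
  have e' : width d2 = width e2 by lia.
  have c1 : chords d1 a =i chords e1 a.
    apply: (sub _ _ _ (fun e0 => e0.2 <= a + width d1)).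
    + move=> [i j] /= hj; have := hc (i, j); rewrite !inE !mem_cat !xpair_eqE.
      rewrite [j == _]ltn_eqF ?andbF /=; last by lia.
      rewrite [j == _]ltn_eqF ?andbF /=; last by lia.
      have z d0 : ((i, j) \in chords d0 (a + width d1)) = false by apply/negbTE/negP => /bd; lia.
      by rewrite -e !z !orbF.
    + by move=> [i j] /bd /=; lia.
    + by move=> [i j] /bd /=; lia.
  have c2 : chords d2 (a + width d1) =i chords e2 (a + width d1).
    apply: (sub _ _ _ (fun e0 => a + width d1 <= e0.1)).
    + move=> [i j] /= hj; have := hc (i, j); rewrite !inE !mem_cat !xpair_eqE -e.
      rewrite [i == _]gtn_eqF /=; last by lia.
      have z d0 : width d0 = width d1 -> ((i, j) \in chords d0 a) = false.
        by move=> w0; apply/negbTE/negP => /bd; lia.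
      by rewrite !z.
    + by move=> [i j] /bd /=; lia.
    + by move=> [i j] /bd /=; lia.
  by rewrite (h1 _ _ e c1) (h2 _ _ e' c2).
- move=> _; have e' : width d = width e by lia.
  rewrite (h e a.+1 e') //; apply: (sub _ _ _ (fun e0 => a < e0.1)).
  + move=> [i j] /= hj; have := hc (i, j); rewrite !inE !xpair_eqE.
    by rewrite [i == _]gtn_eqF.
  + by move=> [i j] /bd /=; lia.
  + by move=> [i j] /bd /=; lia.
- move=> _; have e' : width d = width e by lia.
  rewrite (h e a e') //; apply: (sub _ _ _ (fun e0 => e0.2 <= a + width d)).
  + move=> [i j] /= hj; have := hc (i, j); rewrite !inE !xpair_eqE.
    rewrite [j == _]ltn_eqF ?andbF /=; last by lia.
    by rewrite [j == _]ltn_eqF ?andbF /=; last by lia.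
  + by move=> [i j] /bd /=; lia.
  + by move=> [i j] /bd /=; lia.
- case=> e0; have e : width d1 = width e1 by lia.
  have e' : width d2 = width e2 by lia.
  have c1 : chords d1 a =i chords e1 a.
    apply: (sub _ _ _ (fun e0 => e0.2 <= a + width d1)).
    + move=> [i j] /= hj; have := hc (i, j); rewrite !inE !mem_cat !xpair_eqE.
      rewrite [j == _]ltn_eqF ?andbF /=; last by lia.
      rewrite [j == _]ltn_eqF ?andbF /=; last by lia.
      have z d0 : ((i, j) \in chords d0 (a + (width d1).+1)) = false by apply/negbTE/negP => /bd; lia.
      by rewrite -e !z !orbF.
    + by move=> [i j] /bd /=; lia.
    + by move=> [i j] /bd /=; lia.
  have c2 : chords d2 (a + (width d1).+1) =i chords e2 (a + (width d1).+1).
    apply: (sub _ _ _ (fun e0 => a + width d1 < e0.1)).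
    + move=> [i j] /= hj; have := hc (i, j); rewrite !inE !mem_cat !xpair_eqE -e.
      rewrite [i == _]gtn_eqF /=; last by lia.
      have z d0 : width d0 = width d1 -> ((i, j) \in chords d0 a) = false.
        by move=> w0; apply/negbTE/negP => /bd; lia.
      by rewrite !z.
    + by move=> [i j] /bd /=; lia.
    + by move=> [i j] /bd /=; lia.
  by rewrite (h1 _ _ e c1) (h2 _ _ e' c2).
Qed.

(** * Parities over the edges of a polygon *)

Section CycleEdges.
Variable I : finType.
Implicit Types (s : seq I) (P : {set {set I}}) (C : {set I} -> bool).

Definition cycle_edges s : {set {set I}} := [set [set x; next s x] | x in s].

Definition parity P C : bool := \big[addb/false]_(e in P) C e.

(** The coboundary of a vertex labelling: on an edge, the sum of the labels of
    its two ends. *)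
Definition border (h : I -> bool) (e : {set I}) : bool := \big[addb/false]_(x in e) h x.

Definition neighbours P v u w : Prop :=
  [/\ u != w, u != v, w != v & forall x, ([set v; x] \in P) = (x == u) || (x == w)].

Definition two_regular P : Prop :=
  (forall e, e \in P -> exists u v, u != v /\ e = [set u; v]) /\
  (forall v, v \in cover P -> exists u w, neighbours P v u w).

Lemma cycle_edges_rot n s : uniq s -> cycle_edges (rot n s) = cycle_edges s.
Proof.
move=> us; apply/setP => e; apply/imsetP/imsetP => -[x hx ->]; exists x; rewrite ?next_rot //.
  by rewrite mem_rot in hx.
by rewrite mem_rot.
Qed.

Lemma cycle_edges_rev s : uniq s -> cycle_edges (rev s) = cycle_edges s.
Proof.
move=> us; apply/setP => e; apply/imsetP/imsetP => -[x hx ->].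
  exists (prev s x); first by rewrite mem_prev -mem_rev.
  by rewrite next_rev // next_prev // setUC.
exists (next s x); first by rewrite mem_rev mem_next.
by rewrite next_rev // prev_next // setUC.
Qed.

Definition edge_list x s : seq {set I} := pairmap (fun u v => [set u; v]) x s.

Lemma edge_list_nth x0 x s i : i < size s ->
  nth set0 (edge_list x s) i = [set nth x0 (x :: s) i; nth x0 s i].
Proof. by move=> h; rewrite (nth_pairmap x0). Qed.

Lemma cycle_edges_cons x s : uniq (x :: s) -> cycle_edges (x :: s) = [set e in edge_list x (rcons s x)].
Proof.
move=> us; apply/setP => e; rewrite inE.
have hn i : i < size (x :: s) -> next (x :: s) (nth x (x :: s) i) = nth x (rcons s x) i.
  move=> hi; rewrite next_nth mem_nth // index_uniq //.
  rewrite -(nth_rcons_default _ _ _).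
  by rewrite -cats1 nth_cat; case: ltnP => // h; rewrite nth_default //; case: (i - _) => [|[]].
apply/imsetP/idP => [[y hy ->]|].
  have hi : index y (x :: s) < size (x :: s) by rewrite index_mem.
  rewrite -{1 2}(nth_index x hy) hn //.
  apply/(nthP set0); exists (index y (x :: s)); first by rewrite size_pairmap size_rcons.
  rewrite (edge_list_nth x) ?size_rcons //; congr [set _; _].
  by rewrite -rcons_cons nth_rcons hi.
move=> /(nthP set0)[i]; rewrite size_pairmap size_rcons => hi <-.
exists (nth x (x :: s) i); first exact: mem_nth.
by rewrite hn // (edge_list_nth x) ?size_rcons // -rcons_cons nth_rcons hi.
Qed.

Lemma edge_list_sub x s e v : e \in edge_list x s -> v \in e -> v \in x :: s.
Proof.
elim: s x => //= y s IH x; rewrite inE => /orP[/eqP->|].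
  by rewrite !inE => /orP[->//|->]; rewrite orbT.
by move=> h1 h2; rewrite inE (IH _ h1 h2) orbT.
Qed.

Lemma cycle_edges_neighbours x y s : uniq (x :: y :: s) -> s != [::] ->
  neighbours (cycle_edges (x :: y :: s)) x y (last y s).
Proof.
move=> us hs; have hu := us; move: hu; rewrite /= inE negb_or => /and3P[/andP[xy xs] ys us'].
have hl : last y s \in s by case: s hs {us xs ys us'} => //= z s _; rewrite mem_last.
split; [by apply: contraNneq ys => ->|by rewrite eq_sym|by apply: contraNneq xs => <-|].
move=> v; rewrite cycle_edges_cons // inE rcons_cons -cats1 /edge_list /= pairmap_cat /= inE mem_cat mem_seq1.
have xe z : x != z -> ([set x; v] == [set x; z]) = (v == z).
  move=> xz; apply/eqP/eqP => [h|->] //.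
  have : z \in [set x; v] by rewrite h !inE eqxx orbT.
  by rewrite !inE eq_sym (negPf xz) => /eqP.
rewrite xe // (setUC [set last y s]) xe; last by apply: contraNneq xs => ->.
case: (boolP (_ \in pairmap _ y s)) => // h.
have : x \in [set x; v] by rewrite !inE eqxx.
by move=> /(edge_list_sub h); rewrite inE (negPf xy) (negPf xs).
Qed.

Lemma cover_cycle_edges s : cover (cycle_edges s) = [set x in s].
Proof.
apply/setP => v; rewrite /cover inE; apply/bigcupP/idP => [[e /imsetP[x hx ->]]|hv].
  by rewrite !inE => /orP[/eqP->|/eqP->] //; rewrite mem_next.
by exists [set v; next s v]; [apply/imsetP; exists v|rewrite !inE eqxx].
Qed.

Lemma cycle_two_regular s : uniq s -> 2 < size s -> two_regular (cycle_edges s).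
Proof.
move=> us hs; split=> [e /imsetP[x hx ->]|v].
  exists x, (next s x); split=> //.
  have [i s' hr] := rot_to hx.
  rewrite -(next_rot i us) hr; move: us hs; rewrite -(rot_uniq i) -(size_rot i s) hr.
  by case: s' {hr} => //= y s' /andP[]; rewrite inE negb_or eqxx => /andP[].
rewrite cover_cycle_edges inE => hv.
have [i s' hr] := rot_to hv; rewrite -(cycle_edges_rot i us).
move: us hs; rewrite -(rot_uniq i) -(size_rot i s) hr.
case: s' {hr} => [|y [|z s']] //= us _.
by exists y, (last y (z :: s')); apply: cycle_edges_neighbours.
Qed.

Lemma parity_card P C : parity P C = odd #|[set e in P | C e]|.
Proof.
rewrite -sum1_card (big_morph odd oddD (erefl : odd 0 = false)) /parity big_mkcond [RHS]big_mkcond.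
by apply: eq_bigr => e _; rewrite inE; case: ifP => //=; case: (C e).
Qed.

Lemma parityD P C C' : parity P (fun e => C e (+) C' e) = parity P C (+) parity P C'.
Proof. exact: big_split. Qed.

Lemma eq_parity P C C' : {in P, C =1 C'} -> parity P C = parity P C'.
Proof. by move=> h; apply: eq_bigr. Qed.

Lemma border2 h u v : u != v -> border h [set u; v] = h u (+) h v.
Proof. by move=> uv; rewrite /border big_setU1 ?inE //= big_set1. Qed.

Lemma parity_local P C v u w : two_regular P -> neighbours P v u w ->
  (forall e, e \in P -> v \notin e -> C e = false) ->
  parity P C = C [set v; u] (+) C [set v; w].
Proof.
move=> [he _] [uw uv wv hn] hC; rewrite /parity.
have hu : [set v; u] \in P by rewrite hn eqxx.
have hw : [set v; w] \in P by rewrite hn eqxx orbT.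
have ne : [set v; w] != [set v; u].
  apply/eqP => /setP/(_ u); rewrite !inE eqxx orbT (negPf uv) /= => /eqP e.
  by rewrite e eqxx in uw.
rewrite (bigD1 _ hu) /= (bigD1 [set v; w]) /=; last by apply/andP.
rewrite big1 ?addbF // => e /andP[/andP[heP' n1] n2]; have heP : e \in P by []; apply: hC => //.
apply/negP => hv; have [a [b [ab ee]]] := he _ heP.
have [x ex] : exists x, e = [set v; x].
  by move: hv; rewrite ee !inE => /orP[/eqP->|/eqP->]; [exists b|exists a; rewrite setUC].
have := hn x; rewrite -ex heP => /esym/orP[]/eqP ux; by move: n1 n2; rewrite ex ux ?eqxx.
Qed.

Lemma parity_away P C : (forall e, e \in P -> C e = false) -> parity P C = false.
Proof. by move=> h; rewrite /parity big1. Qed.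

(** Every vertex lies on none or two of the edges, so each label is
    counted an even number of times. *)
Lemma parity_border P h : two_regular P -> parity P (border h) = false.
Proof.
move=> tr; have [he hn] := tr.
rewrite /parity /border (exchange_big_dep predT) //= big1 // => x _.
case: (boolP (x \in cover P)) => hx; last first.
  by rewrite big1 // => e /andP[he' hx']; case/bigcupP: hx; exists e.
have [u [w hx']] := hn _ hx.
transitivity (parity P (fun e => (x \in e) && h x)).
  by rewrite /parity big_mkcondr; apply: eq_bigr => e _; case: (x \in e).
rewrite (parity_local tr hx') ?inE ?eqxx ?addbb // => e _ /negPf-> //.
Qed.

Lemma edge_list_uniq x s : uniq (x :: s) -> uniq (edge_list x s).
Proof.
elim: s x => //= y s IH x /andP[]; rewrite inE negb_or => /andP[xy xs] us.
rewrite IH // andbT; apply/negP => h.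
have := edge_list_sub h (_ : x \in [set x; y]); rewrite !inE eqxx => /(_ isT).
by rewrite (negPf xy) (negPf xs).
Qed.

Lemma parity_cycle x y s C : uniq (x :: y :: s) -> s != [::] ->
  parity (cycle_edges (x :: y :: s)) C =
  C [set x; y] (+) odd (count C (edge_list y s)) (+) C [set last y s; x].
Proof.
move=> us hs; have hu := us; move: hu; rewrite /= inE negb_or => /and3P[/andP[xy xs] ys us'].
have hl : last y s \in s by case: s hs {us xs ys us'} => //= z s _; rewrite mem_last.
rewrite /parity cycle_edges_cons // rcons_cons -cats1 /edge_list /= pairmap_cat /= -/(edge_list y s).
have hnx e : e \in edge_list y s -> x \notin e.
  by move=> h; apply/negP => /(edge_list_sub h); rewrite inE (negPf xy) (negPf xs).
have ul : uniq ([set x; y] :: edge_list y s ++ [:: [set last y s; x]]).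
  rewrite /= cat_uniq /= edge_list_uniq; last by rewrite /= ys.
  rewrite orbF !andbT mem_cat negb_or mem_seq1.
  apply/andP; split.
  - apply/andP; split; first by apply/negP => /hnx; rewrite !inE eqxx.
    apply/eqP => /setP/(_ y); rewrite !inE eqxx orbT [y == x]eq_sym (negPf xy) orbF => /esym/eqP h.
    by rewrite h hl in ys.
  - by apply/negP => /hnx; rewrite !inE eqxx orbT.
under eq_bigl => e do rewrite inE.
rewrite -big_uniq // big_cons big_cat /= big_cons big_nil addbF -addbA; congr (_ (+) (_ (+) _)).
by rewrite -sum1_count (big_morph odd oddD (erefl : odd 0 = false)) [RHS]big_mkcond /=;
  apply: eq_bigr => e _; case: (C e).
Qed.

End CycleEdges.

Local Open Scope ring_scope.

(** * Orientations in the plane *)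

Section Small.
Variable R : realType.
Implicit Types (Q : R -> Prop) (A B C : R).

Definition small Q : Prop := exists2 e : R, 0 < e & forall x, 0 < x < e -> Q x.

Lemma small_and Q Q' : small Q -> small Q' -> small (fun x => Q x /\ Q' x).
Proof.
move=> [e he h] [e' he' h']; exists (Num.min e e'); first by rewrite lt_min he he'.
by move=> x; rewrite lt_min => /and3P[h0 h1 h2]; split; [apply: h|apply: h']; apply/andP.
Qed.

Lemma small_impl Q Q' : small Q -> (forall x, 0 < x -> Q x -> Q' x) -> small Q'.
Proof. by move=> [e he h] hQ; exists e => // x hx; apply: hQ (h _ hx); case/andP: hx. Qed.

Lemma small_all (J : finType) (Q : J -> R -> Prop) :
  (forall j, small (Q j)) -> small (fun x => forall j, Q j x).
Proof.
move=> h.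
suff: small (fun x => forall j, j \in enum J -> Q j x).
  by move/small_impl; apply=> x _ hx j; apply: hx; rewrite mem_enum.
elim: (enum J) => [|j s IH]; first by exists 1.
apply: (small_impl (small_and (h j) IH)) => x _ [h1 h2] k.
by rewrite inE => /orP[/eqP->|/h2].
Qed.

Lemma small_ex Q : small Q -> exists2 x, 0 < x & Q x.
Proof. by move=> [e he h]; exists (e / 2); [lra|apply: h; apply/andP; split; lra]. Qed.

Lemma small_pos A B C : 0 < A -> small (fun x => 0 < A + B * x + C * x ^+ 2).
Proof.
move=> hA; pose D := `|B| + `|C| + 1.
have hD : 0 < D by rewrite /D ltr_wpDl // addr_ge0.
exists (Num.min 1 (A / D)); first by rewrite lt_min ltr01 divr_gt0.
move=> x; rewrite lt_min => /and3P[x0 x1]; rewrite ltr_pdivlMr // => x2.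
have := ler_norm (- B); have := ler_norm (- C); rewrite !normrN => h1 h2.
have h3 : - B * x <= `|B| * x by rewrite ler_pM2r.
have h4 : - C * x ^+ 2 <= `|C| * x ^+ 2 by rewrite ler_pM2r // exprn_gt0.
have h5 : `|C| * x ^+ 2 <= `|C| * x by rewrite ler_wpM2l // expr2; nra.
by rewrite /D in x2; nra.
Qed.

End Small.

Section Plane.
Variable R : realType.
Implicit Types (u v w p q : 'rV[R]_2).

Lemma orient_rot u v w : orient u v w = orient v w u.
Proof. by rewrite /orient; ring. Qed.

Lemma orient_swap u v w : orient v u w = - orient u v w.
Proof. by rewrite /orient; ring. Qed.

Lemma orient_same u w : orient u u w = 0.
Proof. by rewrite /orient; ring. Qed.

Lemma orient_sum u v w q : orient u v w = orient u v q + orient v w q + orient w u q.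
Proof. by rewrite /orient; ring. Qed.

Lemma xcoD u v : xco (u + v) = xco u + xco v. Proof. by rewrite /xco mxE. Qed.
Lemma ycoD u v : yco (u + v) = yco u + yco v. Proof. by rewrite /yco mxE. Qed.
Lemma xcoZ c u : xco (c *: u) = c * xco u. Proof. by rewrite /xco mxE. Qed.
Lemma ycoZ c u : yco (c *: u) = c * yco u. Proof. by rewrite /yco mxE. Qed.
Lemma xcoN u : xco (- u) = - xco u. Proof. by rewrite /xco mxE. Qed.
Lemma ycoN u : yco (- u) = - yco u. Proof. by rewrite /yco mxE. Qed.
Definition coE := (xcoD, ycoD, xcoZ, ycoZ, xcoN, ycoN).

Lemma point_ext u v : xco u = xco v -> yco u = yco v -> u = v.
Proof.
move=> hx hy; apply/rowP => k; case: k => [[|[|//]] hk].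
  by rewrite (_ : Ordinal hk = 0) //; apply: val_inj.
by rewrite (_ : Ordinal hk = 1) //; apply: val_inj.
Qed.

Lemma orient_wedge u v w p q (x y : R) :
  orient u v (w + x *: (p - w) + y *: (q - w)) =
  (1 - x - y) * orient u v w + x * orient u v p + y * orient u v q.
Proof. by rewrite /orient !coE; ring. Qed.

Definition cross q u v : bool :=
  ((xco u <= xco q < xco v) && (orient u v q < 0)) ||
  ((xco v <= xco q < xco u) && (orient v u q < 0)).

(** The barycentric relation for q, read on abscissas: the three terms
    cannot all have the same sign, which is what the even-odd rule for a
    triangle comes down to. *)
Lemma orient_abscissa u v w q :
  (xco u - xco q) * orient v w q + (xco v - xco q) * orient w u q +
  (xco w - xco q) * orient u v q = 0.
Proof. by rewrite /orient; ring. Qed.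

(** As in orient_abscissa, X, Y, Z stand for abscissas relative to q and
    a, b, c for orientations.  A term whose abscissa has the other sign than
    the remaining two balances them only if its orientation agrees with
    theirs. *)
Lemma balance_outer (X Y Z a b c : R) : X * a + Y * b + Z * c = 0 ->
  a != 0 -> b != 0 -> c != 0 ->
  (X <= 0) != (Y <= 0) -> (Y <= 0) = (Z <= 0) -> (b < 0) = (c < 0) -> (a < 0) = (b < 0).
Proof.
move=> e; rewrite !neq_lt => a0 b0 c0.
have [x|x] := leP X 0; have [y|y] := leP Y 0; have [z|z] := leP Z 0 => //= _ _;
have [b1|b1] := ltP b 0; have [c1|c1] := ltP c 0 => // _; have [a1|a1] := ltP a 0 => //; exfalso.
- by case/orP: a0 => ?; nra.
- by case/orP: a0 => ?; nra.
- by case/orP: a0 => ?; nra.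
- by case/orP: a0 => ?; nra.
Qed.

(** Orientations of one sign can only balance if the points lie on both
    sides of the vertical line through q. *)
Lemma balance_inner (X Y Z a b c : R) : X * a + Y * b + Z * c = 0 ->
  (X = 0 -> Y = 0 -> Z = 0 -> False) -> a != 0 -> b != 0 -> c != 0 ->
  (X <= 0) = (Y <= 0) -> (Y <= 0) = (Z <= 0) -> (a < 0) = (b < 0) -> (b < 0) = (c < 0) -> False.
Proof.
move=> e hz; rewrite !neq_lt => a0 b0 c0.
have [x|x] := leP X 0; have [y|y] := leP Y 0; have [z|z] := leP Z 0 => //= _ _;
have [a1|a1] := ltP a 0; have [b1|b1] := ltP b 0; have [c1|c1] := ltP c 0 => // _ _.
all: by nra.
Qed.

Lemma crossE q u v : orient u v q != 0 -> cross q u v =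
  ((xco u - xco q <= 0) != (xco v - xco q <= 0)) && ((xco u - xco q <= 0) == (orient u v q < 0)).
Proof.
rewrite /cross (orient_swap u v) oppr_lt0 !subr_le0 neq_lt !ltNge.
case: (xco u <= xco q); case: (xco v <= xco q) => //=; rewrite ?orbF ?andbT //;
by rewrite -?ltNge; have [] := ltgtP (orient u v q) 0.
Qed.

(** The even-odd rule for a triangle, proved by going through the sign
    patterns that orient_abscissa leaves possible. *)
Lemma cross_triangle (s : R) u v w q : 0 < s * orient u v w -> s != 0 ->
  orient u v q != 0 -> orient v w q != 0 -> orient w u q != 0 ->
  cross q u v (+) cross q v w (+) cross q w u =
  [&& 0 < s * orient u v q, 0 < s * orient v w q & 0 < s * orient w u q].
Proof.
move=> hs s0 n1 n2 n3; have e := orient_abscissa u v w q; have e' := orient_sum u v w q.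
have hz : xco u - xco q = 0 -> xco v - xco q = 0 -> xco w - xco q = 0 -> False.
  move=> e1 e2 e3; move: hs; rewrite /orient.
  have -> : xco u = xco q by lra. have -> : xco v = xco q by lra. have -> : xco w = xco q by lra.
  by rewrite subrr !mul0r !mulr0 subrr mulr0 ltxx.
have -> : [&& 0 < s * orient u v q, 0 < s * orient v w q & 0 < s * orient w u q] =
    ((orient u v q < 0) == (orient v w q < 0)) && ((orient v w q < 0) == (orient w u q < 0)).
  { move: s0 n1 n2 n3; rewrite !neq_lt => /orP[] s0 /orP[] n1 /orP[] n2 /orP[] n3.
  all: rewrite ?(pmulr_rgt0 _ s0) ?(nmulr_rgt0 _ s0) ?n1 ?n2 ?n3 ?(lt_gtF n1) ?(lt_gtF n2) ?(lt_gtF n3) //=.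
  all: by exfalso; move: hs; rewrite ?(pmulr_rgt0 _ s0) ?(nmulr_rgt0 _ s0) => hs; lra. }
rewrite !crossE //.
have e2 : (xco v - xco q) * orient w u q + (xco w - xco q) * orient u v q +
  (xco u - xco q) * orient v w q = 0 by rewrite -[RHS]e; ring.
have e3 : (xco w - xco q) * orient u v q + (xco u - xco q) * orient v w q +
  (xco v - xco q) * orient w u q = 0 by rewrite -[RHS]e; ring.
have k0 := balance_inner e hz n2 n3 n1.
have k1 := balance_outer e n2 n3 n1.
have k2 := balance_outer e2 n3 n1 n2.
have k3 := balance_outer e3 n1 n2 n3.
move: k0 k1 k2 k3.
case: (_ - _ <= 0); case: (_ - _ <= 0); case: (_ - _ <= 0);
  case: (orient u v q < 0); case: (orient v w q < 0); case: (orient w u q < 0) => //= k0 k1 k2 k3;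
  (try by case: k0); (try by have := k1 isT (erefl _) (erefl _));
  (try by have := k2 isT (erefl _) (erefl _)); (try by have := k3 isT (erefl _) (erefl _)).
Qed.

End Plane.

(** * Even-odd counting with triangles at the tip *)

Section Labels.
Variable l : nat.
Local Notation label := (option 'I_l.+2).

(** Chain points are addressed by natural numbers, so that intervals of
    the chain can be handled by integer arithmetic; inord gives a meaningful label
    only up to l+1. *)
Definition chain_label (n : nat) : label := Some (inord n).
Local Notation lb := chain_label.

Lemma lbK (i : 'I_l.+2) : lb i = Some i.
Proof. by rewrite /chain_label inord_val. Qed.

Lemma lb_inj i j : (i <= l.+1)%N -> (j <= l.+1)%N -> lb i = lb j -> i = j.
Proof. by move=> hi hj [/(congr1 val)]; rewrite /= !inordK. Qed.

Lemma lb_eq i j : (i <= l.+1)%N -> (j <= l.+1)%N -> (lb i == lb j) = (i == j).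
Proof. by move=> hi hj; apply/eqP/eqP => [/lb_inj->|->]. Qed.

Lemma label_case (x : label) : x = None \/ exists2 n, (n <= l.+1)%N & x = lb n.
Proof.
case: x => [i|]; last by left.
by right; exists i; rewrite ?lbK // -ltnS.
Qed.

(** Edges at the tip never satisfy it, by under_tip. *)
Definition under (B : nat -> nat -> bool) (e : {set label}) : bool :=
  [exists i : 'I_l.+2, exists j : 'I_l.+2, [&& (i < j)%N, e == [set Some i; Some j] & B i j]].

Lemma under_chain B i j : (i < j)%N -> (j <= l.+1)%N -> under B [set lb i; lb j] = B i j.
Proof.
move=> ij hj; have hi : (i <= l.+1)%N by lia.
apply/existsP/idP => [[i' /existsP[j' /and3P[ij' /eqP e hB]]]|hB].
  have h1 : Some i' \in [set lb i; lb j] by rewrite e !inE eqxx.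
  have h2 : Some j' \in [set lb i; lb j] by rewrite e !inE eqxx orbT.
  have hi' : (i' <= l.+1)%N by rewrite -ltnS.
  have hj' : (j' <= l.+1)%N by rewrite -ltnS.
  move: h1 h2; rewrite !inE -(lbK i') -(lbK j') !lb_eq // => h1 h2.
  have e1 : i' = i :> nat by lia.
  have e2 : j' = j :> nat by lia.
  by rewrite -e1 -e2.
exists (inord i); apply/existsP; exists (inord j).
by rewrite !inordK // ij hB andbT eqxx.
Qed.

Lemma under_tip B x : under B [set None; x] = false.
Proof.
apply/negbTE/negP => /existsP[i /existsP[j /and3P[_ /eqP/setP/(_ None)]]].
by rewrite !inE eqxx.
Qed.

Lemma third_label (i j : label) : exists k, k != i /\ k != j.
Proof.
have : (#|[set i; j]| < #|{: label}|)%N.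
  by rewrite cards2 card_option card_ord; case: (i != j).
move=> h; have : ~~ ([set: label] \subset [set i; j]).
  by apply: contraL h => /subset_leq_card; rewrite cardsT leqNgt.
by move=> /subsetPn[k _]; rewrite !inE negb_or => /andP[h1 h2]; exists k.
Qed.
End Labels.

Section Configuration.
Variables (R : realType) (l : nat).
Local Notation label := (option 'I_l.+2).
Variables (a : label -> 'rV[R]_2) (s : R).
Hypothesis gp : general_position a.
Hypothesis s0 : s != 0.
Implicit Types (i j k v : label) (q : 'rV[R]_2) (P : {set {set label}}).

(** The factor s, which is nonzero, makes the two mirror images of a
    configuration look alike: with the right sign, tip_pos and chain_neg below
    hold for both. *)
Definition side_of i j q : R := s * orient (a i) (a j) q.
Definition sgn_of i j k : R := side_of i j (a k).
Local Notation side := side_of.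
Local Notation sgn3 := sgn_of.

Definition generic q : Prop := forall i j, i != j -> orient (a i) (a j) q != 0.

Lemma side_swap i j q : side j i q = - side i j q.
Proof. by rewrite /side_of orient_swap mulrN. Qed.

Lemma side_same i q : side i i q = 0.
Proof. by rewrite /side_of orient_same mulr0. Qed.

Lemma sgn3_rot i j k : sgn3 i j k = sgn3 j k i.
Proof. by rewrite /sgn_of /side_of orient_rot. Qed.

Lemma sgn3_swap i j k : sgn3 j i k = - sgn3 i j k.
Proof. exact: side_swap. Qed.

Lemma sgn3_same i k : sgn3 i i k = 0. Proof. exact: side_same. Qed.

Lemma sgn3_neq0 i j k : i != j -> j != k -> i != k -> sgn3 i j k != 0.
Proof. by move=> h1 h2 h3; rewrite /sgn_of /side_of mulf_neq0 // gp. Qed.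

Lemma generic_side q i j : generic q -> i != j -> side i j q != 0.
Proof. by move=> g ij; rewrite /side_of mulf_neq0 // g. Qed.

Lemma generic_sideN q i j : generic q -> i != j -> (0 < side j i q) = ~~ (0 < side i j q).
Proof. by move=> g ij; rewrite side_swap oppr_gt0 -leNgt le_eqVlt (negPf (generic_side g ij)). Qed.

Lemma points_distinct i j : i != j -> xco (a i) = xco (a j) -> yco (a i) = yco (a j) -> False.
Proof.
move=> ij hx hy; have [k [ki kj]] := third_label i j.
have := gp ij (_ : j != k) (_ : i != k); rewrite eq_sym kj eq_sym ki => /(_ isT isT).
by rewrite (point_ext hx hy) orient_same eqxx.
Qed.

(** Move q by (x^2, x) with x small and positive.  The vertical shift leaves
    every line that is not vertical, the horizontal one leaves vertical lines,
    and both shifts go in the direction that the half-open convention of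
    crosses_ray allows for: to the right, and upwards off an edge through q. *)
Lemma perturb q : exists q', [/\ generic q',
  forall e, crosses_ray a q' e = crosses_ray a q e &
  forall i j, 0 < side i j q -> 0 < side i j q'].
Proof.
(* the horizontal shift is of second order, so that it only decides where the
   vertical shift does not *)
pose q' (x : R) : 'rV[R]_2 := \row_k (q 0 k + (if k == 0 then x ^+ 2 else x)).
have qx x : xco (q' x) = xco q + x ^+ 2 by rewrite /xco mxE eqxx.
have qy x : yco (q' x) = yco q + x by rewrite /yco mxE.
have oE i j x : orient (a i) (a j) (q' x) = orient (a i) (a j) q +
    (xco (a j) - xco (a i)) * x + (yco (a i) - yco (a j)) * x ^+ 2.
  by rewrite /orient qx qy; ring.
pose good (e : label * label) x := let i := e.1 in let j := e.2 in
  [/\ i != j -> orient (a i) (a j) (q' x) != 0,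
   (xco (a i) <= xco (q' x) < xco (a j)) && (orient (a i) (a j) (q' x) < 0) =
   (xco (a i) <= xco q < xco (a j)) && (orient (a i) (a j) q < 0) &
   0 < side i j q -> 0 < side i j (q' x)].
suff: exists2 x, 0 < x & forall e, good e x.
  move=> [x x0 hx]; exists (q' x); split.
  - by move=> i j ij; have [h _ _] := hx (i, j); apply: h.
  - move=> e; rewrite /crosses_ray; apply: eq_existsb => i; congr (_ && _).
    by apply: eq_existsb => j; congr (_ && _); have [_ h _] := hx (i, j).
  - by move=> i j; have [_ _ h] := hx (i, j).
apply: small_ex; apply: small_all => -[i j].
(* signs of a quantity that is affine in the two infinitesimals *)
have pos A B C : (0 < A) || ((A == 0) && ((0 < B) || ((B == 0) && (0 < C)))) ->
    small (fun x => 0 < A + B * x + C * x ^+ 2).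
  case/orP => [hA|/andP[/eqP-> /orP[hB|/andP[/eqP-> hC]]]].
  - exact: small_pos.
  - apply: (small_impl (small_pos C 0 hB)) => x x0 h.
    by rewrite add0r (_ : _ + _ = x * (B + C * x + 0 * x ^+ 2)) ?mulr_gt0 //; ring.
  - by exists 1 => // x /andP[x0 _]; rewrite mul0r !add0r mulr_gt0 // exprn_gt0.
have ltx c : xco q < c -> small (fun x => xco q + x ^+ 2 < c).
  move=> h; have {h}: small (fun x => 0 < c - xco q + 0 * x + (-1) * x ^+ 2).
    by apply: pos; rewrite subr_gt0 h.
  by move/small_impl; apply => x _ h; lra.
have [ij|ij] := eqVneq i j.
  exists 1 => // x _; split=> //=; first by rewrite ij eqxx.
  - rewrite ij; case: (xco (a j) <= xco q) (leNgt (xco (a j)) (xco q)) => [|].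
    + by rewrite !orient_same ltxx !andbF.
    + by rewrite !orient_same ltxx !andbF.
  - by rewrite ij !side_same.
have xs : small (fun x => (xco (a i) <= xco (q' x) < xco (a j)) = (xco (a i) <= xco q < xco (a j))).
  have h1 : small (fun x => (xco (a i) <= xco (q' x)) = (xco (a i) <= xco q)).
    have [h|h] := leP (xco (a i)) (xco q).
      exists 1 => // x /andP[x0 _]; rewrite qx; apply: (le_trans h).
      by rewrite lerDl exprn_ge0 // ltW.
    by apply: (small_impl (ltx _ h)) => x _ h'; rewrite qx leNgt h'.
  have h2 : small (fun x => (xco (q' x) < xco (a j)) = (xco q < xco (a j))).
    have [h|h] := ltP (xco q) (xco (a j)).
      by apply: (small_impl (ltx _ h)) => x _ h'; rewrite qx h'.
    exists 1 => // x /andP[x0 _]; rewrite qx; apply/negbTE; rewrite -leNgt; apply: (le_trans h).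
    by rewrite lerDl exprn_ge0 // ltW.
  by apply: (small_impl (small_and h1 h2)) => x _ [-> ->].
have [o0|o0|o0] := ltgtP (orient (a i) (a j) q) 0.
- have : small (fun x => 0 < - orient (a i) (a j) q + (- (xco (a j) - xco (a i))) * x +
    (- (yco (a i) - yco (a j))) * x ^+ 2) by apply: pos; rewrite oppr_gt0 o0.
  move=> h; apply: (small_impl (small_and xs h)) => x x0 [h1 h2].
  have h3 : orient (a i) (a j) (q' x) < 0 by rewrite oE; lra.
  split=> /=; [by rewrite lt_eqF|by rewrite h1 h3 o0|].
  by rewrite /side_of !(mulrC s) !nmulr_rgt0.
- have : small (fun x => 0 < orient (a i) (a j) q + (xco (a j) - xco (a i)) * x +
    (yco (a i) - yco (a j)) * x ^+ 2) by apply: pos; rewrite o0.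
  move=> h; apply: (small_impl (small_and xs h)) => x x0 [h1 h2].
  have h3 : 0 < orient (a i) (a j) (q' x) by rewrite oE; lra.
  split=> /=; [by rewrite gt_eqF|by rewrite h1 (lt_gtF h3) (lt_gtF o0) !andbF|].
  by rewrite /side_of !(mulrC s) !pmulr_rgt0.
have hs : side i j q = 0 by rewrite /side_of o0 mulr0.
have hnz : small (fun x => orient (a i) (a j) (q' x) != 0 /\
   (xco (a i) < xco (a j) -> 0 < orient (a i) (a j) (q' x))).
  have dx := @points_distinct i j ij.
  have [e|e|e] := ltgtP (xco (a i)) (xco (a j)).
  + have h : small (fun x => 0 < 0 + (xco (a j) - xco (a i)) * x + (yco (a i) - yco (a j)) * x ^+ 2).
      by apply: pos; rewrite eqxx subr_gt0 e orbT.
    by apply: (small_impl h) => x x0 hx; rewrite oE o0; split=> [|_ //]; rewrite gt_eqF.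
  + have h : small (fun x => 0 < 0 + (- (xco (a j) - xco (a i))) * x + (- (yco (a i) - yco (a j))) * x ^+ 2).
      by apply: pos; rewrite eqxx oppr_gt0 subr_lt0 e orbT.
    by apply: (small_impl h) => x x0 hx; rewrite oE o0; split=> //; rewrite lt_eqF //; lra.
  + exists 1 => // x /andP[x0 _]; rewrite oE o0 e subrr mul0r !add0r; split=> //.
    apply: mulf_neq0; last by rewrite expf_neq0 // gt_eqF.
    by rewrite subr_eq0; apply/eqP => ey; apply: dx.
apply: (small_impl (small_and xs hnz)) => x x0 [h1 [h2 h3]]; split=> //=; last by rewrite hs ltxx.
rewrite h1 o0 ltxx andbF; case: (boolP (_ <= _ < _)) => //= /andP[u1 u2].
by apply: lt_gtF; apply: h3; apply: le_lt_trans u1 u2.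
Qed.

Definition in_tip_triangle q (i j : nat) : bool :=
  [&& 0 < side None (chain_label l i) q, 0 < side (chain_label l j) None q & 0 < side (chain_label l i) (chain_label l j) q].

Hypothesis tip_pos : forall i j : nat, (i < j)%N -> (j <= l.+1)%N -> 0 < sgn3 None (chain_label l i) (chain_label l j).
Hypothesis chain_neg : forall i j k : nat, (i < j)%N -> (j < k)%N -> (k <= l.+1)%N ->
  sgn3 (chain_label l i) (chain_label l j) (chain_label l k) < 0.

Lemma crosses_edge q i j : i != j -> crosses_ray a q [set i; j] = cross q (a i) (a j).
Proof.
move=> ij; apply/existsP/idP => [[x /andP[hx /existsP[y /andP[hy h]]]]|].
  move: hx hy h; rewrite !inE /cross => /orP[]/eqP-> /orP[]/eqP->.
  - by rewrite orient_same ltxx andbF.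
  - by move->.
  - by move->; rewrite orbT.
  - by rewrite orient_same ltxx andbF.
case/orP => h.
  by exists i; rewrite !inE eqxx /=; apply/existsP; exists j; rewrite !inE eqxx orbT.
by exists j; rewrite !inE eqxx orbT /=; apply/existsP; exists i; rewrite !inE eqxx.
Qed.

(** Replace the crossing with an edge (i, j) by the crossings with the
    boundary of the triangle p, i, j.  This changes the edge predicate by the
    border of the labelling that tells whether the ray crosses the segment from
    p to a vertex, so the parity is unchanged, and cross_triangle evaluates the
    new predicate. *)
Lemma parity_crossing P q : two_regular P -> generic q ->
  odd #|[set e in P | crosses_ray a q e]| = parity P (under (in_tip_triangle q)).
Proof.
move=> tr g; rewrite -(parity_card P (crosses_ray a q)).
pose h (v : label) : bool := (v != None) && crosses_ray a q [set None; v].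
rewrite -[LHS]addbF -(parity_border h tr) -parityD; apply: eq_parity => e he.
have [u [v [uv ->]]] := tr.1 _ he; rewrite border2 //.
have tipcase x : x != None ->
    crosses_ray a q [set None; x] (+) (h None (+) h x) = under (in_tip_triangle q) [set None; x].
  by move=> hx; rewrite under_tip /h hx /= addbb.
have chaincase (i j : nat) : (i < j)%N -> (j <= l.+1)%N ->
    crosses_ray a q [set chain_label l i; chain_label l j] (+) (h (chain_label l i) (+) h (chain_label l j)) =
    under (in_tip_triangle q) [set chain_label l i; chain_label l j].
  move=> ij hj; rewrite under_chain // /h /=.
  have nij : chain_label l i != chain_label l j by rewrite lb_eq; lia.
  rewrite !crosses_edge //.
  have := @cross_triangle R s (a None) (a (chain_label l i)) (a (chain_label l j)) q (tip_pos ij hj) s0.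
  rewrite !g // => /(_ isT isT isT).
  have -> : cross q (a (chain_label l j)) (a None) = cross q (a None) (a (chain_label l j)) by rewrite /cross orbC.
  rewrite /in_tip_triangle /side_of => e'.
  rewrite addbC -addbA [_ (+) cross q (a (chain_label l i)) _]addbC addbA e'.
  by congr (_ && _); rewrite andbC.
have [eu|[i hi eu]] := label_case u; have [ev|[j hj ev]] := label_case v.
- by rewrite eu ev eqxx in uv.
- by rewrite eu; apply: tipcase; rewrite ev.
- by rewrite ev setUC [h u (+) _]addbC; apply: tipcase; rewrite eu.
rewrite eu ev; have [lt|gt|e0] := ltngtP i j.
- exact: chaincase.
- by rewrite setUC [h _ (+) _]addbC; apply: chaincase.
- by rewrite eu ev e0 eqxx in uv.
Qed.

End Configuration.

(** * Interior points near a vertex *)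

Section Inside.
Variables (R : realType) (l : nat).
Local Notation label := (option 'I_l.+2).
Variables (a : label -> 'rV[R]_2) (s : R).
Hypothesis gp : general_position a.
Hypothesis s0 : s != 0.
Implicit Types (u v w : label) (q : 'rV[R]_2) (P : {set {set label}}).
Local Notation side := (side_of a s).
Local Notation sgn3 := (sgn_of a s).

Lemma conv_edgeP u v q : u != v ->
  conv a [set u; v] q <-> exists2 t, 0 <= t <= 1 & q = (1 - t) *: a u + t *: a v.
Proof.
move=> uv; split=> [[c [c0 cz c1 ->]]|[t /andP[t0 t1] ->]].
  have hsum (V : lmodType R) (f : label -> V) (hf : forall k, k != u -> k != v -> f k = 0) :
      \sum_k f k = f u + f v.
    rewrite (bigD1 u) //= (bigD1 v) //= 1?eq_sym // big1 ?addr0 // => k /andP[k1 k2].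
    exact: hf.
  have e1 : c u + c v = 1.
    rewrite -c1 (hsum (R^o : lmodType R) c) // => k k1 k2; apply: cz.
    by rewrite !inE negb_or k1.
  exists (c v); first by rewrite c0 -e1 lerDr c0.
  rewrite (hsum _ (fun k => c k *: a k)); first by rewrite -e1 addrK.
  by move=> k k1 k2; rewrite cz ?scale0r // !inE negb_or k1.
exists (fun k => if k == u then 1 - t else if k == v then t else 0).
have vu : v != u by rewrite eq_sym.
split.
- by move=> k; case: ifP => _; [rewrite subr_ge0|case: ifP].
- by move=> k; rewrite !inE negb_or => /andP[/negPf-> /negPf->].
- rewrite (bigD1 u) //= (bigD1 v) //= eqxx (negPf vu) eqxx big1 ?addr0 ?subrK //.
  by move=> k /andP[/negPf-> /negPf->].
- rewrite (bigD1 u) //= (bigD1 v) //= eqxx (negPf vu) eqxx big1 ?addr0 //.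
  by move=> k /andP[/negPf-> /negPf->]; rewrite scale0r.
Qed.

Lemma conv_edge_side u v q : u != v -> conv a [set u; v] q -> side u v q = 0.
Proof.
move=> uv /(conv_edgeP _ uv)[t _ ->].
by rewrite /side_of /orient !coE; ring.
Qed.

Lemma generic_not_boundary P q : two_regular P -> generic a q -> ~ boundary a P q.
Proof.
move=> tr g [e he]; have [u [v [uv ->]]] := tr.1 _ he.
by move/(conv_edge_side uv)/eqP; rewrite (negPf (generic_side s0 g uv)).
Qed.

(** Closeness to v only matters through the lines that miss v. *)
Definition near v q : Prop :=
  forall i j, i != v -> j != v -> 0 < sgn3 i j v -> 0 < side i j q.

(** For the lines through v, q lies as the points of the open angle at v
    between u and w do. *)
Definition in_wedge v u w q : Prop :=
  forall k, [/\ 0 <= sgn3 v k u -> 0 <= sgn3 v k w -> 0 < sgn3 v k u + sgn3 v k w -> 0 < side v k q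
             & sgn3 v k u <= 0 -> sgn3 v k w <= 0 -> sgn3 v k u + sgn3 v k w < 0 -> 0 < side k v q].

Definition wedge_point v u w (x y : R) : 'rV[R]_2 := a v + x *: (a u - a v) + y *: (a w - a v).

(** A line that misses v keeps small wedge points on the side of v, and
    for a line through v the side is a positive combination of the sides of u
    and w. *)
Lemma wedge_near v u w : exists2 e : R, 0 < e &
  forall x y, 0 < x < e -> 0 < y < e -> near v (wedge_point v u w x y) /\ in_wedge v u w (wedge_point v u w x y).
Proof.
suff [e e0 he] : exists2 e : R, 0 < e & forall x y, 0 < x < e -> 0 < y < e -> near v (wedge_point v u w x y).
  exists e => // x y hx hy; split; first exact: he.
  move=> k; have E : side v k (wedge_point v u w x y) = x * sgn3 v k u + y * sgn3 v k w.
    rewrite /side_of /wedge_point orient_wedge /sgn_of /side_of.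
    by rewrite -(orient_rot (a v)) orient_same; ring.
  case/andP: hx => x0 _; case/andP: hy => y0 _; rewrite (side_swap a s v k) E; split=> h1 h2 h3; have [xy|xy] := leP x y; nra.
pose good (e : label * label) x := 0 < sgn3 e.1 e.2 v ->
  0 < sgn3 e.1 e.2 v / 2%:R + (sgn3 e.1 e.2 u - sgn3 e.1 e.2 v) * x /\
  0 < sgn3 e.1 e.2 v / 2%:R + (sgn3 e.1 e.2 w - sgn3 e.1 e.2 v) * x.
have [e e0 he] : small (fun x => forall e, good e x).
  apply: small_all => -[i j]; rewrite /good /=.
  have [h|h] := ltP 0 (sgn3 i j v); last by exists 1.
  have h2 : 0 < sgn3 i j v / 2%:R by rewrite divr_gt0.
  apply: (small_impl (small_and (small_pos (sgn3 i j u - sgn3 i j v) 0 h2) (small_pos (sgn3 i j w - sgn3 i j v) 0 h2))).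
  by move=> x x0 [h3 h4] _; split; lra.
exists e => // x y hx hy i j iv jv h.
have [h1 _] := he _ hx (i, j) h; have [_ h2] := he _ hy (i, j) h.
rewrite /side_of /wedge_point orient_wedge.
by move: h1 h2; rewrite /= /sgn_of /side_of; lra.
Qed.

Lemma near_perturb v q q' : (forall i j, 0 < side i j q -> 0 < side i j q') -> near v q -> near v q'.
Proof. by move=> h hn i j iv jv hs; apply/h/hn. Qed.

Lemma wedge_perturb v u w q q' : (forall i j, 0 < side i j q -> 0 < side i j q') ->
  in_wedge v u w q -> in_wedge v u w q'.
Proof. by move=> h hw k; have [h1 h2] := hw k; split=> *; apply: h; [apply: h1|apply: h2]. Qed.

Lemma wedge_generic v u w : exists q, [/\ generic a q, near v q & in_wedge v u w q].
Proof.
have [e e0 he] := wedge_near v u w; have e2 : 0 < e / 2%:R < e by apply/andP; split; lra.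
have [h1 h2] := he _ _ e2 e2; have [q' [g _ hs]] := perturb s gp (wedge_point v u w (e / 2%:R) (e / 2%:R)).
by exists q'; split=> //; [apply: near_perturb hs h1|apply: wedge_perturb hs h2].
Qed.

Hypothesis tip_pos : forall i j : nat, (i < j)%N -> (j <= l.+1)%N -> 0 < sgn3 None (chain_label l i) (chain_label l j).

(** The even-odd rule for generic points in the form of parity_crossing. *)
Definition encloses P q : bool := parity P (under (in_tip_triangle a s q)).

(** A generic point is on no edge, so only the parity matters. *)
Lemma inside_generic P q : two_regular P -> generic a q -> inside a P q <-> encloses P q.
Proof.
move=> tr g; rewrite /inside (parity_crossing s0 tip_pos) //.
by split=> [[]|h] //; split=> //; apply: generic_not_boundary.
Qed.

Lemma inside_encloses P q q' : two_regular P -> generic a q' ->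
  (forall e, crosses_ray a q' e = crosses_ray a q e) -> inside a P q -> encloses P q'.
Proof.
move=> tr g hc [_ h]; rewrite /encloses -(parity_crossing s0 tip_pos) //.
by have -> : [set e in P | crosses_ray a q' e] = [set e in P | crosses_ray a q e] by apply/setP => e; rewrite !inE hc.
Qed.

Lemma encloses_inside P q q' : two_regular P -> generic a q' ->
  (forall e, crosses_ray a q' e = crosses_ray a q e) -> ~ boundary a P q -> encloses P q' -> inside a P q.
Proof.
move=> tr g hc hb; rewrite /encloses -(parity_crossing s0 tip_pos) // => h; split=> //.
by have <- : [set e in P | crosses_ray a q' e] = [set e in P | crosses_ray a q e] by apply/setP => e; rewrite !inE hc.
Qed.

Lemma wedge_swap v u w q : in_wedge v u w q -> in_wedge v w u q.
Proof. by move=> h k; have [h1 h2] := h k; split=> *; [apply: h1|apply: h2] => //; rewrite addrC. Qed.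

(** Whether wedge points at v are interior does not depend on how small
    they are, so convexity can be tested on any generic point in the wedge
    close to v.  Conversely a wedge point close to v is on no edge: edges at v
    bound the wedge, and the other edges span lines that miss v. *)
Lemma convex_vertexE P v u w b : two_regular P -> neighbours P v u w ->
  (forall q, generic a q -> near v q -> in_wedge v u w q -> encloses P q = b) ->
  convex_vertex a P v <-> b.
Proof.
move=> tr nb hb; have [uw uv wv hn] := nb; split.
  move=> [u' [w' [uw' hu' hw' [e e0 hin]]]].
  have [e' e'0 he'] := wedge_near v u' w'.
  pose x := Num.min e e' / 2%:R.
  have x0 : 0 < Num.min e e' by rewrite lt_min e0.
  have [xe xe'] : 0 < x < e /\ 0 < x < e'.
    have : Num.min e e' <= e /\ Num.min e e' <= e' by rewrite !ge_min !lexx orbT.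
    by rewrite /x => -[? ?]; split; apply/andP; split; lra.
  have [h1 h2] := he' _ _ xe' xe'; have hi := hin _ _ xe xe.
  have [q' [g hc hs]] := perturb s gp (wedge_point v u' w' x x).
  have h3 := inside_encloses tr g hc hi.
  rewrite -(hb q') //; first exact: near_perturb hs h1.
  have {h2}h2 := wedge_perturb hs h2.
  move: hu' hw' uw' h2; rewrite !hn => /orP[]/eqP-> /orP[]/eqP-> //; rewrite ?eqxx //.
  by move=> _ /wedge_swap.
move=> hbt; have [e e0 he] := wedge_near v u w.
exists u, w; split=> //; rewrite ?hn ?eqxx ?orbT //; exists e => // x y hx hy.
have [h1 h2] := he _ _ hx hy.
have [q' [g hc hs]] := perturb s gp (wedge_point v u w x y).
have hv : encloses P q' by rewrite hb //; [apply: near_perturb hs h1|apply: wedge_perturb hs h2].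
apply: (encloses_inside tr g hc _ hv) => -[f hf].
have [i [j [ij ef]]] := tr.1 _ hf.
have nz (i' j' : label) : i' != j' -> 0 < side i' j' (wedge_point v u w x y) \/ 0 < side j' i' (wedge_point v u w x y) ->
    conv a [set i'; j'] (wedge_point v u w x y) -> False.
  move=> ij' h /(conv_edge_side ij') e1; move: h; rewrite (side_swap a s i') e1 oppr0 ltxx; by case.
have atv k : [set v; k] \in P -> conv a [set v; k] (wedge_point v u w x y) -> False.
  rewrite hn => hk; have vk : v != k by case/orP: hk => /eqP->; rewrite eq_sym.
  apply: nz => //; have [g1 g2] := h2 k.
  have vu : v != u by rewrite eq_sym.
  have vw : v != w by rewrite eq_sym.
  case/orP: hk => /eqP ek; move: g1 g2; rewrite ek.
    rewrite sgn3_rot sgn3_same add0r lexx => g1 g2.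
    have := sgn3_neq0 gp s0 vu uw vw; rewrite neq_lt => /orP[] hz; [right; apply: g2|left; apply: g1] => //; exact: ltW.
  have wu : w != u by rewrite eq_sym.
  rewrite (sgn3_rot a s v w w) sgn3_same addr0 lexx => g1 g2.
  have := sgn3_neq0 gp s0 vw wu vu; rewrite neq_lt => /orP[] hz; [right; apply: g2|left; apply: g1] => //; exact: ltW.
case: (eqVneq i v) => iv; first by rewrite ef iv; apply: atv; rewrite -iv -ef.
case: (eqVneq j v) => jv; first by rewrite ef jv setUC; apply: atv; rewrite setUC -jv -ef.
rewrite ef; apply: nz => //.
have := sgn3_neq0 gp s0 ij jv iv; rewrite neq_lt => /orP[] hz; [right|left]; apply: h1 => //.
by rewrite sgn3_swap oppr_gt0.
Qed.

(** The two lines meet at the point that divides each segment in the ratio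
    of the distances of its ends from the other line. *)
Lemma segments_meet (i j i' j' : label) : i != j -> i' != j' ->
  sgn3 i j i' * sgn3 i j j' < 0 -> sgn3 i' j' i * sgn3 i' j' j < 0 ->
  exists q, conv a [set i; j] q /\ conv a [set i'; j'] q.
Proof.
move=> ij ij'.
have ss : 0 < s * s by rewrite -expr2 exprn_even_gt0.
have E (x y : R) : (s * x) * (s * y) = (s * s) * (x * y) by ring.
rewrite /sgn_of /side_of !E !(pmulr_rlt0 _ ss).
set A := orient (a i) (a j) (a i'); set B := orient (a i) (a j) (a j').
set C := orient (a i') (a j') (a i); set D := orient (a i') (a j') (a j) => h1 h2.
have AB : A - B != 0 by apply/eqP => /subr0_eq e; move: h1; rewrite e -expr2 ltNge sqr_ge0.
have CD : C - D != 0 by apply/eqP => /subr0_eq e; move: h2; rewrite e -expr2 ltNge sqr_ge0.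
have rng (x y : R) : x * y < 0 -> 0 <= x / (x - y) <= 1.
  move=> h; have [x0|x0] := ltP 0 x.
    have xy : 0 < x - y by nra.
    rewrite divr_ge0 ?(ltW x0) ?(ltW xy) //= ler_pdivrMr // mul1r; nra.
  have xy : x - y < 0 by nra.
  rewrite -(opprK (x - y)) invrN mulrN -mulNr divr_ge0 /=; [|lra|lra].
  rewrite ler_pdivrMr; [nra|lra].
exists ((1 - C / (C - D)) *: a i + (C / (C - D)) *: a j); split.
  by apply/(conv_edgeP _ ij); exists (C / (C - D)); first exact: rng.
apply/(conv_edgeP _ ij'); exists (A / (A - B)); first exact: rng.
have ABe : A - B = - (C - D) by rewrite /A /B /C /D /orient; ring.
apply: point_ext; rewrite !coE.
  have -> : A / (A - B) = - A / (C - D) by rewrite ABe invrN mulrN mulNr.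
  apply: (mulfI CD); rewrite !mulrDr.
  have z (c x y : R) : (C - D) * ((1 - c / (C - D)) * x) = (C - D - c) * x by field.
  have z' (c x y : R) : (C - D) * (c / (C - D) * x) = c * x by field.
  rewrite !z ?z' //; rewrite /A /C /D /orient; ring.
have -> : A / (A - B) = - A / (C - D) by rewrite ABe invrN mulrN mulNr.
apply: (mulfI CD); rewrite !mulrDr.
have z (c x y : R) : (C - D) * ((1 - c / (C - D)) * x) = (C - D - c) * x by field.
have z' (c x y : R) : (C - D) * (c / (C - D) * x) = c * x by field.
rewrite !z ?z' //; rewrite /A /C /D /orient; ring.
Qed.

End Inside.

(** * Sectors at the tip and wedges at chain points *)

Section Crossings.
Variable l : nat.
Local Notation label := (option 'I_l.+2).
Local Notation lb := (chain_label l).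
Implicit Types (P : {set {set label}}) (i j k v u w c : nat).

Lemma edge_case P e : two_regular P -> e \in P ->
  (exists2 j, (j <= l.+1)%N & e = [set None; lb j]) \/
  (exists i j, [/\ (i < j)%N, (j <= l.+1)%N & e = [set lb i; lb j]]).
Proof.
move=> tr he; have [u [v [uv ->]]] := tr.1 _ he.
have [eu|[i hi eu]] := label_case u; have [ev|[j hj ev]] := label_case v.
- by rewrite eu ev eqxx in uv.
- by left; exists j; rewrite ?eu ?ev.
- by left; exists i; rewrite ?eu ?ev // setUC.
right; have [lt|gt|e0] := ltngtP i j.
- by exists i, j; rewrite eu ev.
- by exists j, i; rewrite eu ev setUC.
- by rewrite eu ev e0 eqxx in uv.
Qed.

Lemma lb_set2_neq i j k : (i <= l.+1)%N -> (j <= l.+1)%N -> (k <= l.+1)%N ->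
  lb k \notin [set lb i; lb j] -> k != i /\ k != j.
Proof. by move=> hi hj hk; rewrite !inE negb_or !lb_eq // => /andP[]. Qed.

(** The triangles p, i, j that contain the points close to p between the
    directions of the chain points c and c+1. *)
Definition sector c : nat -> nat -> bool := fun i j => (i <= c < j)%N.
(** For a polygon: whether it fills the directions at the tip between c and
    c+1. *)
Definition crossings P c : bool := parity P (under (sector c)).

Definition upto c (x : label) : bool := if x is Some i then (i <= c)%N else false.

Arguments upto : simpl never.
Arguments chain_label : simpl never.
Arguments under : simpl never.

Lemma upto_lb c i : (i <= l.+1)%N -> upto c (lb i) = (i <= c)%N.
Proof. by move=> hi; rewrite /upto /= inordK. Qed.

(** On chain edges sector c is the border of the labelling i <= c;
    subtracting it leaves the contribution of the two edges at the tip. *)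
Lemma crossings_tip P u w c : two_regular P -> neighbours P None (lb u) (lb w) ->
  (u <= l.+1)%N -> (w <= l.+1)%N -> crossings P c = (u <= c)%N (+) (w <= c)%N.
Proof.
move=> tr nb hu hw; rewrite /crossings -[LHS]addbF -(parity_border (upto c) tr) -parityD.
rewrite (parity_local tr nb).
  by rewrite !under_tip !border2 //= !upto_lb.
move=> e he; have [[j hj ->]|[i [j [ij hj ->]]] _] := edge_case tr he; first by rewrite !inE eqxx.
have ne : lb i != lb j by rewrite lb_eq; lia.
rewrite under_chain // border2 // !upto_lb /sector; [|lia|lia].
by case: (leqP i c); case: (leqP j c) => //=; lia.
Qed.

Lemma crossings_notip P c : two_regular P -> None \notin cover P -> crossings P c = false.
Proof.
move=> tr hn; rewrite /crossings -[LHS]addbF -[X in _ (+) X = _](parity_border (upto c) tr) -parityD.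
apply: parity_away => e he; have [[j hj ee]|[i [j [ij hj ->]]]] := edge_case tr he.
  by case/negP: hn; apply/bigcupP; exists e; rewrite // ee !inE eqxx.
have ne : lb i != lb j by rewrite lb_eq; lia.
rewrite under_chain // border2 // !upto_lb /sector; [|lia|lia].
by case: (leqP i c); case: (leqP j c) => //=; lia.
Qed.

End Crossings.

Arguments upto : simpl never.
Arguments chain_label : simpl never.
Arguments under : simpl never.

Section Wedges.
Variables (R : realType) (l : nat).
Local Notation label := (option 'I_l.+2).
Variables (a : label -> 'rV[R]_2) (s : R).
Hypothesis gp : general_position a.
Hypothesis s0 : s != 0.
Implicit Types (q : 'rV[R]_2) (P : {set {set label}}) (i j k v u w c : nat).
Local Notation side := (side_of a s).
Local Notation sgn3 := (sgn_of a s).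
Local Notation lb := (chain_label l).
Hypothesis tip_pos : forall i j, (i < j)%N -> (j <= l.+1)%N -> 0 < sgn3 None (lb i) (lb j).
Hypothesis chain_neg : forall i j k, (i < j)%N -> (j < k)%N -> (k <= l.+1)%N ->
  sgn3 (lb i) (lb j) (lb k) < 0.

Lemma side_tip_left q i v : near a s (lb v) q -> (i < v)%N -> (v <= l.+1)%N -> 0 < side None (lb i) q.
Proof.
move=> hn iv hv; apply: hn => //; last exact: tip_pos.
by rewrite lb_eq; lia.
Qed.

Lemma side_tip_right q j v : near a s (lb v) q -> (v < j)%N -> (j <= l.+1)%N -> 0 < side (lb j) None q.
Proof.
move=> hn vj hj; apply: hn => //; first by rewrite lb_eq; lia.
by rewrite sgn3_rot; apply: tip_pos.
Qed.

Lemma in_tip_triangle_near q v i j : generic a q -> near a s (lb v) q -> (v <= l.+1)%N ->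
  (i < j)%N -> (j <= l.+1)%N -> i != v -> j != v -> in_tip_triangle a s q i j = (i < v < j)%N.
Proof.
move=> g hn hv ij hj iv jv; rewrite /in_tip_triangle.
have ti x : (x <= l.+1)%N -> x != v -> (0 < side None (lb x) q) = (x < v)%N.
  move=> hx xv; case: (ltnP x v) => h; first by rewrite (side_tip_left hn).
  rewrite (generic_sideN s0 g (_ : lb x != None)) // (side_tip_right hn) //; lia.
have tj x : (x <= l.+1)%N -> x != v -> (0 < side (lb x) None q) = (v < x)%N.
  by move=> hx xv; rewrite (generic_sideN s0 g (_ : None != lb x)) // ti //; lia.
rewrite ti ?tj //; [|lia].
case: (boolP (i < v)%N) => iv' //=; case: (boolP (v < j)%N) => vj //=.
apply: hn; rewrite ?lb_eq //; try lia.
by rewrite sgn3_rot sgn3_swap sgn3_rot sgn3_rot oppr_gt0 chain_neg.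
Qed.

Lemma encloses_right q v j : generic a q -> near a s (lb v) q -> (v < j)%N -> (j <= l.+1)%N ->
  in_tip_triangle a s q v j = (0 < side None (lb v) q) && (0 < side (lb v) (lb j) q).
Proof. by move=> g hn vj hj; rewrite /in_tip_triangle (side_tip_right hn). Qed.

Lemma encloses_left q v i : generic a q -> near a s (lb v) q -> (i < v)%N -> (v <= l.+1)%N ->
  in_tip_triangle a s q i v = (0 < side (lb v) None q) && (0 < side (lb i) (lb v) q).
Proof. by move=> g hn iv hv; rewrite /in_tip_triangle (side_tip_left hn). Qed.

(** Close to v, a chain edge that misses v contains q in its triangle
    exactly when it passes over v, so only the two edges at v need
    correction. *)
Lemma encloses_near P q v (B : nat -> nat -> bool) x y : two_regular P -> generic a q ->
  near a s (lb v) q -> (v <= l.+1)%N -> neighbours P (lb v) x y ->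
  (forall i j, (i < j)%N -> (j <= l.+1)%N -> i != v -> j != v -> B i j = (i < v < j)%N) ->
  encloses a s P q = parity P (under B) (+)
    (under (in_tip_triangle a s q) [set lb v; x] (+) under B [set lb v; x]) (+)
    (under (in_tip_triangle a s q) [set lb v; y] (+) under B [set lb v; y]).
Proof.
move=> tr g hn hv nb hB; rewrite -addbA.
have := @parity_local _ P (fun e => under (in_tip_triangle a s q) e (+) under B e) _ _ _ tr nb.
rewrite parityD -/(encloses a s P q) => <-; first by rewrite [parity P (under B) (+) _]addbC -addbA addbb addbF.
move=> e he hve; have [[j hj ->]|[i [j [ij hj ee]]]] := edge_case tr he.
  by rewrite !under_tip.
move: hve; rewrite ee => /lb_set2_neq[||//|vi vj]; [lia|done|].
rewrite eq_sym in vi; rewrite eq_sym in vj.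
by rewrite !under_chain // (in_tip_triangle_near g hn hv ij hj vi vj) hB ?addbb.
Qed.

(** Close to a point that is not a vertex of P the predicate is that of
    the sector. *)
Lemma encloses_away P q v : two_regular P -> generic a q -> near a s (lb v) q -> (v <= l.+1)%N ->
  lb v \notin cover P -> encloses a s P q = crossings P v.
Proof.
move=> tr g hn hv hc; apply: eq_parity => e he.
have hve : lb v \notin e by apply: contra hc => h; apply/bigcupP; exists e.
have [[j hj ->]|[i [j [ij hj ee]]]] := edge_case tr he; first by rewrite !under_tip.
move: hve; rewrite ee => /lb_set2_neq[||//|vi vj]; [lia|done|].
rewrite eq_sym in vi; rewrite eq_sym in vj.
by rewrite !under_chain // (in_tip_triangle_near g hn hv ij hj vi vj) /sector; lia.
Qed.

Lemma sgn_vrr v u w : (v < u)%N -> (u < w)%N -> (w <= l.+1)%N -> sgn3 (lb v) (lb u) (lb w) < 0.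
Proof. exact: chain_neg. Qed.

Lemma sgn_vll v u w : (u < w)%N -> (w < v)%N -> (v <= l.+1)%N -> sgn3 (lb v) (lb u) (lb w) < 0.
Proof. by move=> *; rewrite sgn3_rot chain_neg. Qed.

Lemma sgn_vlr v u w : (u < v)%N -> (v < w)%N -> (w <= l.+1)%N -> 0 < sgn3 (lb v) (lb u) (lb w).
Proof. by move=> *; rewrite sgn3_swap oppr_gt0 chain_neg. Qed.

Lemma sgn_vrp v w : (v < w)%N -> (w <= l.+1)%N -> 0 < sgn3 (lb v) (lb w) None.
Proof. by move=> *; rewrite -sgn3_rot tip_pos. Qed.

Lemma sgn_vlp v u : (u < v)%N -> (v <= l.+1)%N -> sgn3 (lb v) (lb u) None < 0.
Proof. by move=> *; rewrite sgn3_swap oppr_lt0 sgn_vrp. Qed.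

Lemma sgn_vpr v w : (v < w)%N -> (w <= l.+1)%N -> sgn3 (lb v) None (lb w) < 0.
Proof. by move=> *; rewrite sgn3_swap oppr_lt0 tip_pos. Qed.

Lemma sgn_vpl v u : (u < v)%N -> (v <= l.+1)%N -> 0 < sgn3 (lb v) None (lb u).
Proof. by move=> *; rewrite sgn3_rot tip_pos. Qed.

Lemma sgn3_swap_last (x y z : label) : sgn3 x z y = - sgn3 x y z.
Proof. by rewrite sgn3_rot sgn3_swap -sgn3_rot. Qed.

Lemma sgn3_same_last (x y : label) : sgn3 x y y = 0.
Proof. by rewrite sgn3_rot sgn3_same. Qed.

Lemma wedge_sides (x y z : label) q : in_wedge a s x y z q ->
  (0 < sgn3 x y z -> 0 < side x y q /\ 0 < side z x q) /\
  (sgn3 x y z < 0 -> 0 < side y x q /\ 0 < side x z q).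
Proof.
move=> h; have [k1 k2] := h y; have [k3 k4] := h z.
rewrite sgn3_rot sgn3_same in k1 k2; rewrite (sgn3_rot a s _ z z) sgn3_same in k3 k4.
rewrite (sgn3_swap_last x y z) in k3 k4.
by split=> hs; split; [apply: k1|apply: k4|apply: k2|apply: k3]; rewrite ?lexx //; lra.
Qed.

Lemma under_right B v w : (v < w)%N -> (w <= l.+1)%N -> under B [set lb v; lb w] = B v w.
Proof. exact: under_chain. Qed.

Lemma under_left B v u : (u < v)%N -> (v <= l.+1)%N -> under B [set lb v; lb u] = B u v.
Proof. by move=> *; rewrite setUC under_chain. Qed.

(** The predicate differs from sector v on exactly one of the two edges at
    v. *)
Lemma encloses_corner P q v u w : two_regular P -> generic a q -> near a s (lb v) q ->
  in_wedge a s (lb v) (lb u) (lb w) q -> neighbours P (lb v) (lb u) (lb w) ->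
  (u < w)%N -> (w <= l.+1)%N -> (v <= l.+1)%N -> encloses a s P q = ~~ crossings P v.
Proof.
move=> tr g hn hw nb uw hw' hv; have hu : (u <= l.+1)%N by lia.
have nb' := nb; case: nb' => _; rewrite !lb_eq // => uv wv _.
rewrite (encloses_near tr g hn hv nb (B := sector v)); last first.
  by rewrite /sector => i j *; lia.
rewrite -/(crossings P v) -addbA -addbT; congr (_ (+) _).
have [kp kn] := wedge_sides hw; have [k1 k2] := hw None.
have [lt|gt|e] := ltngtP v u; last by rewrite e eqxx in uv.
- have vw := ltn_trans lt uw; have h1 := sgn_vpr lt hu; have h2 := sgn_vpr vw hw'.
  have r : 0 < side None (lb v) q by apply: k2; lra.
  have [e1 e2] := kn (sgn_vrr lt uw hw').
  rewrite !under_right // !encloses_right // r e2 (generic_sideN s0 g (_ : lb u != lb v)) ?e1 ?lb_eq //.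
  by rewrite /sector leqnn lt vw.
have [lt|gt'|e] := ltngtP v w; last by rewrite e eqxx in wv.
- have [e1 e2] := kp (sgn_vlr gt lt hw').
  rewrite !(under_left _ gt hv) !(under_right _ lt hw') encloses_left // encloses_right //.
  rewrite (generic_sideN s0 g (_ : lb w != lb v)) ?e2 ?lb_eq //.
  rewrite (generic_sideN s0 g (_ : lb v != lb u)) ?e1 ?lb_eq 1?eq_sym // !andbF.
  by rewrite /sector leqnn lt ltnn !andbF.
have h1 := sgn_vpl gt hv; have h2 := sgn_vpl gt' hv.
have r : 0 < side (lb v) None q by apply: k1; lra.
have [e1 e2] := kn (sgn_vll uw gt' hv).
rewrite !under_left // !encloses_left // r e1 (generic_sideN s0 g (_ : lb v != lb w)) ?e2 ?lb_eq 1?eq_sym //.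
by rewrite /sector ltnn !andbF.
Qed.

Lemma encloses_corner_tip_right P q v w : two_regular P -> generic a q -> near a s (lb v) q ->
  in_wedge a s (lb v) None (lb w) q -> neighbours P (lb v) None (lb w) ->
  (v < w)%N -> (w <= l.+1)%N -> encloses a s P q = crossings P v.
Proof.
move=> tr g hn hw nb vw hw'; have hv : (v <= l.+1)%N by lia.
rewrite (encloses_near tr g hn hv nb (B := sector v)); last first.
  by rewrite /sector => i j *; lia.
rewrite -/(crossings P v) [[set _; None]]setUC !under_tip addbF.
have [kp kn] := wedge_sides hw; have [e1 e2] := kn (sgn_vpr vw hw').
by rewrite !under_right // encloses_right // e1 e2 /sector leqnn vw /= !addbF.
Qed.

(** This is sector v.-1, written without the predecessor. *)
Definition sector_left v : nat -> nat -> bool := fun i j => (i < v <= j)%N.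

Lemma encloses_corner_tip_left P q v w : two_regular P -> generic a q -> near a s (lb v) q ->
  in_wedge a s (lb v) None (lb w) q -> neighbours P (lb v) None (lb w) ->
  (w < v)%N -> (v <= l.+1)%N -> encloses a s P q = crossings P v.-1.
Proof.
move=> tr g hn hw nb wv hv; have v0 : (0 < v)%N by lia.
have eqs : forall i j, sector v.-1 i j = sector_left v i j by move=> i j; rewrite /sector /sector_left; lia.
rewrite (encloses_near tr g hn hv nb (B := sector v.-1)); last first.
  by rewrite /sector => i j *; lia.
rewrite -/(crossings P v.-1) [[set _; None]]setUC !under_tip addbF.
have [kp kn] := wedge_sides hw; have [e1 e2] := kp (sgn_vpl wv hv).
have E : sector v.-1 w v by rewrite eqs /sector_left wv /=.
by rewrite !under_left // encloses_left // e1 e2 E /= !addbF.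
Qed.

(** Adding the border of the labelling that tells on which side of q the
    ray from p to a vertex passes turns the predicate into one that vanishes
    away from p. *)
Lemma encloses_corner_tip P q u w : two_regular P -> generic a q -> near a s None q ->
  in_wedge a s None (lb u) (lb w) q -> neighbours P None (lb u) (lb w) ->
  (u < w)%N -> (w <= l.+1)%N -> encloses a s P q.
Proof.
move=> tr g hn hw nb uw hw'; have hu : (u <= l.+1)%N by lia.
pose r (x : label) : bool := (x != None) && (0 < side None x q).
have [kp _] := wedge_sides hw; have [e1 e2] := kp (tip_pos uw hw').
have q0 : 0 < side None (lb 0) q.
  have [u0|u0] := posnP u; first by rewrite -u0.
  have w0 : (0 < w)%N by lia.
  have [k1 _] := hw (lb 0); have h1 := tip_pos u0 hu; have h2 := tip_pos w0 hw'.
  by apply: k1; rewrite ?ltW ?addr_gt0.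
have mono i j : (i < j)%N -> (j <= l.+1)%N -> 0 < side None (lb j) q -> 0 < side None (lb i) q.
  move=> ij hj rj; have [i0|i0] := posnP i; first by rewrite i0.
  have j0 : (0 < j)%N by lia.
  have hi : (i <= l.+1)%N by lia.
  have t1 := tip_pos ij hj; have t2 := tip_pos i0 hi; have t3 := tip_pos j0 hj.
  have E : sgn3 None (lb 0) (lb j) * side None (lb i) q =
           side None (lb 0) q * sgn3 None (lb i) (lb j) + side None (lb j) q * sgn3 None (lb 0) (lb i).
    by rewrite /sgn_of /side_of /orient; ring.
  rewrite -(pmulr_rgt0 _ t3) E; apply: addr_gt0; exact: mulr_gt0.
have n (x : label) : x != None -> (0 < side x None q) = ~~ (0 < side None x q).
  by move=> hx; rewrite (generic_sideN s0 g) // eq_sym.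
rewrite /encloses -[parity _ _]addbF -(parity_border r tr) -parityD (parity_local tr nb).
  rewrite !under_tip !border2 // /r /= e1.
  by rewrite -(negbK (0 < side None (lb w) q)) -n // e2.
move=> e he; have [[j hj ->]|[i [j [ij hj ->]]] _] := edge_case tr he; first by rewrite !inE eqxx.
have ne : lb i != lb j by rewrite lb_eq; lia.
rewrite under_chain // border2 // /r /= /in_tip_triangle n //.
have -> : 0 < side (lb i) (lb j) q.
  by apply: hn => //; rewrite -sgn3_rot tip_pos.
rewrite andbT; have := mono _ _ ij hj.
by case: (0 < side None (lb i) q); case: (0 < side None (lb j) q) => // /(_ isT).
Qed.

Lemma tip_nonneg i j : (i <= j)%N -> (j <= l.+1)%N -> 0 <= sgn3 None (lb i) (lb j).
Proof.
rewrite leq_eqVlt => /orP[/eqP-> _|ij hj]; last by rewrite ltW // tip_pos.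
by rewrite sgn3_rot sgn3_same.
Qed.

Lemma right_nonpos v u w : (v < u)%N -> (u <= w)%N -> (w <= l.+1)%N -> sgn3 (lb v) (lb u) (lb w) <= 0.
Proof.
move=> vu; rewrite leq_eqVlt => /orP[/eqP-> _|uw hw]; last by rewrite ltW // sgn_vrr.
by rewrite sgn3_rot sgn3_same.
Qed.

Lemma left_nonpos v u w : (u <= w)%N -> (w < v)%N -> (v <= l.+1)%N -> sgn3 (lb v) (lb u) (lb w) <= 0.
Proof.
rewrite leq_eqVlt => /orP[/eqP-> _ _|uw wv hv]; last by rewrite ltW // sgn_vll.
by rewrite sgn3_rot sgn3_same.
Qed.

(** Take a point close to p in the wedge between c and c+1. *)
Lemma sector_germ c : (c <= l)%N ->
  exists q, generic a q /\ forall i j, (i < j)%N -> (j <= l.+1)%N -> in_tip_triangle a s q i j = sector c i j.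
Proof.
move=> hc; have [q [g hn hw]] := wedge_generic s gp None (lb c) (lb c.+1).
have left k : (k <= c)%N -> 0 < side None (lb k) q.
  move=> kc; have [h _] := hw (lb k).
  by apply: h; rewrite ?tip_nonneg ?ltr_wpDl ?tip_nonneg ?tip_pos //; lia.
have right k : (c < k)%N -> (k <= l.+1)%N -> 0 < side (lb k) None q.
  move=> ck hk; have [_ h] := hw (lb k).
  rewrite !(sgn3_swap_last _ _ (lb k)) in h; apply: h; rewrite ?oppr_le0 ?tip_nonneg //; first by lia.
  by rewrite -opprD oppr_lt0 ltr_pwDl ?tip_pos ?tip_nonneg.
exists q; split=> // i j ij hj; have hi : (i <= l.+1)%N by lia.
rewrite /in_tip_triangle /sector (hn (lb i) (lb j)) // ?andbT; last by rewrite -sgn3_rot tip_pos.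
congr (_ && _).
  case: (leqP i c) => ic; first exact: left.
  by rewrite (generic_sideN s0 g (_ : lb i != None)) // right.
case: (ltnP c j) => cj; first exact: right.
by rewrite (generic_sideN s0 g (_ : None != lb j)) // left.
Qed.

(** The triangles p, i, j that contain the points close to the chain point v in
    the angle between the directions of b-1 and b; for b = v+1 the direction of
    the tip takes the place of b-1. *)
Definition fan v b : nat -> nat -> bool := fun i j => ((i < v < j) || ((i == v) && (b <= j)))%N.

Lemma fan_encloses q v b : generic a q -> near a s (lb v) q -> (v <= l)%N -> (v < b)%N ->
  (0 < side None (lb v) q) || [forall i : 'I_v, 0 < side (lb v) (lb i) q] ->
  (forall j, (v < j)%N -> (j <= l.+1)%N ->
     (0 < side None (lb v) q) && (0 < side (lb v) (lb j) q) = (b <= j)%N) ->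
  forall i j, (i < j)%N -> (j <= l.+1)%N -> in_tip_triangle a s q i j = fan v b i j.
Proof.
move=> g hn hv vb hl hr i j ij hj; have hv' : (v <= l.+1)%N by lia.
rewrite /fan; have [ei|iv] := eqVneq i v.
  by rewrite ei in ij *; rewrite encloses_right // hr // ltnn.
have [ej|jv] := eqVneq j v; last by rewrite (in_tip_triangle_near g hn hv' ij hj iv jv) orbF.
rewrite ej in ij *; rewrite encloses_left // ltnn andbF /=.
have vi : lb v != lb i by rewrite lb_eq //; lia.
rewrite (generic_sideN s0 g (_ : None != lb v)) // (generic_sideN s0 g vi) -negb_or.
by case/orP: hl => [->|/forallP/(_ (Ordinal ij)) /= ->] //; rewrite orbT.
Qed.

(** The wedge at v is spanned by the tip and v+1, by b-1 and b, or, for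
    b = l+2, by l+1 and 0; the last needs v > 0. *)
Lemma fan_germ v b : (v < b)%N -> (b <= l.+2)%N -> (v <= l)%N -> (b = l.+2 -> 0 < v)%N ->
  exists q, generic a q /\ forall i j, (i < j)%N -> (j <= l.+1)%N -> in_tip_triangle a s q i j = fan v b i j.
Proof.
move=> vb bl hvl hb; have hv : (v <= l.+1)%N by lia.
have [eb|nb] := eqVneq b v.+1.
  have [q [g hn hw]] := wedge_generic s gp (lb v) None (lb v.+1).
  have r : 0 < side None (lb v) q.
    have [_ h] := hw None; have h1 : sgn3 (lb v) None (lb v.+1) < 0 by apply: sgn_vpr; lia.
    by rewrite sgn3_same_last add0r in h; apply: h => //; apply: ltW.
  exists q; split=> //; apply: fan_encloses => //; first by rewrite r.
  move=> j vj hj; rewrite r eb vj /=; have [h _] := hw (lb j).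
  have h1 := sgn_vrp vj hj.
  have h2 : 0 <= sgn3 (lb v) (lb j) (lb v.+1) by rewrite sgn3_swap_last oppr_ge0 right_nonpos.
  by apply: h; rewrite ?(ltW h1) // ltr_pwDl.
have [eb|nb'] := eqVneq b l.+2.
  have v0 := hb eb.
  have [q [g hn hw]] := wedge_generic s gp (lb v) (lb l.+1) (lb 0).
  exists q; split=> //; apply: fan_encloses => //.
    apply/orP; right; apply/forallP => -[i iv] /=; have [h _] := hw (lb i).
    have h1 : 0 < sgn3 (lb v) (lb i) (lb l.+1) by apply: sgn_vlr.
    have h2 : 0 <= sgn3 (lb v) (lb i) (lb 0) by rewrite sgn3_swap_last oppr_ge0 left_nonpos.
    by apply: h; rewrite ?(ltW h1) // ltr_pwDl.
  move=> j vj hj; rewrite eb leqNgt ltnS hj /= (generic_sideN s0 g (_ : lb j != lb v)); last first.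
    by rewrite lb_eq //; lia.
  have [_ h] := hw (lb j); rewrite h ?andbF //.
  - exact: right_nonpos.
  - by rewrite ltW // sgn3_swap_last oppr_lt0 sgn_vlr.
  - by apply: ltr_wnDl; [exact: right_nonpos|rewrite sgn3_swap_last oppr_lt0 sgn_vlr].
have vb1 : (v < b.-1)%N by lia.
have hb1 : (b <= l.+1)%N by lia.
have [q [g hn hw]] := wedge_generic s gp (lb v) (lb b.-1) (lb b).
have r : 0 < side None (lb v) q.
  have [_ h] := hw None; have h1 : sgn3 (lb v) None (lb b) < 0 by apply: sgn_vpr.
  have h2 : sgn3 (lb v) None (lb b.-1) < 0 by apply: sgn_vpr; lia.
  by apply: h; rewrite ?ltW //; lra.
have nv j : (v < j)%N -> (j <= l.+1)%N -> lb j != lb v by move=> *; rewrite lb_eq //; lia.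
have prd j : (b <= j)%N -> (b.-1 < j)%N by lia.
have prd' j : (j < b)%N -> (j <= b.-1)%N by lia.
have hb1' : (b.-1 <= l.+1)%N by lia.
exists q; split=> //; apply: fan_encloses => //; first by rewrite r.
move=> j vj hj; rewrite r /=; have [h h'] := hw (lb j).
case: (leqP b j) => bj.
  have h1 : 0 < sgn3 (lb v) (lb j) (lb b.-1).
    by rewrite sgn3_swap_last oppr_gt0; apply: sgn_vrr => //; apply: prd.
  have h2 : 0 <= sgn3 (lb v) (lb j) (lb b) by rewrite sgn3_swap_last oppr_ge0 right_nonpos.
  by apply: h; rewrite ?(ltW h1) // ltr_pwDl.
rewrite (generic_sideN s0 g (nv j vj hj)).
have h1 : sgn3 (lb v) (lb j) (lb b) < 0 by apply: sgn_vrr.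
have h2 : sgn3 (lb v) (lb j) (lb b.-1) <= 0 by apply: right_nonpos => //; apply: prd'.
by rewrite h' ?(ltW h1) // ltr_wnDl.
Qed.

End Wedges.

Local Open Scope nat_scope.

(** * The shape of one pseudo-triangle *)

(** Discrete continuity: a path from one side of y to the other that avoids y
    has a link passing over y. *)
Lemma exit_link y t z : z < y -> y < last z t -> y \notin z :: t ->
  exists u u', [/\ (u, u') \in links (z :: t), u < y & y < u'].
Proof.
elim: t z => [|x t IH] z zy hl hy; first by move: hl => /=; lia.
have lk : links [:: z, x & t] = (z, x) :: links (x :: t) by [].
move: hy; rewrite inE negb_or => /andP[_ hy].
case: (ltngtP x y) => c.
- have [u [u' [h1 h2 h3]]] := IH x c hl hy.
  by exists u, u'; rewrite lk inE h1 orbT.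
- by exists z, x; rewrite lk mem_head.
- by rewrite c mem_head in hy.
Qed.

Lemma links_suffix s1 s2 e : e \in links s2 -> e \in links (s1 ++ s2).
Proof.
case: s2 => [|x s2] //; rewrite links_cat mem_cat => ->; exact: orbT.
Qed.

Lemma links_prefix s1 s2 e : e \in links s1 -> e \in links (s1 ++ s2).
Proof.
case/lastP: s1 => [|s1 x] //; rewrite cat_rcons links_cat mem_cat => ->; exact: orTb.
Qed.

(** If the path returned below a vertex y just reached from x, a later link
    would have to pass over y on the way to the maximal end.  That link starts
    above x, the minimal vertex, so it would cross the link from x to y. *)
Lemma noncrossing_sorted x s : uniq (x :: s) -> {in s, forall y, x < y} ->
  {in s, forall y, y <= last x s} ->
  (forall i j i' j', (i, j) \in links (x :: s) ->
     (i', j') \in links (x :: s) -> i < i' -> i' < j -> j < j' -> False) ->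
  path ltn x s.
Proof.
elim: s x => //= y s IH x /and3P[xs ys us] hmin hmax hnc.
have lk : links [:: x, y & s] = (x, y) :: links (y :: s) by [].
have xy : x < y by apply: hmin; rewrite mem_head.
rewrite xy /=; apply: IH.
- by rewrite /= ys.
- move=> z hz; rewrite ltnNge; apply/negP => zy.
  have {}zy : z < y by rewrite ltn_neqAle zy andbT; apply: contraNneq ys => <-.
  have [s1 [s2 es]] : exists s1 s2, s = s1 ++ z :: s2 by case/splitPr: hz => s1 s2; exists s1, s2.
  have hl : last y s \in s by case: (s) hz => //= ? ? _; apply: mem_last.
  have yl : y < last y s.
    rewrite ltn_neqAle hmax ?mem_head // andbT.
    by apply: contraNneq ys => ->.
  have ez : last z s2 = last y s by rewrite es last_cat.
  have [||u [u' [h1 h2 h3]]] := @exit_link y s2 z zy; first by rewrite ez.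
    by move: ys; rewrite es mem_cat negb_or => /andP[].
  have hu : (u, u') \in links [:: x, y & s].
    by rewrite lk inE es -cat_cons links_suffix ?orbT.
  have xu : x < u.
    apply: hmin; rewrite inE es mem_cat.
    suff -> : u \in z :: s2 by rewrite !orbT.
    move: h1; rewrite /links; elim: (s2) (z) => //= b t IHt b'; rewrite inE => /orP[/eqP[->]|/IHt].
      by rewrite mem_head.
    by move=> h; rewrite inE h orbT.
  by apply: (hnc _ _ _ _ _ hu xu h2 h3); rewrite lk mem_head.
- by move=> z hz; apply: hmax; rewrite inE hz orbT.
- by move=> i j i' j' h1 h2; apply: hnc; rewrite lk inE ?h1 ?h2 orbT.
Qed.

Lemma sorted_iota u v s : sorted ltn s -> (forall c, (c \in s) = (u < c < v)) -> s = iota u.+1 (v - u).-1.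
Proof.
move=> ss hs; apply: (irr_sorted_eq ltn_trans ltnn) => //; first exact: iota_ltn_sorted.
by move=> c; rewrite hs mem_iota; lia.
Qed.

Section Tiles.
Variable l : nat.
Local Notation label := (option 'I_l.+2).
Local Notation lb := (chain_label l).

Definition tip_polygon (t : seq nat) : {set {set label}} := cycle_edges (None :: map lb t).

Definition chain_triangle (t : nat * nat * nat) : {set {set label}} :=
  cycle_edges [:: lb t.1.1; lb t.1.2; lb t.2].

(** Only then is gap_path u v k k' the boundary of a polygon on the chain, with
    k and k' genuinely outside the interval from u to v. *)
Definition gap_ok (u v : nat) (k k' : option nat) : Prop :=
  [/\ u < v, v <= l.+1, (forall x, k = Some x -> x < u) & (forall x, k' = Some x -> v < x <= l.+1)].

Lemma map_lb_inj (t : seq nat) : {in t, forall x, x <= l.+1} -> {in t &, injective lb}.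
Proof. by move=> h x y hx hy; apply: lb_inj; apply: h. Qed.

Lemma map_lb_uniq (t : seq nat) : {in t, forall x, x <= l.+1} -> uniq (map lb t) = uniq t.
Proof. by move=> h; apply: map_inj_in_uniq; apply: map_lb_inj. Qed.

Lemma mem_map_lb (t : seq nat) x : {in t, forall y, y <= l.+1} -> x <= l.+1 -> (lb x \in map lb t) = (x \in t).
Proof.
move=> h hx; apply/mapP/idP => [[y hy /lb_inj e]|h']; last by exists x.
by rewrite e // h.
Qed.

Lemma triangle_set (x y z : label) : uniq [:: x; y; z] ->
  cycle_edges [:: x; y; z] = [set [set x; y]; [set y; z]; [set z; x]].
Proof.
by move=> us; rewrite cycle_edges_cons //; apply/setP => e; rewrite !inE orbA.
Qed.

Lemma triangle_sorted (s : seq label) : uniq s -> size s = 3 -> None \notin s ->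
  exists i k j, [/\ i < k, k < j, j <= l.+1 & cycle_edges s = chain_triangle (i, k, j)].
Proof.
case: s => [|x [|y [|z [|]]]] // us _; rewrite !inE !negb_or => /and3P[]; move: us.
have [->|[x' hx ->]] := label_case x; first by move=> _; rewrite eqxx.
have [->|[y' hy ->]] := label_case y; first by move=> _ _; rewrite eqxx.
have [->|[z' hz ->]] := label_case z; first by move=> _ _ _; rewrite eqxx.
move=> us; have hrot n := cycle_edges_rot n us; have hrev := cycle_edges_rev us.
have usr : uniq (rev [:: lb x'; lb y'; lb z']) by rewrite rev_uniq.
have hrr n := cycle_edges_rot n usr.
move: us; rewrite /= !inE !negb_or !lb_eq // => /and3P[/andP[xy xz] yz _] _ _ _.
have [x1|x1|e] := ltngtP x' y'; last by rewrite e eqxx in xy.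
  have [x2|x2|e] := ltngtP y' z'; last by rewrite e eqxx in yz.
    by exists x', y', z'.
  have [x3|x3|e] := ltngtP x' z'; last by rewrite e eqxx in xz.
    by exists x', z', y'; rewrite -hrev -(hrr 2).
  by exists z', x', y'; rewrite -(hrot 2).
have [x2|x2|e] := ltngtP y' z'; last by rewrite e eqxx in yz.
  have [x3|x3|e] := ltngtP x' z'; last by rewrite e eqxx in xz.
    by exists y', x', z'; rewrite -hrev -(hrr 1).
  by exists y', z', x'; rewrite -(hrot 1).
by exists z', y', x'; rewrite -hrev.
Qed.

End Tiles.

Section Shape.
Variables (R : realType) (l : nat).
Local Notation label := (option 'I_l.+2).
Variables (a : label -> 'rV[R]_2) (s : R).
Hypothesis gp : general_position a.
Hypothesis s0 : (s != 0)%R.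
Local Notation sgn3 := (sgn_of a s).
Local Notation lb := (chain_label l).
Hypothesis tip_pos : forall i j, i < j -> j <= l.+1 -> (0 < sgn3 None (lb i) (lb j))%R.
Hypothesis chain_neg : forall i j k, i < j -> j < k -> k <= l.+1 ->
  (sgn3 (lb i) (lb j) (lb k) < 0)%R.
Implicit Types P : {set {set label}}.

Lemma neighbours_sym P (v u w : label) : neighbours P v u w -> neighbours P v w u.
Proof. by case=> uw uv wv h; split=> //; [rewrite eq_sym|move=> x; rewrite h orbC]. Qed.

Lemma neighbours_cover P (v u w : label) : neighbours P v u w -> [/\ v \in cover P, u \in cover P & w \in cover P].
Proof.
case=> _ _ _ h; have hu : [set v; u] \in P by rewrite h eqxx.
have hw : [set v; w] \in P by rewrite h eqxx orbT.
by split; apply/bigcupP; [exists [set v; u]|exists [set v; u]|exists [set v; w]]; rewrite // !inE eqxx ?orbT.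
Qed.

Lemma convex_cover P v : convex_vertex a P v -> v \in cover P.
Proof. by move=> [u [w [_ hu _ _]]]; apply/bigcupP; exists [set v; u]; rewrite // !inE eqxx. Qed.

(** The wedge between two chords at v never contains the direction of the
    tip, and crossings tells whether the polygon fills that direction. *)
Lemma convex_chain P v u w : two_regular P -> neighbours P (lb v) (lb u) (lb w) ->
  v <= l.+1 -> u <= l.+1 -> w <= l.+1 -> convex_vertex a P (lb v) <-> ~~ crossings P v.
Proof.
move=> tr nb hv hu hw; have uw : u != w by case: nb; rewrite lb_eq.
have [lt|gt|e] := ltngtP u w; last by rewrite e eqxx in uw.
  by apply: (convex_vertexE gp s0 tip_pos tr nb) => q g hn hq; apply: (encloses_corner s0 tip_pos chain_neg tr g hn hq nb).
have nb' := neighbours_sym nb.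
by apply: (convex_vertexE gp s0 tip_pos tr nb') => q g hn hq; apply: (encloses_corner s0 tip_pos chain_neg tr g hn hq nb').
Qed.

Lemma convex_tip_right P v w : two_regular P -> neighbours P (lb v) None (lb w) ->
  v < w -> w <= l.+1 -> convex_vertex a P (lb v) <-> crossings P v.
Proof.
move=> tr nb vw hw; apply: (convex_vertexE gp s0 tip_pos tr nb) => q g hn hq.
exact: (encloses_corner_tip_right s0 tip_pos chain_neg tr g hn hq nb).
Qed.

Lemma convex_tip_left P v w : two_regular P -> neighbours P (lb v) None (lb w) ->
  w < v -> v <= l.+1 -> convex_vertex a P (lb v) <-> crossings P v.-1.
Proof.
move=> tr nb vw hw; apply: (convex_vertexE gp s0 tip_pos tr nb) => q g hn hq.
exact: (encloses_corner_tip_left s0 tip_pos chain_neg tr g hn hq nb).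
Qed.

Lemma convex_tip P u w : two_regular P -> neighbours P None (lb u) (lb w) ->
  u < w -> w <= l.+1 -> convex_vertex a P None.
Proof.
move=> tr nb uw hw; apply/(convex_vertexE gp s0 tip_pos tr nb (b := true)) => // q g hn hq.
exact: (encloses_corner_tip s0 tip_pos tr g hn hq nb).
Qed.

Lemma simple_cycle P : simple_polygon a P ->
  exists t : seq label, [/\ uniq t, 2 < size t & P = cycle_edges t].
Proof. by move=> [t [us hs ->] _]; exists t. Qed.

Lemma simple_regular P : simple_polygon a P -> two_regular P.
Proof. by move=> /simple_cycle[t [us hs ->]]; apply: cycle_two_regular. Qed.

Lemma simple_noncrossing P i i' j j' : simple_polygon a P ->
  [set lb i; lb j] \in P -> [set lb i'; lb j'] \in P ->
  i < i' -> i' < j -> j < j' -> j' <= l.+1 -> False.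
Proof.
move=> [t [_ _ _ hnc]] h1 h2 ii ij jj hj.
have ne x y : x <= l.+1 -> y <= l.+1 -> x != y -> lb x != lb y by move=> ? ?; rewrite lb_eq.
have ss : (sgn3 (lb i) (lb j) (lb i') * sgn3 (lb i) (lb j) (lb j') < 0)%R.
  rewrite nmulr_llt0; first by rewrite sgn3_swap_last oppr_gt0 chain_neg //; lia.
  by apply: chain_neg; lia.
have ss' : (sgn3 (lb i') (lb j') (lb i) * sgn3 (lb i') (lb j') (lb j) < 0)%R.
  rewrite pmulr_llt0; first by rewrite -sgn3_rot; apply: chain_neg; lia.
  by rewrite sgn3_swap_last oppr_gt0; apply: chain_neg; lia.
have [q [c1 c2]] := segments_meet s0 (ne i j ltac:(lia) ltac:(lia) ltac:(lia))
  (ne i' j' ltac:(lia) ltac:(lia) ltac:(lia)) ss ss'.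
have nef : [set lb i; lb j] != [set lb i'; lb j'].
  apply/eqP => /setP/(_ (lb i)); rewrite !inE eqxx /= !lb_eq; lia.
have [x hx _] := hnc _ _ _ h1 h2 nef c1 c2.
by move: hx; rewrite !inE => /andP[/orP[]/eqP->]; rewrite !lb_eq; lia.
Qed.

(** Without the tip there are no crossings, so every vertex is a
    corner. *)
Lemma chain_polygon P : pseudo_triangle a P -> None \notin cover P ->
  exists i k j, [/\ i < k, k < j, j <= l.+1 & P = chain_triangle l (i, k, j)].
Proof.
move=> [sp h3] hn; have tr := simple_regular sp; have [t [us hs eP]] := simple_cycle sp.
have hc : [set v : label | `[< convex_vertex a P v >]] = cover P.
  apply/setP => v; rewrite inE; apply/asboolP/idP => [/convex_cover //|hv].
  have [u [w nb]] := tr.2 _ hv; have [_ hu hw] := neighbours_cover nb.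
  have [ev|[v' hv' ev]] := label_case v; first by rewrite -ev hv in hn.
  have [eu|[u' hu' eu]] := label_case u; first by rewrite -eu hu in hn.
  have [ew|[w' hw' ew]] := label_case w; first by rewrite -ew hw in hn.
  rewrite ev eu ew in nb *.
  by apply/(convex_chain tr nb) => //; rewrite crossings_notip.
rewrite hc eP cover_cycle_edges cardsE (card_uniqP us) in h3.
have hnt : None \notin t by move: hn; rewrite eP cover_cycle_edges inE.
by rewrite eP; apply: triangle_sorted.
Qed.

Lemma tip_polygon_rev (t : seq nat) : uniq t -> {in t, forall x, x <= l.+1} ->
  tip_polygon l (rev t) = tip_polygon l t.
Proof.
move=> ut ht; rewrite /tip_polygon map_rev.
have us : uniq (None :: map lb t).
  by rewrite /= map_lb_uniq // ut andbT; apply/negP => /mapP[].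
have us' : uniq (None :: rev (map lb t)) by move: us; rewrite /= mem_rev rev_uniq.
by rewrite -[RHS](cycle_edges_rev us) rev_cons -(cycle_edges_rot 1 us') rot1_cons.
Qed.

Lemma tip_cycle P : simple_polygon a P -> None \in cover P ->
  exists u v m, let t := u :: rcons m v in
    [/\ P = tip_polygon l t, u < v, uniq t & {in t, forall x, x <= l.+1}].
Proof.
move=> sp hn; have [t [us hs eP]] := simple_cycle sp.
have {}hn : None \in t by move: hn; rewrite eP cover_cycle_edges inE.
have [i t' hr] := rot_to hn.
have us' : uniq (None :: t') by rewrite -hr rot_uniq.
have eP' : P = cycle_edges (None :: t') by rewrite eP -(cycle_edges_rot i us) hr.
pose f (x : label) := if x is Some i then val i else 0.
have fK : {in t', cancel f lb}.
  by case=> [j|] hj; [rewrite /= lbK|move: us'; rewrite /= hj].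
have fb : {in map f t', forall x, x <= l.+1}.
  by move=> x /mapP[[j|] _ ->] //=; rewrite -ltnS.
have et : t' = map lb (map f t').
  by rewrite -map_comp -[LHS]map_id; apply/eq_in_map => x /fK /= ->.
have ut : uniq (map f t') by rewrite -(map_lb_uniq fb) -et; case/andP: us'.
have st : 1 < size (map f t') by rewrite size_map -ltnS -[(size t').+1]/(size (None :: t')) -hr size_rot.
move: eP'; rewrite et -/(tip_polygon l _) => eP'.
move: (map f t') fb ut st eP' => r fb ur sr eP'.
case: r fb ur sr eP' => // u r; case/lastP: r => // m v fb ur _ eP'.
have uv : u != v by apply: contraTneq ur => ->; rewrite /= mem_rcons mem_head.
have [lt|gt|e] := ltngtP u v; last by rewrite e eqxx in uv.
  by exists u, v, m; split.
exists v, u, (rev m); rewrite /= -rev_cons -rev_rcons; split=> //.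
- by rewrite tip_polygon_rev.
- by move: ur; rewrite -rcons_cons rcons_uniq mem_rev rev_uniq.
- by move=> x; rewrite mem_rev rcons_cons; apply: fb.
Qed.

End Shape.

Lemma cycle_neighbours_mid (I : finType) (s1 s2 : seq I) w x y :
  uniq (s1 ++ [:: w, x, y & s2]) -> neighbours (cycle_edges (s1 ++ [:: w, x, y & s2])) x y w.
Proof.
move=> us; rewrite -(cycle_edges_rot (size s1).+1 us).
have er : rot (size s1).+1 (s1 ++ [:: w, x, y & s2]) = [:: x, y & s2 ++ rcons s1 w].
  rewrite -cat_rcons -(size_rcons s1 w) rot_size_cat /=; by rewrite -cat_cons.
rewrite er; have hw : last y (s2 ++ rcons s1 w) = w by rewrite last_cat last_rcons.
rewrite -[X in neighbours _ _ _ X]hw; apply: cycle_edges_neighbours.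
  by rewrite -er rot_uniq.
by case: (s2) => //; case: (s1).
Qed.

Section TipPolygon.
Variable l : nat.
Local Notation label := (option 'I_l.+2).
Local Notation lb := (chain_label l).

Lemma links_edges t i j : uniq t -> {in t, forall x, x <= l.+1} ->
  (i, j) \in links t -> [set lb i; lb j] \in tip_polygon l t.
Proof.
move=> ut ht hij; rewrite /tip_polygon cycle_edges_cons; last first.
  by rewrite /= map_lb_uniq // ut andbT; apply/negP => /mapP[].
rewrite inE; case: t ut ht hij => // x t _ _ hij.
rewrite /= inE; apply/orP; right; rewrite -cats1 /edge_list pairmap_cat mem_cat; apply/orP; left.
move: hij; rewrite /links; elim: t x => //= y t IH x; rewrite !inE => /orP[/eqP[-> ->]|/IH->].
  by rewrite eqxx.
by rewrite orbT.
Qed.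

Lemma tip_polygon_cover t : cover (tip_polygon l t) = [set x in None :: map lb t].
Proof. exact: cover_cycle_edges. Qed.

Lemma tip_uniq t : uniq t -> {in t, forall x, x <= l.+1} -> uniq (None :: map lb t).
Proof. by move=> ut ht; rewrite /= map_lb_uniq // ut andbT; apply/negP => /mapP[]. Qed.

Lemma tip_regular t : uniq t -> 1 < size t -> {in t, forall x, x <= l.+1} -> two_regular (tip_polygon l t).
Proof. by move=> ut st ht; apply: cycle_two_regular; [apply: tip_uniq|rewrite /= size_map]. Qed.

Lemma tip_neighbours u m v : uniq (u :: rcons m v) -> {in u :: rcons m v, forall x, x <= l.+1} ->
  neighbours (tip_polygon l (u :: rcons m v)) None (lb u) (lb v).
Proof.
move=> ut ht; have us := tip_uniq ut ht.
rewrite -[X in neighbours _ _ _ (chain_label l X)](last_rcons u m v) -last_map.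
by apply: cycle_edges_neighbours => //; case: (m).
Qed.

Lemma mid_neighbours t1 w x y t2 : uniq (t1 ++ [:: w, x, y & t2]) ->
  {in t1 ++ [:: w, x, y & t2], forall x, x <= l.+1} ->
  neighbours (tip_polygon l (t1 ++ [:: w, x, y & t2])) (lb x) (lb y) (lb w).
Proof.
move=> ut ht; have us := tip_uniq ut ht.
have us' : uniq ((None :: map lb t1) ++ [:: lb w, lb x, lb y & map lb t2]).
  by move: us; rewrite map_cat.
by rewrite /tip_polygon map_cat; apply: cycle_neighbours_mid us'.
Qed.

Lemma first_neighbours u y t : uniq [:: u, y & t] -> {in [:: u, y & t], forall x, x <= l.+1} ->
  neighbours (tip_polygon l [:: u, y & t]) (lb u) None (lb y).
Proof.
move=> ut ht; have us := tip_uniq ut ht; apply: neighbours_sym.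
exact: (@cycle_neighbours_mid _ [::] (map lb t) None (lb u) (lb y) us).
Qed.

Lemma last_neighbours u m v : uniq (u :: rcons m v) -> {in u :: rcons m v, forall x, x <= l.+1} ->
  neighbours (tip_polygon l (u :: rcons m v)) (lb v) None (lb (last u m)).
Proof.
move=> ut ht; rewrite -tip_polygon_rev // rev_cons rev_rcons /=.
have ur : uniq (rev (u :: rcons m v)) by rewrite rev_uniq.
have hr : {in rev (u :: rcons m v), forall x, x <= l.+1} by move=> x; rewrite mem_rev; apply: ht.
move: ur hr; rewrite rev_cons rev_rcons /=.
case/lastP: m {ut ht} => [|m y]; first exact: first_neighbours.
by rewrite rev_rcons last_rcons /=; apply: first_neighbours.
Qed.

Lemma interior_neighbours u m v x : uniq (u :: rcons m v) ->
  {in u :: rcons m v, forall x, x <= l.+1} -> x \in m ->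
  exists y w, [/\ y \in u :: rcons m v, w \in u :: rcons m v &
    neighbours (tip_polygon l (u :: rcons m v)) (lb x) (lb y) (lb w)].
Proof.
move=> ut ht hx; have [m1 [m2 em]] : exists m1 m2, m = m1 ++ x :: m2.
  by case/splitPr: hx => m1 m2; exists m1, m2.
have [t1 [w e1]] : exists t1 w, u :: m1 = rcons t1 w by case/lastP: (m1) => [|m3 w]; [exists [::], u|exists (u :: m3), w].
have [y [t2 e2]] : exists y t2, rcons m2 v = y :: t2 by case: (m2) => [|y m3]; [exists v, [::]|exists y, (rcons m3 v)].
have et : u :: rcons m v = t1 ++ [:: w, x, y & t2].
  by rewrite em rcons_cat rcons_cons e2 -cat_cons e1 cat_rcons.
exists y, w; rewrite et; split.
- by rewrite mem_cat !inE eqxx !orbT.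
- by rewrite mem_cat !inE eqxx !orbT.
- by apply: mid_neighbours; rewrite -et.
Qed.

(** Only the edges at the tip matter, by crossings_tip. *)
Lemma path_crossings u v m c : uniq (u :: rcons m v) -> {in u :: rcons m v, forall x, x <= l.+1} ->
  u < v -> crossings (tip_polygon l (u :: rcons m v)) c = (u <= c < v).
Proof.
move=> ut ht uv; have hu : u <= l.+1 by apply: ht; rewrite mem_head.
have hv : v <= l.+1 by apply: ht; rewrite inE mem_rcons mem_head orbT.
have tr : two_regular (tip_polygon l (u :: rcons m v)) by apply: tip_regular; rewrite //= size_rcons.
rewrite (crossings_tip _ tr (tip_neighbours ut ht) hu hv).
by case: (leqP u c); case: (leqP v c) => //=; lia.
Qed.

End TipPolygon.

Section TipShape.
Variables (R : realType) (l : nat).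
Local Notation label := (option 'I_l.+2).
Variables (a : label -> 'rV[R]_2) (s : R).
Hypothesis gp : general_position a.
Hypothesis s0 : (s != 0)%R.
Local Notation sgn3 := (sgn_of a s).
Local Notation lb := (chain_label l).
Hypothesis tip_pos : forall i j, i < j -> j <= l.+1 -> (0 < sgn3 None (lb i) (lb j))%R.
Hypothesis chain_neg : forall i j k, i < j -> j < k -> k <= l.+1 ->
  (sgn3 (lb i) (lb j) (lb k) < 0)%R.

Section Corners.
Variables (u v : nat) (m : seq nat).
Let t := u :: rcons m v.
Let P := tip_polygon l t.
Hypotheses (ut : uniq t) (ht : {in t, forall x, x <= l.+1}) (uv : u < v).

Let tr : two_regular P. Proof. by apply: tip_regular; rewrite //= size_rcons. Qed.
Let hu : u <= l.+1. Proof. by apply: ht; rewrite mem_head. Qed.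
Let hv : v <= l.+1. Proof. by apply: ht; rewrite inE mem_rcons mem_head orbT. Qed.

Lemma path_tip_convex : convex_vertex a P None.
Proof. exact: (convex_tip gp s0 tip_pos tr (tip_neighbours ut ht) uv hv). Qed.

(** A vertex between the two neighbours of the tip is reflex, because
    the polygon lies on its tip side. *)
Lemma path_interior_convex x : x \in m -> convex_vertex a P (lb x) <-> (x < u) || (v < x).
Proof.
move=> hx; have [y [w [hy hw nb]]] := interior_neighbours ut ht hx.
have [xu xv] : x != u /\ x != v.
  move: ut; rewrite /= mem_rcons inE negb_or rcons_uniq => /and3P[/andP[_ um] vm _].
  by split; [apply: contraNneq um => <-|apply: contraNneq vm => <-].
have hxl : x <= l.+1 by apply: ht; rewrite inE mem_rcons inE hx !orbT.
apply: (iff_trans (convex_chain gp s0 tip_pos chain_neg tr nb hxl (ht hy) (ht hw))).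
rewrite (path_crossings _ ut ht uv) (_ : ~~ (u <= x < v) = (x < u) || (v < x)) //; lia.
Qed.

Lemma path_first_convex : convex_vertex a P (lb u) <-> u < head v m.
Proof.
have [y [t' et]] : exists y t', rcons m v = y :: t' by case: (m) => [|y m3]; [exists v, [::]|exists y, (rcons m3 v)].
have eh : head v m = y by move: et; case: (m) => [|y' m'] /= [].
have ut' := ut; have ht' := ht; rewrite /t et in ut' ht'.
have nb := first_neighbours ut' ht'; rewrite -et -/t -/P in nb.
have hy : y <= l.+1 by apply: ht'; rewrite !inE eqxx orbT.
rewrite eh; have [lt|gt|e] := ltngtP u y.
- by apply: (iff_trans (convex_tip_right gp s0 tip_pos chain_neg tr nb lt hy)); rewrite (path_crossings _ ut ht uv) leqnn uv.
- apply: (iff_trans (convex_tip_left gp s0 tip_pos chain_neg tr nb gt hu)).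
  by rewrite (path_crossings _ ut ht uv) (_ : u <= u.-1 = false) //; lia.
- by move: ut'; rewrite e /= inE eqxx.
Qed.

Lemma path_last_convex : convex_vertex a P (lb v) <-> last u m < v.
Proof.
have nb := last_neighbours ut ht; rewrite -/t -/P in nb.
have hl : last u m \in u :: m by apply: mem_last.
have hz : last u m <= l.+1.
  by apply: ht; move: hl; rewrite !inE mem_rcons inE => /orP[->|->]; rewrite ?orbT.
have [lt|gt|e] := ltngtP (last u m) v.
- apply: (iff_trans (convex_tip_left gp s0 tip_pos chain_neg tr nb lt hv)).
  by rewrite (path_crossings _ ut ht uv) (_ : u <= v.-1 < v = true) //; lia.
- by apply: (iff_trans (convex_tip_right gp s0 tip_pos chain_neg tr nb gt hz)); rewrite (path_crossings _ ut ht uv) ltnn andbF.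
- by move: ut; rewrite /t -rcons_cons rcons_uniq -e hl.
Qed.

End Corners.
End TipShape.

(** Vertices outside the interval from u to v are corners, and
    so are u and v when the path leaves them towards each other.  Apart from
    the tip there is room for two corners only, and there is one at or beyond
    each of u and v; hence at most one vertex lies to the left of u, the one
    that follows u, and likewise on the right.  The part between is sorted by
    noncrossing_sorted. *)
Lemma gap_path_of_corners (n u v : nat) (m : seq nat) (cvx : nat -> Prop) :
  let t := u :: rcons m v in
  uniq t -> u < v -> u <= n -> v <= n -> {in m, forall x, x <= n} ->
  (forall c, u < c < v -> c \in m) ->
  (forall i j i' j', (i, j) \in links t -> (i', j') \in links t ->
     i < i' -> i' < j -> j < j' -> False) ->
  (forall x y z, cvx x -> cvx y -> cvx z -> x <= n -> y <= n -> z <= n ->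
     [&& x != y, x != z & y != z] -> False) ->
  (forall x, x \in m -> (x < u) || (v < x) -> cvx x) ->
  (u < head v m -> cvx u) -> (last u m < v -> cvx v) ->
  exists k k', [/\ forall x, k = Some x -> x < u, forall x, k' = Some x -> v < x <= n &
    t = gap_path u v k k'].
Proof.
move=> t ut uv hu hv hm cmid hnc no4 cin cfst clst.
have um : u \notin m by move: ut; rewrite /= mem_rcons inE negb_or => /andP[/andP[]].
have vm : v \notin m by move: ut; rewrite /= rcons_uniq => /and3P[].
have mu : uniq m by move: ut; rewrite /= rcons_uniq => /and3P[].
have hy : head v m = v /\ m = [::] \/ head v m \in m.
  by case: (m) => [|y m']; [left|right; rewrite mem_head].
have hz : last u m = u /\ m = [::] \/ last u m \in m.
  by case: (m) => [|z m']; [left|right; apply: mem_last].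
have ltm x : x \in m -> x != u /\ x != v.
  by move=> hx; split; [apply: contraNneq um => <-|apply: contraNneq vm => <-].
(* a corner at or beyond each end *)
have [r [hr hr' cr]] : exists r, [/\ v <= r, r <= n & cvx r].
  case: (ltnP (last u m) v) => c; first by exists v; split=> //; apply: clst.
  case: hz => [[e _]|h]; first by lia.
  exists (last u m); split; [exact: c|exact: hm|apply: cin => //; have [_ e] := ltm _ h; lia].
have [q [hq cq]] : exists q, q <= u /\ cvx q.
  case: (ltnP u (head v m)) => c; first by exists u; split=> //; apply: cfst.
  case: hy => [[e _]|h]; first by lia.
  exists (head v m); split; [exact: c|apply: cin => //; have [e _] := ltm _ h; lia].
have hL : (forall x, x \in m -> u < x) \/
    [/\ head v m \in m, head v m < u & forall x, x \in m -> x < u -> x = head v m].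
  case: (ltnP u (head v m)) => c.
    left=> x hx; rewrite ltnNge; apply/negP => xu; have [e e'] := ltm _ hx.
    apply: (no4 x u r) => //; [apply: cin => //; lia|exact: cfst|exact: hm|lia].
  right; case: hy => [[e _]|h]; first by lia.
  have [e _] := ltm _ h; split=> //; first by lia.
  move=> x hx xu; apply/eqP/negP => /negP ne.
  apply: (no4 x (head v m) r) => //; try (apply: cin => //; lia); try exact: hm; lia.
have hR : (forall x, x \in m -> x < v) \/
    [/\ last u m \in m, v < last u m & forall x, x \in m -> v < x -> x = last u m].
  case: (ltnP (last u m) v) => c.
    left=> x hx; rewrite ltnNge; apply/negP => xv; have [e e'] := ltm _ hx.
    apply: (no4 x v q) => //; [apply: cin => //; lia|exact: clst|exact: hm|lia|lia].
  right; case: hz => [[e _]|h]; first by lia.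
  have [_ e] := ltm _ h; split=> //; first by lia.
  move=> x hx xv; apply/eqP/negP => /negP ne.
  apply: (no4 x (last u m) q) => //; try (apply: cin => //; lia); try exact: hm; lia.
have core L m1 Rr t1 t2 : t = t1 ++ (L :: rcons m1 Rr) ++ t2 -> L <= u -> v <= Rr ->
    (forall x, (x \in m1) = (u < x < v)) -> m1 = iota u.+1 (v - u).-1.
  move=> et hLu hRv hm1; apply: sorted_iota => //.
  have up : uniq (L :: rcons m1 Rr) by move: ut; rewrite et !cat_uniq => /and3P[_ _ /and3P[]].
  have: path ltn L (rcons m1 Rr).
    apply: noncrossing_sorted => //.
    - by move=> x; rewrite mem_rcons inE hm1 => /orP[/eqP->|]; lia.
    - by move=> x; rewrite last_rcons mem_rcons inE hm1 => /orP[/eqP->|]; lia.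
    - move=> i j i' j' e1 e2; apply: hnc; rewrite et; apply: links_suffix; exact: links_prefix.
  by rewrite rcons_path => /andP[hp _]; apply: path_sorted hp.
case: hL => [hL|[yin yu hL]]; case: hR => [hR|[zin zv hR]].
- exists None, None; split=> //.
  rewrite /gap_path /= /t; congr (_ :: _).
  rewrite -cats1 (core u m v [::] [::]) ?cats0 // => x; apply/idP/idP => [h|]; last exact: cmid.
  by rewrite hL ?hR.
- case/lastP: m @t ut um vm mu hm cmid hnc cin cfst clst hy hz ltm hL zin zv hR core => // m z.
  rewrite last_rcons => t ut um vm mu hm cmid hnc cin cfst clst hy hz ltm hL zin zv hR core.
  exists None, (Some z); split=> //; first by move=> x [<-]; rewrite zv hm.
  rewrite /gap_path /= /t; congr (_ :: _).
  rewrite (core u m z [::] [:: v]) ?(ltnW zv) //; first by rewrite -!cats1 -!catA.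
    by rewrite /t -(cats1 (rcons m z)).
  move=> x; apply/idP/idP => [h|].
    have h' : x \in rcons m z by rewrite mem_rcons inE h orbT.
    rewrite hL //=; rewrite ltnNge; apply/negP => xv; have [_ e] := ltm _ h'.
    move: mu; rewrite rcons_uniq -(hR x h') ?h //; lia.
  move=> hx; have := cmid x hx; rewrite mem_rcons inE => /orP[/eqP ex|//]; lia.
- case: m @t ut um vm mu hm cmid hnc cin cfst clst hy hz ltm hL yin yu hR core => // y m.
  rewrite [head _ _]/= => t ut um vm mu hm cmid hnc cin cfst clst hy hz ltm hL yin yu hR core.
  exists (Some y), None; split=> //; first by move=> x [<-].
  rewrite /gap_path /t /=; congr [:: _, _ & _].
  rewrite -cats1 (core y m v [:: u] [::]) ?(ltnW yu) ?cats0 //.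
  move=> x; apply/idP/idP => [h|].
    have h' : x \in y :: m by rewrite inE h orbT.
    rewrite hR // andbT ltnNge; apply/negP => xv; have [e _] := ltm _ h'.
    move: mu; rewrite /= -(hL x h') ?h //; lia.
  move=> hx; have := cmid x hx; rewrite inE => /orP[/eqP ex|//]; lia.
case: m @t ut um vm mu hm cmid hnc cin cfst clst hy hz ltm hL yin yu zin zv hR core => // y m.
rewrite [head _ _]/=; case/lastP: m => [|m z].
  by move=> t ut um vm mu hm cmid hnc cin cfst clst hy hz ltm hL yin yu zin zv; rewrite /= in zv; lia.
rewrite [last _ _]/= last_rcons.
move=> t ut um vm mu hm cmid hnc cin cfst clst hy hz ltm hL yin yu zin zv hR core.
exists (Some y), (Some z); split=> //; [by move=> x [<-]|by move=> x [<-]; rewrite zv hm|].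
rewrite /gap_path /t /=; congr [:: _, _ & _].
rewrite (core y m z [:: u] [:: v]) ?(ltnW yu) ?(ltnW zv) //; first by rewrite -!cats1 -!catA.
  by rewrite /t /= -(cats1 (rcons m z)).
move=> x; apply/idP/idP => [h|].
  have h' : x \in y :: rcons m z by rewrite inE mem_rcons inE h !orbT.
  have [e e'] := ltm _ h'; apply/andP; split; rewrite ltnNge; apply/negP => c.
    move: mu; rewrite /= -(hL x h') ?mem_rcons ?inE ?h ?orbT //; lia.
  move: mu; rewrite /= rcons_uniq -(hR x h') ?h ?andbF //; lia.
move=> hx; have := cmid x hx; rewrite inE mem_rcons inE => /or3P[/eqP ex|/eqP ex|//]; lia.
Qed.

Section TipShape.
Variables (R : realType) (l : nat).
Local Notation label := (option 'I_l.+2).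
Variables (a : label -> 'rV[R]_2) (s : R).
Hypothesis gp : general_position a.
Hypothesis s0 : (s != 0)%R.
Local Notation sgn3 := (sgn_of a s).
Local Notation lb := (chain_label l).
Hypothesis tip_pos : forall i j, i < j -> j <= l.+1 -> (0 < sgn3 None (lb i) (lb j))%R.
Hypothesis chain_neg : forall i j k, i < j -> j < k -> k <= l.+1 ->
  (sgn3 (lb i) (lb j) (lb k) < 0)%R.
Implicit Types P : {set {set label}}.

Lemma tip_shape P : pseudo_triangle a P -> None \in cover P ->
  (forall u v c, neighbours P None (lb u) (lb v) -> u < c < v -> v <= l.+1 -> lb c \in cover P) ->
  exists u v k k', gap_ok l u v k k' /\ P = tip_polygon l (gap_path u v k k').
Proof.
move=> [sp h3] hn hempty; have [u [v [m]]] := tip_cycle sp hn.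
set t := u :: rcons m v => -[eP uv ut ht].
have hu : u <= l.+1 by apply: ht; rewrite mem_head.
have hv : v <= l.+1 by apply: ht; rewrite inE mem_rcons mem_head orbT.
have hm : {in m, forall x, x <= l.+1} by move=> x hx; apply: ht; rewrite inE mem_rcons inE hx !orbT.
have nb := tip_neighbours ut ht.
have cmid x : u < x < v -> x \in m.
  move=> hx; rewrite eP in hempty.
  have := hempty u v x nb hx hv; rewrite tip_polygon_cover inE in_cons => /orP[/eqP //|].
  rewrite mem_map_lb //; last by lia.
  by rewrite /t inE mem_rcons inE; case/or3P => [/eqP|/eqP|] //; lia.
(* no four convex corners *)
have no4 x y z : convex_vertex a P (lb x) -> convex_vertex a P (lb y) -> convex_vertex a P (lb z) ->
    x <= l.+1 -> y <= l.+1 -> z <= l.+1 -> [&& x != y, x != z & y != z] -> False.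
  move=> cx cy cz hx hy hz /and3P[xy xz yz].
  (* with x, y and z this would be a fourth corner *)
  have cn : convex_vertex a P None by rewrite eP; apply: (path_tip_convex gp s0 tip_pos).
  have ul : uniq [:: None; lb x; lb y; lb z] by rewrite /= !inE !lb_eq // negb_or xy xz yz.
  have : #|[:: None; lb x; lb y; lb z]| <= #|[set w : label | `[< convex_vertex a P w >]]|.
    by apply: subset_leq_card; apply/subsetP => w; rewrite !inE => /or4P[]/eqP->; apply/asboolP.
  by rewrite h3 (card_uniqP ul).
have cin x : x \in m -> (x < u) || (v < x) -> convex_vertex a P (lb x).
  by move=> hx hx'; rewrite eP; apply/(path_interior_convex gp s0 tip_pos chain_neg ut ht uv hx).
have cfst : u < head v m -> convex_vertex a P (lb u).
  by rewrite eP => ?; apply/(path_first_convex gp s0 tip_pos chain_neg ut ht uv).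
have clst : last u m < v -> convex_vertex a P (lb v).
  by rewrite eP => ?; apply/(path_last_convex gp s0 tip_pos chain_neg ut ht uv).
have hnc i j i' j' : (i, j) \in links t -> (i', j') \in links t ->
    i < i' -> i' < j -> j < j' -> False.
  move=> e1 e2 c1 c2 c3; have j'l : j' <= l.+1.
    apply: ht; move: e2; rewrite /links /t.
    elim: (rcons m v) (u) => //= b t0 IH b'; rewrite inE => /orP[/eqP[_ ->]|/IH h].
      by rewrite !inE eqxx orbT.
    by rewrite inE h orbT.
  by apply: (simple_noncrossing s0 chain_neg sp _ _ c1 c2 c3 j'l);
    rewrite eP; apply: links_edges.
have [k [k' [h1 h2 et]]] := gap_path_of_corners ut uv hu hv hm cmid hnc no4 cin cfst clst.
by exists u, v, k, k'; rewrite eP -et.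
Qed.

End TipShape.

(** * Polygons at the tip and fans of chords *)

Section Fans.
Variable l : nat.
Local Notation label := (option 'I_l.+2).
Local Notation lb := (chain_label l).
Implicit Types P : {set {set label}}.

Lemma parity_pred1 P e : parity P (pred1 e) = (e \in P).
Proof.
rewrite /parity; case: (boolP (e \in P)) => he; last first.
  by rewrite big1 // => f hf /=; apply: contraNF he => /eqP <-.
rewrite (bigD1 e) //= eqxx big1 // => f /andP[_ /negPf] //.
Qed.

Lemma eq_under P (B B' : nat -> nat -> bool) : two_regular P ->
  (forall i j, i < j -> j <= l.+1 -> B i j = B' i j) -> parity P (under B) = parity P (under B').
Proof.
move=> tr h; apply: eq_parity => e he.
have [[j hj ->]|[i [j [ij hj ->]]]] := edge_case tr he; first by rewrite !under_tip.
by rewrite !under_chain // h.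
Qed.

Lemma fan_sector P v : two_regular P -> parity P (under (fan v v.+1)) = crossings P v.
Proof. by move=> tr; apply: eq_under => // i j ij hj; rewrite /fan /sector; lia. Qed.

(** Passing the direction of b changes the predicate on the edge (v, b)
    only. *)
Lemma fan_step P v b : two_regular P -> v < b -> b <= l.+1 ->
  parity P (under (fan v b)) = parity P (under (fan v b.+1)) (+) ([set lb v; lb b] \in P).
Proof.
move=> tr vb hb; rewrite -parity_pred1 -parityD; apply: eq_parity => e he.
have [[j hj ->]|[i [j [ij hj ->]]]] := edge_case tr he.
  rewrite !under_tip /=; symmetry; apply/eqP => /setP/(_ None).
  by rewrite !inE eqxx.
rewrite !under_chain //= /fan.
have -> : ([set lb i; lb j] == [set lb v; lb b]) = (i == v) && (j == b).
  apply/eqP/andP => [e1|[/eqP-> /eqP->] //].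
  move/setP: e1 => e1; have := e1 (lb i); have := e1 (lb j).
  by rewrite !inE !eqxx ?orbT !lb_eq; lia.
lia.
Qed.

(** No edge at v is passed when turning from the tip towards b. *)
Lemma fan_empty P v b : two_regular P -> v < b -> b <= l.+1 ->
  (forall x, v < x < b -> lb x \notin cover P) -> parity P (under (fan v b)) = crossings P v.
Proof.
move=> tr; elim: b => // b IH; rewrite ltnS leq_eqVlt => /orP[/eqP<- _ _|vb hb hx].
  exact: fan_sector.
rewrite -IH //; [|lia|by move=> x hx'; apply: hx; lia].
rewrite [RHS]fan_step //; last by lia.
suff -> : [set lb v; lb b] \in P = false by rewrite addbF.
apply: contraNF (hx b _) => [h|]; last by lia.
by apply/bigcupP; exists [set lb v; lb b]; rewrite // !inE eqxx orbT.
Qed.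

Lemma tip_polygon_edge t i j : uniq t -> {in t, forall x, x <= l.+1} -> i <= l.+1 -> j <= l.+1 ->
  [set lb i; lb j] \in tip_polygon l t -> ((i, j) \in links t) || ((j, i) \in links t).
Proof.
move=> ut ht hi hj; rewrite /tip_polygon cycle_edges_cons; last exact: tip_uniq.
rewrite inE; case: t ut ht => [|x t] ut ht.
  by rewrite /= inE => /eqP/setP/(_ None); rewrite !inE eqxx.
have noN (A : {set label}) : None \in A -> ([set lb i; lb j] == A) = false.
  by move=> h; apply/negP => /eqP e; move: h; rewrite -e !inE.
rewrite /edge_list /= -cats1 pairmap_cat /= inE mem_cat mem_seq1 !noN ?inE ?eqxx ?orbT // orbF /=.
rewrite /links; elim: t x ut ht => //= y t IH x ut ht; rewrite !inE => /orP[/eqP e1|h].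
  have hx : x <= l.+1 by apply: ht; rewrite !inE eqxx.
  have hy : y <= l.+1 by apply: ht; rewrite !inE eqxx orbT.
  have xy : x != y by move: ut => /=; rewrite inE negb_or => /andP[/andP[]].
  move/setP: e1 => e1; have := e1 (lb i); have := e1 (lb j); have := e1 (lb x); have := e1 (lb y).
  by rewrite !inE !eqxx ?orbT !lb_eq // !xpair_eqE; lia.
have := IH y _ _ h; case/(_ _ _)/orP => [||->|->]; rewrite ?orbT //.
  by case/andP: ut.
by move=> z hz; apply: ht; rewrite inE hz orbT.
Qed.

(** The left end of the link of a gap path that spans the step from c to c+1:
    the step at u starts from the extra corner if there is one.  With c+1 and v
    it gives the right end. *)
Definition core_left (u : nat) (k : option nat) c := if c == u then odflt u k else c.

Lemma gap_path_links u v k k' i j : u < v -> (i, j) \in links (gap_path u v k k') ->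
  [\/ i = u /\ k = Some j, k' = Some i /\ j = v |
      exists c, [/\ u <= c < v, i = core_left u k c & j = core_left v k' c.+1]].
Proof.
move=> uv; pose L := odflt u k; pose r := odflt v k'.
have core i0 j0 : (i0, j0) \in links (L :: rcons (iota u.+1 (v - u).-1) r) ->
   exists c, [/\ u <= c < v, i0 = core_left u k c & j0 = core_left v k' c.+1].
  have claim : forall n w, u <= w -> w + n.+1 = v ->
      (i0, j0) \in links (core_left u k w :: rcons (iota w.+1 n) r) ->
      exists c, [/\ u <= c < v, i0 = core_left u k c & j0 = core_left v k' c.+1].
    elim=> [|n IH] w uw wn.
      rewrite /links /= inE => /eqP[-> ->]; exists w; split=> //; first by lia.
      by rewrite /core_left (_ : w.+1 == v) //; lia.
    rewrite /links /= inE => /orP[/eqP[-> ->]|h].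
      by exists w; split=> //; [lia|rewrite /core_left (_ : w.+1 == v = false) //; lia].
    by apply: (IH w.+1); [lia|lia|rewrite /core_left (_ : w.+1 == u = false) //; lia].
  by have := claim (v - u).-1 u (leqnn u) ltac:(lia); rewrite /core_left eqxx.
rewrite /gap_path; case: k @L core => [x|] L core; case: k' @r core => [y|] r core /=.
- rewrite (_ : [:: u, x & iota u.+1 (v - u).-1 ++ [:: y; v]] = [:: u] ++ (x :: rcons (iota u.+1 (v - u).-1) y) ++ [:: v]).
    rewrite links_cat mem_cat inE /= => /orP[/eqP[-> ->]|]; first by apply: Or31.
    rewrite -cat_cons -rcons_cons cat_rcons links_cat mem_cat /= inE => /orP[|/eqP[-> ->]].
      by move=> h; apply: Or33; apply: core.
    by apply: Or32.
  by rewrite /= -cats1 -catA.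
- rewrite (_ : [:: u, x & iota u.+1 (v - u).-1 ++ [:: v]] = [:: u] ++ (x :: rcons (iota u.+1 (v - u).-1) v)).
    rewrite links_cat mem_cat inE /= => /orP[/eqP[-> ->]|]; first by apply: Or31.
    by move=> h; apply: Or33; apply: core.
  by rewrite /= -cats1.
- rewrite (_ : u :: iota u.+1 (v - u).-1 ++ [:: y; v] = (u :: rcons (iota u.+1 (v - u).-1) y) ++ [:: v]).
    rewrite -rcons_cons cat_rcons links_cat mem_cat /= inE => /orP[|/eqP[-> ->]].
      by move=> h; apply: Or33; apply: core.
    by apply: Or32.
  by rewrite /= -cats1 -catA.
- by rewrite cats1 => h; apply: Or33; apply: core.
Qed.

Lemma mem_gap_path u v k k' x : u < v ->
  (x \in gap_path u v k k') = [|| u <= x <= v, k == Some x | k' == Some x].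
Proof.
move=> uv; have sE y : (Some y == Some x) = (x == y) by rewrite eq_sym.
rewrite /gap_path inE !mem_cat mem_iota mem_seq1.
have nE : (None == Some x) = false by [].
by case: k => [y|]; case: k' => [z|] /=; rewrite ?sE ?nE ?mem_seq1 ?in_nil; lia.
Qed.

Lemma gap_path_ok u v k k' : gap_ok l u v k k' ->
  uniq (gap_path u v k k') /\ {in gap_path u v k k', forall x, x <= l.+1}.
Proof.
move=> [uv hv hk hk']; split; last first.
  move=> x; rewrite mem_gap_path // => /or3P[|/eqP e|/eqP e]; first by lia.
    by have := hk _ e; lia.
  by have := hk' _ e; lia.
rewrite /gap_path; case: k hk => [y|] hk; case: k' hk' => [z|] hk' /=;
  try (have := hk _ erefl); try (have := hk' _ erefl);
  by rewrite ?cat_uniq /= ?iota_uniq ?inE ?mem_cat ?inE ?mem_iota ?negb_or ?orbF ?andbT; lia.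
Qed.

Lemma gap_path_shape u v k k' : u < v -> exists m, gap_path u v k k' = u :: rcons m v.
Proof.
by move=> uv; exists (seq_of_opt k ++ iota u.+1 (v - u).-1 ++ seq_of_opt k'); rewrite /gap_path -cats1 -!catA.
Qed.

Definition gap_polygon u v k k' : {set {set label}} := tip_polygon l (gap_path u v k k').

Lemma gap_neighbours u v k k' : gap_ok l u v k k' -> neighbours (gap_polygon u v k k') None (lb u) (lb v).
Proof.
move=> h; have [ut ht] := gap_path_ok h; have [uv _ _ _] := h.
rewrite /gap_polygon; have [m e] := gap_path_shape k k' uv; rewrite e in ut ht *.
exact: tip_neighbours.
Qed.

Lemma gap_crossings u v k k' c : gap_ok l u v k k' -> crossings (gap_polygon u v k k') c = (u <= c < v).
Proof.
move=> h; have [ut ht] := gap_path_ok h; have [uv _ _ _] := h.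
rewrite /gap_polygon; have [m e] := gap_path_shape k k' uv; rewrite e in ut ht *.
exact: path_crossings.
Qed.

Lemma gap_cover u v k k' x : gap_ok l u v k k' -> x <= l.+1 ->
  (lb x \in cover (gap_polygon u v k k')) = [|| u <= x <= v, k == Some x | k' == Some x].
Proof.
move=> h hx; have [ut ht] := gap_path_ok h; have [uv _ _ _] := h.
by rewrite tip_polygon_cover inE in_cons mem_map_lb // mem_gap_path.
Qed.

Lemma gap_link u v k k' i j : gap_ok l u v k k' -> (i, j) \in links (gap_path u v k k') ->
  [set lb i; lb j] \in gap_polygon u v k k'.
Proof. by move=> h; have [ut ht] := gap_path_ok h; apply: links_edges. Qed.

Lemma gap_edge u v k k' i j : gap_ok l u v k k' -> i < j -> j <= l.+1 ->
  [set lb i; lb j] \in gap_polygon u v k k' ->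
  [\/ k = Some i /\ j = u, i = v /\ k' = Some j |
      exists c, [/\ u <= c < v, i = core_left u k c & j = core_left v k' c.+1]].
Proof.
move=> h ij hj he; have [ut ht] := gap_path_ok h; have [uv hv hk hk'] := h.
have cl c : u <= c < v -> core_left u k c < core_left v k' c.+1.
  rewrite /core_left => hc; case: eqP => e1; case: eqP => e2; case: k hk {h he ut ht} => [y|] hk; case: k' hk' => [z|] hk' //=;
  try (have := hk _ erefl); try (have := hk' _ erefl); lia.
have /orP[/(gap_path_links uv)[[e1 e2]|[e1 e2]|[c hc]]|/(gap_path_links uv)[[e1 e2]|[e1 e2]|[c [h1 e1 e2]]]] :=
  tip_polygon_edge ut ht (leq_trans (ltnW ij) hj) hj he.
- by have := hk _ e2; lia.
- by have := hk' _ e1; lia.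
- by apply: Or33; exists c.
- by apply: Or31.
- by apply: Or32.
- by have := cl _ h1; lia.
Qed.

End Fans.

(** * Tiles of a pseudo-triangulation *)

Lemma straddle_change u w c : 0 < c -> u != w -> (c == u) || (c == w) ->
  (u <= c) (+) (w <= c) = false -> (u <= c.-1) (+) (w <= c.-1) = false -> False.
Proof. by case: (leqP u c); case: (leqP w c); case: (leqP u c.-1); case: (leqP w c.-1) => //=; lia. Qed.

Section Hull.
Variables (R : realType) (l : nat).
Local Notation label := (option 'I_l.+2).
Variables (a : label -> 'rV[R]_2) (s : R).
Local Notation lb := (chain_label l).
Hypothesis s0 : (s != 0)%R.
Hypothesis tip_pos : forall i j, i < j -> j <= l.+1 -> (0 < sgn_of a s None (lb i) (lb j))%R.

Lemma barycentric (p u v q : 'rV[R]_2) : orient p u v != 0%R ->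
  q = (orient u v q / orient p u v *: p + orient v p q / orient p u v *: u +
       orient p u q / orient p u v *: v)%R.
Proof.
move=> h.
have ex : (orient p u v * xco q = orient u v q * xco p + orient v p q * xco u + orient p u q * xco v)%R.
  by rewrite /orient; ring.
have ey : (orient p u v * yco q = orient u v q * yco p + orient v p q * yco u + orient p u q * yco v)%R.
  by rewrite /orient; ring.
move: h ex ey; move: (orient p u v) (orient u v q) (orient v p q) (orient p u q) => D A B C h ex ey.
by apply: point_ext; rewrite !coE; apply: (mulfI h); rewrite ?ex ?ey; field.
Qed.

(** The three labels need not be distinct, which covers edges as well. *)
Lemma conv3 (X : {set label}) (i j k : label) (x y z : R) : i \in X -> j \in X -> k \in X ->
  (0 <= x -> 0 <= y -> 0 <= z -> x + y + z = 1 -> conv a X (x *: a i + y *: a j + z *: a k))%R.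
Proof.
move=> hi hj hk x0 y0 z0 e.
pose w (m : label) : R := ((m == i)%:R * x + (m == j)%:R * y + (m == k)%:R * z)%R.
have pick (m0 : label) (c : R) (V : lmodType R) (f : label -> V) :
    (\sum_m ((m == m0)%:R * c) *: f m = c *: f m0)%R.
  rewrite (bigD1 m0) //= eqxx mul1r big1 ?addr0 // => m /negPf->.
  by rewrite mul0r scale0r.
have pick1 (m0 : label) (c : R) : (\sum_m ((m == m0)%:R * c) = c)%R.
  by rewrite (bigD1 m0) //= eqxx mul1r big1 ?addr0 // => m /negPf->; rewrite mul0r.
exists w; split.
- by move=> m; rewrite /w !addr_ge0 // mulr_ge0 // ler0n.
- move=> m hm; rewrite /w.
  have ne n : n \in X -> (m == n) = false by move=> hn; apply: contraNF hm => /eqP->.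
  by rewrite !ne // !mul0r !addr0.
- by rewrite /w !big_split /= !pick1.
- under eq_bigr do rewrite /w !scalerDl.
  by rewrite !big_split /= !pick.
Qed.

Lemma hull_conv q : (0 <= side_of a s None (lb 0) q)%R -> (0 <= side_of a s (lb l.+1) None q)%R ->
  (0 <= side_of a s (lb 0) (lb l.+1) q)%R -> conv a [set: label] q.
Proof.
move=> h1 h2 h3; have hS := tip_pos (ltn0Sn l) (leqnn l.+1).
have oz : orient (a None) (a (lb 0)) (a (lb l.+1)) != 0%R.
  by apply: contraTneq hS => e; rewrite /sgn_of /side_of e mulr0 ltxx.
have scale u v : (0 <= side_of a s u v q)%R ->
    (0 <= orient (a u) (a v) q / orient (a None) (a (lb 0)) (a (lb l.+1)))%R.
  move=> h; rewrite -(mul1r (_ / _)%R) -(divff s0) mulf_div; exact: divr_ge0 h (ltW hS).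
rewrite (barycentric q oz); apply: conv3; rewrite ?in_setT ?scale //.
rewrite -!mulrDl; apply: (mulIf oz); rewrite mul1r mulfVK // /orient; ring.
Qed.

Lemma side_average i j (w : label -> R) : (\sum_k w k = 1)%R ->
  side_of a s i j (\sum_k w k *: a k)%R = (\sum_k w k * sgn_of a s i j k)%R.
Proof.
move=> w1; rewrite /sgn_of /side_of /orient.
have cx (f : 'rV[R]_2 -> R) (fD : forall x y, f (x + y)%R = (f x + f y)%R) (fZ : forall c x, f (c *: x)%R = (c * f x)%R) :
    f (\sum_k w k *: a k)%R = (\sum_k w k * f (a k))%R.
  have f0 : f 0%R = 0%R by rewrite -(scale0r (0%R : 'rV[R]_2)) fZ mul0r.
  by rewrite (big_morph f fD f0); apply: eq_bigr => k _; rewrite fZ.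
rewrite (cx (@xco R) (@xcoD R) (@xcoZ R)) (cx (@yco R) (@ycoD R) (@ycoZ R)).
set A := (xco (a j) - xco (a i))%R; set C := (yco (a j) - yco (a i))%R.
transitivity (\sum_k (w k * (s * (A * yco (a k) - C * xco (a k))) + w k * (s * (C * xco (a i) - A * yco (a i)))))%R.
  rewrite big_split /= -!big_distrl /= w1 mul1r.
  have -> : (\sum_k (w k * (s * (A * yco (a k) - C * xco (a k)))) =
    s * (A * (\sum_k w k * yco (a k)) - C * (\sum_k w k * xco (a k))))%R.
    by rewrite !big_distrr /= -sumrB big_distrr /=; apply: eq_bigr => k _; ring.
  ring.
by apply: eq_bigr => k _; ring.
Qed.

Lemma conv_side i j q : conv a [set: label] q -> (forall k, 0 <= sgn_of a s i j k)%R -> (0 <= side_of a s i j q)%R.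
Proof.
move=> [w [w0 _ w1 ->]] h; rewrite side_average //.
by apply: sumr_ge0 => k _; rewrite mulr_ge0.
Qed.

(** The side of q is an average of nonnegative terms, so the weights vanish
    wherever the term is positive. *)
Lemma conv_support i j q : conv a [set: label] q -> (forall k, 0 <= sgn_of a s i j k)%R ->
  (forall k, k != i -> k != j -> 0 < sgn_of a s i j k)%R -> side_of a s i j q = 0%R -> conv a [set i; j] q.
Proof.
move=> [w [w0 _ w1 ->]] h h'; rewrite side_average // => e0.
have z k : (w k * sgn_of a s i j k = 0)%R.
  by apply: (psumr_eq0P _ e0) => // m _; rewrite mulr_ge0.
exists w; split=> // k; rewrite !inE negb_or => /andP[ki kj].
by have /eqP := z k; rewrite mulf_eq0 (gt_eqF (h' _ ki kj)) orbF => /eqP.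
Qed.

End Hull.

Section Triangulation.
Variables (R : realType) (l : nat).
Local Notation label := (option 'I_l.+2).
Variables (a : label -> 'rV[R]_2) (s : R).
Hypothesis gp : general_position a.
Hypothesis s0 : (s != 0)%R.
Local Notation sgn3 := (sgn_of a s).
Local Notation lb := (chain_label l).
Hypothesis tip_pos : forall i j, i < j -> j <= l.+1 -> (0 < sgn3 None (lb i) (lb j))%R.
Hypothesis chain_neg : forall i j k, i < j -> j < k -> k <= l.+1 ->
  (sgn3 (lb i) (lb j) (lb k) < 0)%R.
Implicit Types P Q : {set {set label}}.
Variable T : {set {set {set label}}}.
Hypothesis hT : pseudo_triangulation a T.

Lemma tile_regular P : P \in T -> two_regular P.
Proof. by move=> hP; have [h _ _ _] := hT; apply: (@simple_regular R l a); case: (h _ hP). Qed.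

Lemma tile_unique q P Q : generic a q -> P \in T -> Q \in T -> encloses a s P q -> encloses a s Q q -> P = Q.
Proof.
move=> g hP hQ sP sQ; have [_ _ h _] := hT; apply/eqP/negPn/negP => ne.
by apply: (h P Q q hP hQ ne); split; apply/(inside_generic s0 tip_pos (tile_regular _) g).
Qed.

Lemma tile_exists q : generic a q -> in_tip_triangle a s q 0 l.+1 -> exists2 P, P \in T & encloses a s P q.
Proof.
move=> g /and3P[h1 h2 h3]; have [_ h _ _] := hT.
have [P hP hr] := (h q).1 (hull_conv s0 tip_pos (ltW h1) (ltW h2) (ltW h3)).
exists P => //; apply/(inside_generic s0 tip_pos (tile_regular hP) g).
by case: hr => // /(generic_not_boundary s0 (tile_regular hP) g).
Qed.

Lemma encloses_eq q B P : two_regular P ->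
  (forall i j, i < j -> j <= l.+1 -> in_tip_triangle a s q i j = B i j) -> encloses a s P q = parity P (under B).
Proof. by move=> tr h; apply: eq_under. Qed.

Lemma sector_unique c P Q : c <= l -> P \in T -> Q \in T -> crossings P c -> crossings Q c -> P = Q.
Proof.
move=> hc hP hQ cP cQ; have [q [g hq]] := sector_germ gp s0 tip_pos hc.
by apply: (tile_unique g hP hQ); rewrite (encloses_eq (tile_regular _) hq).
Qed.

Lemma sector_exists c : c <= l -> exists2 P, P \in T & crossings P c.
Proof.
move=> hc; have [q [g hq]] := sector_germ gp s0 tip_pos hc.
have [|P hP sP] := tile_exists g; first by rewrite hq // /sector; lia.
by exists P => //; rewrite /crossings -(encloses_eq (tile_regular hP) hq).
Qed.

Lemma fan_unique v b P Q : v < b -> b <= l.+2 -> v <= l -> (b = l.+2 -> 0 < v) -> P \in T -> Q \in T ->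
  parity P (under (fan v b)) -> parity Q (under (fan v b)) -> P = Q.
Proof.
move=> h1 h2 h3 h4 hP hQ cP cQ; have [q [g hq]] := fan_germ gp s0 tip_pos chain_neg h1 h2 h3 h4.
by apply: (tile_unique g hP hQ); rewrite (encloses_eq (tile_regular _) hq).
Qed.

Lemma fan_exists v b : v < b -> b <= l.+1 -> exists2 P, P \in T & parity P (under (fan v b)).
Proof.
move=> h1 h2; have [||q [g hq]] := fan_germ gp s0 tip_pos chain_neg h1 (leqW h2); [lia|lia|].
have [|P hP sP] := tile_exists g; first by rewrite hq // /fan; lia.
by exists P => //; rewrite -(encloses_eq (tile_regular hP) hq).
Qed.

Lemma vertex_tile v : exists2 P, P \in T & v \in cover P.
Proof.
have [_ _ _ /setP/(_ v)] := hT; rewrite inE => /bigcupP[P hP hv]; by exists P.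
Qed.

(** The point c is a vertex of some tile Q.  If P passed over c on both
    sides without having it as a vertex, it would contain all points close to
    c, among them points of Q. *)
Lemma no_vertex_inside P c : P \in T -> 0 < c <= l -> crossings P c -> crossings P c.-1 ->
  lb c \in cover P.
Proof.
move=> hP hc cr cl; apply/negPn/negP => hn.
have [c0 hc1 hc2 hcl] : [/\ 0 < c, c <= l, c.-1 <= l & c <= l.+1] by split; lia.
have [Q hQ hcQ] := vertex_tile (lb c); have trQ := tile_regular hQ; have trP := tile_regular hP.
have PQ : P <> Q by move=> e; rewrite e hcQ in hn.
have cQ : crossings Q c = false.
  by apply/negP => h; apply: PQ; apply: (@sector_unique c).
have cQ' : crossings Q c.-1 = false.
  by apply/negP => h; apply: PQ; apply: (@sector_unique c.-1).
have [x [y nb]] := trQ.2 _ hcQ; have [_ hx hy] := neighbours_cover nb.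
have notip : [set lb c; None] \notin Q.
  apply/negP => hcn; have hN : None \in cover Q by apply/bigcupP; exists [set lb c; None]; rewrite // !inE eqxx orbT.
  have [u [w nbN]] := trQ.2 _ hN; have [uw uN wN hn'] := nbN.
  have [eu|[u' hu' eu]] := label_case u; first by rewrite eu in uN.
  have [ew|[w' hw' ew]] := label_case w; first by rewrite ew in wN.
  rewrite eu ew in nbN uw hn'; rewrite lb_eq // in uw.
  have h1 := crossings_tip c trQ nbN hu' hw'; have h2 := crossings_tip c.-1 trQ nbN hu' hw'.
  move: hcn; rewrite setUC hn' !lb_eq //.
  by move=> h3; rewrite cQ in h1; rewrite cQ' in h2; apply: (straddle_change c0 uw h3 (esym h1) (esym h2)).
have [xy xc yc hh] := nb.
have [ex|[x' hx' ex]] := label_case x; first by move: notip; rewrite hh ex eqxx.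
have [ey|[y' hy' ey]] := label_case y; first by move: notip; rewrite hh ey eqxx orbT.
have [x2 [y2 [hx2 hxy nb2]]] : exists x2 y2, [/\ y2 <= l.+1, x2 < y2 & neighbours Q (lb c) (lb x2) (lb y2)].
  rewrite ex ey in nb xy; rewrite lb_eq // in xy.
  have [lt|gt|e] := ltngtP x' y'; last by rewrite e eqxx in xy.
    by exists x', y'.
  by exists y', x'; split=> //; apply: neighbours_sym.
(* points in the wedge of Q at c are inside Q, as Q does not pass over c, and inside P *)
have [q [g hn2 hw]] := wedge_generic s gp (lb c) (lb x2) (lb y2).
apply: PQ; apply: (tile_unique g hP hQ).
  by rewrite (encloses_away s0 tip_pos chain_neg trP g hn2 hcl hn).
by rewrite (encloses_corner s0 tip_pos chain_neg trQ g hn2 hw nb2 hxy hx2 hcl) cQ.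
Qed.

(** The hypothesis of tip_shape holds because every chain point is a vertex
    of some tile. *)
Lemma tile_shape P : P \in T ->
  (exists i k j, [/\ i < k, k < j, j <= l.+1 & P = chain_triangle l (i, k, j)]) \/
  (exists u v k k', gap_ok l u v k k' /\ P = gap_polygon l u v k k').
Proof.
move=> hP; have [h _ _ _] := hT; have pt := h _ hP.
case: (boolP (None \in cover P)) => hN; last first.
  by left; exact: (chain_polygon gp s0 tip_pos chain_neg pt hN).
right; apply: (tip_shape gp s0 tip_pos chain_neg pt hN) => u v c nb huv hv.
have tr := tile_regular hP; have hu : u <= l.+1 by lia.
apply: no_vertex_inside => //; first by lia.
  by rewrite (crossings_tip _ tr nb hu hv); lia.
by rewrite (crossings_tip _ tr nb hu hv); lia.
Qed.

(** Take the tile that covers the points at x on the tip side of the chord.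
    If the chord were not one of its sides, it would also cover the points on
    the other side, hence points of a tile that has the chord as a side, and
    would be that tile.  Beyond the hull edge (0, l+1) there is nothing to
    cover. *)
Lemma chord_below x y : x < y -> y <= l.+1 -> ([set lb x; lb y] \in edges T) || ((x == 0) && (y == l.+1)) ->
  exists P, [/\ P \in T, [set lb x; lb y] \in P & parity P (under (fan x y))].
Proof.
move=> xy hy he; have xl : x <= l by lia.
have [P hP sP] := fan_exists xy hy; have tr := tile_regular hP.
case: (boolP ([set lb x; lb y] \in P)) => hin; first by exists P.
have sP' : parity P (under (fan x y.+1)) by move: sP; rewrite fan_step // (negPf hin) addbF.
have [/andP[/eqP x0 /eqP yl]|hull] := boolP ((x == 0) && (y == l.+1)).
  exfalso; move: sP'; rewrite (@eq_under _ _ _ (fun _ _ => false)) //; last first.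
    by move=> i j ij hj; rewrite /fan; lia.
  rewrite parity_away // => e he'; have [[j hj ->]|[i [j [ij hj ->]]]] := edge_case tr he'.
    by rewrite under_tip.
  by rewrite under_chain.
rewrite (negPf hull) orbF in he; case/bigcupP: he => Q hQ hin'.
have trQ := tile_regular hQ; have := fan_step trQ xy hy; rewrite hin' addbT => e.
suff PQ : P = Q by rewrite PQ hin' in hin.
case: (boolP (parity Q (under (fan x y)))) => sQ.
  apply: (@fan_unique x y) => //; first exact: leqW.
  by move=> ey; move: hy; rewrite ey ltnn.
rewrite e negbK in sQ; apply: (@fan_unique x y.+1) => //; first exact: leqW.
by move=> [ey]; move: hull; rewrite ey eqxx andbT lt0n.
Qed.

End Triangulation.

(** * Decoding a pseudo-triangulation into a dissection *)

Section Realize.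
Variable l : nat.
Local Notation label := (option 'I_l.+2).
Local Notation lb := (chain_label l).
Variable T : {set {set {set label}}}.

Definition gap_tile u v k k' : Prop := gap_ok l u v k k' /\ gap_polygon l u v k k' \in T.

(** The recorded extra corner fixes one of the two tiles at the spoke, the
    one on the side opposite to that corner. *)
Definition spoke_realized (x : spoke) : Prop :=
  match x with
  | (w, Some k, None) => exists v k', gap_tile w v (Some k) k'
  | (w, None, Some k) => exists u k', gap_tile u w k' (Some k)
  | _ => False
  end.

Definition realized (d : dissection) (a : nat) : Prop :=
  (forall t, t \in triangles d a -> chain_triangle l t \in T) /\
  (forall x, x \in spokes d a -> spoke_realized x).

(** The four ways to continue correspond to the constructors Triangle,
    OpenRight, OpenLeft and OpenMiddle. *)
Definition chord_step (x y : nat) : Prop :=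
  [\/ exists k, [/\ x < k, k < y & chain_triangle l (x, k, y) \in T],
      exists v k', gap_tile y.-1 v (Some x) k',
      exists u k, gap_tile u x.+1 k (Some y) |
      exists u, gap_tile u u.+1 (Some x) (Some y)].

Lemma edges_mem P e : P \in T -> e \in P -> e \in edges T.
Proof. by move=> hP he; apply/bigcupP; exists P. Qed.

Lemma chain_triangle_edges i k j :
  i < k -> k < j -> j <= l.+1 ->
  [/\ [set lb i; lb k] \in chain_triangle l (i, k, j), [set lb k; lb j] \in chain_triangle l (i, k, j)
    & [set lb i; lb j] \in chain_triangle l (i, k, j)].
Proof.
move=> ik kj hj; rewrite /chain_triangle /= triangle_set.
  by rewrite (setUC [set lb i] [set lb j]) !inE !eqxx !orbT.
by rewrite /= !inE !negb_or !lb_eq; lia.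
Qed.

Lemma gap_left_link u v k x : gap_ok l u v (Some x) k -> [set lb x; lb u] \in gap_polygon l u v (Some x) k.
Proof. by move=> h; rewrite setUC; apply: gap_link => //; rewrite /gap_path /links /= mem_head. Qed.

Lemma gap_right_link u v k y : gap_ok l u v k (Some y) -> [set lb v; lb y] \in gap_polygon l u v k (Some y).
Proof.
move=> h; rewrite setUC; apply: gap_link => //; rewrite /gap_path /= -!cat_cons.
have -> : (u :: seq_of_opt k) ++ iota u.+1 (v - u).-1 ++ [:: y; v] =
   ((u :: seq_of_opt k) ++ iota u.+1 (v - u).-1) ++ y :: [:: v] by rewrite catA.
by rewrite links_cat mem_cat /links /= mem_head orbT.
Qed.

Lemma gap_tip_left u v k k' : gap_ok l u v k k' -> [set None; lb u] \in gap_polygon l u v k k'.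
Proof. by move=> h; have [_ _ _ ->] := gap_neighbours h; rewrite eqxx. Qed.

Lemma gap_tip_right u v k k' : gap_ok l u v k k' -> [set None; lb v] \in gap_polygon l u v k k'.
Proof. by move=> h; have [_ _ _ ->] := gap_neighbours h; rewrite eqxx orbT. Qed.

(** Strong induction on the number of chain steps spanned by the chord. *)
Lemma realize n a : 0 < n -> a + n <= l.+1 ->
  (forall x y, x < y -> y <= l.+1 -> y != x.+1 ->
     ([set lb x; lb y] \in edges T) || ((x == 0) && (y == l.+1)) -> chord_step x y) ->
  ([set lb a; lb (a + n)] \in edges T) || ((a == 0) && (a + n == l.+1)) ->
  exists d, width d = n /\ realized d a.
Proof.
move=> n0 hn step; elim/ltn_ind: n a n0 hn => n IH a n0 hn he.
have [->|n1] := eqVneq n 1.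
  by exists Edge; split=> //; split=> //= x; rewrite in_nil.
have xy : a < a + n by lia.
have ny : a + n != a.+1 by lia.
case: (step _ _ xy hn ny he) => [[k [ak kb ht]]|[v [k' [ok ht]]]|[u [k [ok ht]]]|[u [ok ht]]].
- have [e1 e2 _] := chain_triangle_edges ak kb hn.
  have [||||d1 [w1 [t1 s1]]] := IH (k - a) _ a; try lia.
    by rewrite subnKC ?(ltnW ak) // (edges_mem ht).
  have [||||d2 [w2 [t2 s2]]] := IH (a + n - k) _ k; try lia.
    by rewrite subnKC ?(ltnW kb) // (edges_mem ht).
  exists (Triangle d1 d2); split; first by rewrite /= w1 w2; lia.
  have ek : a + width d1 = k by lia.
  split=> /= [t|x]; rewrite ?inE ?mem_cat ek.
    case/or3P => [/eqP->|/t1|/t2] //.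
    by rewrite w1 w2 (_ : a + (k - a + (a + n - k)) = a + n) //; lia.
  by case/orP => [/s1|/s2].
- have ab : a < (a + n).-1 by have [_ _ h _] := ok; apply: h.
  have [||||d1 [w1 [t1 s1]]] := IH n.-1 _ a; try lia.
    rewrite (_ : a + n.-1 = (a + n).-1); last by lia.
    by rewrite (edges_mem ht (gap_left_link ok)).
  exists (OpenRight d1); split; first by rewrite /= w1; lia.
  split=> //= x; rewrite mem_rcons inE => /orP[/eqP->|/s1] //.
  by exists v, k'; rewrite w1 (_ : a + n.-1 = (a + n).-1) //; lia.
- have [uv hv hk hk'] := ok; have ab := hk' _ erefl.
  have [||||d1 [w1 [t1 s1]]] := IH n.-1 _ a.+1; try lia.
    rewrite (_ : a.+1 + n.-1 = a + n); last by lia.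
    by rewrite (edges_mem ht (gap_right_link ok)).
  exists (OpenLeft d1); split; first by rewrite /= w1; lia.
  split=> //= x; rewrite inE => /orP[/eqP->|/s1] //.
  by exists u, k; rewrite w1 (_ : a + n.-1.+1 = a + n) //; lia.
have [uv hv hk hk'] := ok; have ab := hk _ erefl; have bb := hk' _ erefl.
have [||||d1 [w1 [t1 s1]]] := IH (u - a) _ a; try lia.
  by rewrite subnKC ?(ltnW ab) // (edges_mem ht (gap_left_link ok)).
have [||||d2 [w2 [t2 s2]]] := IH (a + n - u.+1) _ u.+1; try lia.
  by rewrite subnKC; [rewrite (edges_mem ht (gap_right_link ok))|lia].
exists (OpenMiddle d1 d2); split; first by rewrite /= w1 w2; lia.
have e1 : a + width d1 = u by lia.
have e2 : a + (width d1).+1 = u.+1 by lia.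
have e3 : a + (width d1 + width d2).+1 = a + n by lia.
split=> /= [t|x]; rewrite ?inE ?mem_cat e2.
  by case/orP => [/t1|/t2].
rewrite !inE e1 e3 => /or4P[/s1|/eqP->|/eqP->|/s2] //.
  by exists u.+1, (Some (a + n)).
by exists u, (Some a).
Qed.

End Realize.

Definition tiles (l : nat) (d : dissection) : {set {set {set option 'I_l.+2}}} :=
  [set P in map (tip_polygon l) (tips d 0) ++ map (chain_triangle l) (triangles d 0)].

Section Triangles.
Variable l : nat.
Local Notation lb := (chain_label l).

Lemma lb_set2_eq i j x y : i < j -> j <= l.+1 -> x < y -> y <= l.+1 ->
  ([set lb x; lb y] == [set lb i; lb j]) = (x == i) && (y == j).
Proof.
move=> ij hj xy hy; apply/eqP/andP => [e1|[/eqP-> /eqP->] //].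
have hi : i <= l.+1 by lia.
have hx : x <= l.+1 by lia.
move/setP: e1 => e1; have := e1 (lb i); have := e1 (lb j).
by rewrite !inE !eqxx ?orbT !lb_eq //; lia.
Qed.

Lemma chain_triangle_set i k j : i < k -> k < j -> j <= l.+1 ->
  chain_triangle l (i, k, j) = [set [set lb i; lb k]; [set lb k; lb j]; [set lb i; lb j]].
Proof.
move=> ik kj hj; rewrite /chain_triangle /= triangle_set; first by rewrite (setUC [set lb j]).
by rewrite /= !inE !negb_or !lb_eq; lia.
Qed.

Lemma chain_triangle_edge i k j x y : i < k -> k < j -> j <= l.+1 -> x < y -> y <= l.+1 ->
  [set lb x; lb y] \in chain_triangle l (i, k, j) ->
  [\/ x = i /\ y = k, x = k /\ y = j | x = i /\ y = j].
Proof.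
move=> ik kj hj xy hy; have hk : k <= l.+1 by lia.
rewrite chain_triangle_set // !inE !lb_set2_eq //; last by lia.
by case/orP => [/orP[]|] /andP[/eqP-> /eqP->]; [apply: Or31|apply: Or32|apply: Or33].
Qed.

Lemma chain_triangle_cover i k j x : i < k -> k < j -> j <= l.+1 -> x <= l.+1 ->
  (lb x \in cover (chain_triangle l (i, k, j))) = [|| x == i, x == k | x == j].
Proof.
move=> ik kj hj hx; rewrite chain_triangle_set // /cover !bigcup_setU !big_set1.
by rewrite !inE !lb_eq //; lia.
Qed.

Lemma chain_triangle_notip i k j : i < k -> k < j -> j <= l.+1 ->
  None \notin cover (chain_triangle l (i, k, j)).
Proof. by move=> ik kj hj; rewrite chain_triangle_set // /cover !bigcup_setU !big_set1 !inE. Qed.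

End Triangles.

Section Step.
Variables (R : realType) (l : nat).
Local Notation label := (option 'I_l.+2).
Variables (a : label -> 'rV[R]_2) (s : R).
Hypothesis gp : general_position a.
Hypothesis s0 : (s != 0)%R.
Local Notation sgn3 := (sgn_of a s).
Local Notation lb := (chain_label l).
Hypothesis tip_pos : forall i j, i < j -> j <= l.+1 -> (0 < sgn3 None (lb i) (lb j))%R.
Hypothesis chain_neg : forall i j k, i < j -> j < k -> k <= l.+1 ->
  (sgn3 (lb i) (lb j) (lb k) < 0)%R.
Implicit Types P Q : {set {set label}}.

Lemma triple_balance (A B C x y z : R) : (0 < A)%R -> (0 < B)%R -> (0 < C)%R ->
  (x <= 0)%R -> (y <= 0)%R -> (z <= 0)%R -> (A * x + B * y + C * z = 0)%R -> [/\ x = 0, y = 0 & z = 0]%R.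
Proof.
move=> hA hB hC hx hy hz e.
have p1 : (0 <= A * - x)%R by rewrite mulr_ge0 ?oppr_ge0 // ltW.
have p2 : (0 <= B * - y)%R by rewrite mulr_ge0 ?oppr_ge0 // ltW.
have p3 : (0 <= C * - z)%R by rewrite mulr_ge0 ?oppr_ge0 // ltW.
rewrite !mulrN in p1 p2 p3.
have z1 : (A * x = 0)%R by lra.
have z2 : (B * y = 0)%R by lra.
have z3 : (C * z = 0)%R by lra.
have q0 (u t : R) : (0 < u -> u * t = 0 -> t = 0)%R.
  by move=> hu /eqP; rewrite mulf_eq0 (gt_eqF hu) => /eqP.
by split; [apply: q0 hA z1|apply: q0 hB z2|apply: q0 hC z3].
Qed.

(** A chain point v lies inside the triangle spanned by the tip and
    two chain points on either side of it.  So the directions of these three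
    edges positively span the plane, and no angle at v exceeds pi. *)
Lemma pointed_obstruction (E : {set {set label}}) x v y : x < v -> v < y -> y <= l.+1 ->
  [set None; lb v] \in E -> [set lb x; lb v] \in E -> [set lb v; lb y] \in E ->
  ~ pointed a E (lb v).
Proof.
move=> xv vy hy eN ex ey; have nvx : v != x by rewrite neq_ltn xv orbT.
move=> [i [j [ei ej hk hij]]].
have key k : [set lb v; k] \in E -> (orient (a (lb v)) (a i) (a k) <= 0)%R.
  by move=> /hk; rewrite /in_ccw_angle ltNge (ltW hij) /= negb_or -!leNgt => /andP[].
have h1 : (orient (a (lb v)) (a i) (a None) <= 0)%R by apply: key; rewrite setUC.
have h2 : (orient (a (lb v)) (a i) (a (lb x)) <= 0)%R by apply: key; rewrite setUC.
have h3 : (orient (a (lb v)) (a i) (a (lb y)) <= 0)%R by apply: key.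
have vl : v <= l.+1 := ltnW (leq_trans vy hy).
have xl : x <= l.+1 := ltnW (leq_trans xv vl).
have pA := chain_neg xv vy hy; have pB := tip_pos vy hy; have pC := tip_pos xv vl.
have [] := @triple_balance (- sgn3 (lb x) (lb v) (lb y)) (sgn3 None (lb v) (lb y)) (sgn3 None (lb x) (lb v))
   (orient (a (lb v)) (a i) (a None)) (orient (a (lb v)) (a i) (a (lb x))) (orient (a (lb v)) (a i) (a (lb y))).
- by rewrite oppr_gt0.
- by [].
- by [].
- by [].
- by [].
- by [].
- by rewrite /sgn_of /side_of /orient; ring.
move=> z1 z2 z3.
have iv : i != lb v.
  by apply: contraTneq hij => ->; rewrite /orient !subrr !mul0r subrr ltxx.
have vi : lb v != i by rewrite eq_sym.
have [iN|iN] := eqVneq i None.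
  have vx : lb v != lb x by rewrite lb_eq.
  have := gp (i := lb v) (j := i) (k := lb x) vi; rewrite z2 eqxx => /(_ _ vx) h.
  by have: false by apply: h; rewrite iN.
by have := gp (i := lb v) (j := i) (k := None) vi iN; rewrite z1 eqxx => /(_ isT).
Qed.

Section PseudoTriangulation.
Variable T : {set {set {set label}}}.
Hypothesis hT : pseudo_triangulation a T.

(** The tile below the chord has it as a side and covers the side of the tip
    near it.  This excludes the chords from k to u and from v to k' of a tile
    at the tip and the short sides of a triangle, which see the tile on the
    other side. *)
Lemma step_holds x y : x < y -> y <= l.+1 -> y != x.+1 ->
  ([set lb x; lb y] \in edges T) || ((x == 0) && (y == l.+1)) -> chord_step T x y.
Proof.
move=> xy hy ny he; have [P [hP hin hf]] := chord_below gp s0 tip_pos chain_neg hT xy hy he.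
have xl : x <= l by lia.
have tr := tile_regular hT hP.
have [[i [k [j [ik kj hj e]]]]|[u [v [k [k' [ok e]]]]]] := tile_shape gp s0 tip_pos chain_neg hT hP.
  rewrite e in hin hf tr hP; have hk : k <= l.+1 by lia.
  have side_false x' y' : x' < y' -> y' <= l.+1 ->
      (forall z, x' < z < y' -> [|| z == i, z == k | z == j] = false) ->
      parity (chain_triangle l (i, k, j)) (under (fan x' y')) = false.
    move=> h1 h2 h3; rewrite (fan_empty tr h1 h2) => [|z hz].
      by rewrite crossings_notip // chain_triangle_notip.
    by rewrite chain_triangle_cover ?h3 //; lia.
  case: (chain_triangle_edge ik kj hj xy hy hin) => [[ex ey]|[ex ey]|[ex ey]].
  - by move: hf; rewrite ex ey side_false //; lia.
  - by move: hf; rewrite ex ey side_false //; lia.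
  - by rewrite ex ey; apply: Or41; exists k.
have [uv hv hk hk'] := ok; rewrite e in hin hf hP tr.
have gt k0 k0' : k = k0 -> k' = k0' -> gap_tile T u v k0 k0' by move=> <- <-.
have [[e1 e2]|[e1 e2]|[c [hc e1 e2]]] := gap_edge ok xy hy hin.
- have xu := hk _ e1; exfalso; move: hf; rewrite (fan_empty tr xy hy) ?gap_crossings //; first by lia.
  move=> z hz; rewrite gap_cover //; last by lia.
  rewrite e1; apply/negP => /or3P[|/eqP[]|/eqP/hk']; lia.
- have vy := hk' _ e2; exfalso; move: hf; rewrite (fan_empty tr xy hy) ?gap_crossings //; first by lia.
  move=> z hz; rewrite gap_cover //; last by lia.
  rewrite e2; apply/negP => /or3P[|/eqP/hk|/eqP[]]; lia.
rewrite /core_left in e1 e2; have [cu|cu] := eqVneq c u; have [cv|cv] := eqVneq c.+1 v;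
  rewrite ?(negPf cu) ?(negPf cv) ?cv ?cu ?eqxx in e1 e2.
- have vu : v = u.+1 by rewrite -cv cu.
  case ek : k e1 => [k0|] /= e1; case ek' : k' e2 => [k0'|] /= e2.
  + by apply: Or44; exists u; rewrite e1 e2 -vu; apply: gt.
  + by apply: Or42; exists v, None; rewrite e1 e2 {1}vu; apply: gt.
  + by apply: Or43; exists u, None; rewrite e1 e2 -vu; apply: gt.
  + by move: ny; rewrite e1 e2 vu eqxx.
- case ek : k e1 => [k0|] /= e1; last by move: ny; rewrite e1 e2 eqxx.
  by apply: Or42; exists v, k'; rewrite e1 e2; apply: gt.
- case ek' : k' e2 => [k0'|] /= e2; last by move: ny; rewrite e1 e2 -cv eqxx.
  by apply: Or43; exists u, k; rewrite e1 e2 cv; apply: gt.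
- by move: ny; rewrite e1 e2 eqxx.
Qed.

End PseudoTriangulation.
End Step.

(** * Spokes determine the tiles at the tip *)

Lemma gap_left_eq l u v k k' x : gap_ok l u v k k' -> x < u ->
  [set chain_label l x; chain_label l u] \in gap_polygon l u v k k' -> k = Some x.
Proof.
move=> ok xu hin; have [uv hv hk hk'] := ok; have hu : u <= l.+1 by lia.
have [[e1 e2]|[e1 e2]|[c [hc e1 e2]]] := gap_edge ok xu hu hin => //; first by lia.
move: e2; rewrite /core_left; case: eqP => e3; last by lia.
by case: k' hk' {ok hin} => [y|] hk' /=; [have := hk' _ erefl; lia|lia].
Qed.

Lemma gap_right_eq l u v k k' y : gap_ok l u v k k' -> v < y -> y <= l.+1 ->
  [set chain_label l v; chain_label l y] \in gap_polygon l u v k k' -> k' = Some y.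
Proof.
move=> ok vy hy hin; have [uv hv hk hk'] := ok.
have [[e1 e2]|[e1 e2]|[c [hc e1 e2]]] := gap_edge ok vy hy hin => //; first by lia.
move: e1; rewrite /core_left; case: eqP => e3; last by lia.
by case: k hk {ok hin} => [x|] hk /=; [have := hk _ erefl; lia|lia].
Qed.

Section Rigidity.
Variables (R : realType) (l : nat).
Local Notation label := (option 'I_l.+2).
Variables (a : label -> 'rV[R]_2) (s : R).
Hypothesis gp : general_position a.
Hypothesis s0 : (s != 0)%R.
Local Notation sgn3 := (sgn_of a s).
Local Notation lb := (chain_label l).
Hypothesis tip_pos : forall i j, i < j -> j <= l.+1 -> (0 < sgn3 None (lb i) (lb j))%R.
Hypothesis chain_neg : forall i j k, i < j -> j < k -> k <= l.+1 ->
  (sgn3 (lb i) (lb j) (lb k) < 0)%R.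
Variable T : {set {set {set label}}}.
Hypothesis hT : pseudo_triangulation a T.

Lemma gap_tile_same c u v k k' u' v' q q' : gap_tile T u v k k' -> gap_tile T u' v' q q' ->
  u <= c < v -> u' <= c < v' -> gap_polygon l u v k k' = gap_polygon l u' v' q q'.
Proof.
move=> [ok hP] [ok' hQ] h1 h2; have [_ hv _ _] := ok.
by apply: (@sector_unique _ _ _ _ gp s0 tip_pos T hT c) => //; rewrite ?gap_crossings //; lia.
Qed.

(** The sectors that a tile at the tip covers are those from u to v. *)
Lemma gap_polygon_ends u v k k' u' v' q q' : gap_ok l u v k k' -> gap_ok l u' v' q q' ->
  gap_polygon l u v k k' = gap_polygon l u' v' q q' -> u = u' /\ v = v'.
Proof.
move=> ok ok' e; have ce c : (u <= c < v) = (u' <= c < v') by rewrite -(gap_crossings _ ok) e gap_crossings.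
have [uv _ _ _] := ok; have [uv' _ _ _] := ok'.
have := ce u; have := ce u'; have := ce v.-1; have := ce v'.-1; lia.
Qed.

(** Such an edge at the tip would bound another tile that covers one of the
    same sectors. *)
Lemma gap_tip_between u v k k' w : gap_tile T u v k k' -> w <= l.+1 ->
  [set None; lb w] \in edges T -> u < w -> w < v -> False.
Proof.
move=> [ok hP] hw /bigcupP[Q hQ hin] uw wv.
have [[i [x [j [ik kj hj e]]]]|[u' [v' [q [q' [ok' e]]]]]] := tile_shape gp s0 tip_pos chain_neg hT hQ.
  have /negP[] := chain_triangle_notip ik kj hj.
  by rewrite -e; apply/bigcupP; exists [set None; lb w]; rewrite // !inE eqxx.
have [uv hv _ _] := ok; have [uv' hv' _ _] := ok'.
have tQ : gap_tile T u' v' q q' by split; rewrite -?e.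
have hu' : u' <= l.+1 by lia.
move: hin; rewrite e; have [_ _ _ ->] := gap_neighbours ok'.
rewrite !lb_eq // => hwe.
have [c [h1 h2]] : exists c, u <= c < v /\ u' <= c < v'.
  by case/orP: hwe => /eqP we; [exists w|exists w.-1]; lia.
have [] := gap_polygon_ends ok ok' (gap_tile_same (conj ok hP) tQ h1 h2).
by case/orP: hwe => /eqP we; lia.
Qed.

Lemma sector_gap c : c <= l -> exists u v k k', gap_tile T u v k k' /\ u <= c < v.
Proof.
move=> hc; have [P hP cP] := sector_exists gp s0 tip_pos hT hc.
have [[i [x [j [ik kj hj e]]]]|[u' [v' [q [q' [ok' e]]]]]] := tile_shape gp s0 tip_pos chain_neg hT hP.
  move: cP; rewrite crossings_notip //; first exact: (tile_regular hT hP).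
  by rewrite e chain_triangle_notip.
exists u', v', q, q'; split; first by split; rewrite -?e.
by move: cP; rewrite e gap_crossings.
Qed.

Hypothesis hpt : forall v, pointed a (edges T) v.
Variable d : dissection.
Hypothesis wd : width d = l.+1.
Hypothesis rd : realized T d 0.

Lemma left_spoke_realized w k : (w, Some k, None) \in spokes d 0 ->
  [/\ exists v k', gap_tile T w v (Some k) k', k < w, [set None; lb w] \in edges T & [set lb k; lb w] \in edges T].
Proof.
move=> /(rd.2)[v [k' ht]]; have [ok hP] := ht; have [_ _ hk _] := ok.
split; [by exists v, k'|exact: hk| |]; apply: edges_mem hP _.
  exact: gap_tip_left.
exact: gap_left_link.
Qed.

Lemma right_spoke_realized w k : (w, None, Some k) \in spokes d 0 ->
  [/\ exists u k', gap_tile T u w k' (Some k), w < k, k <= l.+1, [set None; lb w] \in edges T & [set lb w; lb k] \in edges T].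
Proof.
move=> /(rd.2)[v [k' ht]]; have [ok hP] := ht; have [_ _ _ hk] := ok.
have [|h1 h2] := andP (hk k _) => //.
split=> //; [by exists v, k'| |]; apply: edges_mem hP _.
  exact: gap_tip_right.
exact: gap_right_link.
Qed.

Lemma spoke_tip x : x \in spokes d 0 -> [set None; lb (foot x)] \in edges T.
Proof.
move=> hx; have [k [[e _]|[e _]]] := spoke_sides hx; rewrite e in hx.
  by have [] := left_spoke_realized hx.
by have [] := right_spoke_realized hx.
Qed.

(** A chain point that is not a recorded foot is the apex of a triangle, so
    it has chords on both sides. *)
Lemma no_other_spoke w : 0 < w -> w <= l -> [set None; lb w] \in edges T -> w \in map foot (spokes d 0).
Proof.
move=> w0 wl he; apply/negPn/negP => hn.
have [|i [j hij]] := triangle_apex (d := d) (a := 0) _ hn; first by rewrite wd; lia.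
have [_ iw wj hj] := triangles_bound hij; rewrite add0n wd in hj.
have [e1 e2 _] := chain_triangle_edges iw wj hj; have ht := (rd.1) _ hij.
exact: (pointed_obstruction gp tip_pos chain_neg iw wj hj he (edges_mem ht e1) (edges_mem ht e2) (hpt _)).
Qed.

Lemma not_both_sides x w y : x < w -> w < y -> y <= l.+1 -> [set None; lb w] \in edges T ->
  [set lb x; lb w] \in edges T -> [set lb w; lb y] \in edges T -> False.
Proof. by move=> h1 h2 h3 h4 h5 h6; apply: (pointed_obstruction gp tip_pos chain_neg h1 h2 h3 h4 h5 h6). Qed.

(** The tile of T that covers the sector at the first of two consecutive feet
    is bounded by exactly these feet, since there are no other edges at the tip.
    An extra corner of it at a foot is the recorded one if the spoke recorded it
    for this tile, and is excluded by pointedness otherwise. *)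
Lemma tips_realized t : t \in tips d 0 -> tip_polygon l t \in T.
Proof.
move=> /tips_spokes[x [y [-> xy hx hy hz]]]; rewrite wd add0n in hy.
have yl : foot y <= l.+1.
  case: hy => [->|] //; by move/foot_bound; rewrite wd add0n => /andP[_ /ltnW].
have xl : foot x <= l by lia.
have [u [v [k [k' [ht /andP[ux xv]]]]]] := sector_gap xl.
have [ok hP] := ht; have [uv hv hk hk'] := ok.
have eu : u = foot x.
  case: hx => [ex|hx]; first by move: ux; rewrite ex leqn0 => /eqP.
  apply/eqP; rewrite eqn_leq ux leqNgt; apply/negP => lt.
  by apply: (gap_tip_between ht _ (spoke_tip hx) lt xv); rewrite ltnW.
have ev : v = foot y.
  apply/eqP; rewrite eqn_leq; apply/andP; split; rewrite leqNgt; apply/negP => lt.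
    case: hy => [ey|hy]; first by move: lt; rewrite ey /foot /=; lia.
    by apply: (gap_tip_between ht yl (spoke_tip hy) _ lt); rewrite eu.
  have vf : v \in map foot (spokes d 0).
    by apply: no_other_spoke; [lia|lia|exact: edges_mem hP (gap_tip_right ok)].
  by have /mapP[z /hz h e] := vf; lia.
suff -> : tile_path x y = gap_path u v k k' by [].
rewrite /tile_path -eu -ev.
have -> : k = x.1.2.
  case: hx => [ex|hx].
    by rewrite ex in eu *; case: k hk {ht ok hP} => //= z hk; have := hk _ erefl; rewrite eu.
  have [q [[e _]|[e _]]] := spoke_sides hx; rewrite e -eu in hx *.
    have [[v0 [k0 ht0]] qu _ hin] := left_spoke_realized hx; rewrite /=.
    have [ok0 hP0] := ht0; have [uv0 _ _ _] := ok0.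
    apply: (gap_left_eq ok qu); rewrite (gap_tile_same ht ht0 (c := u)) ?leqnn //.
    exact: gap_left_link.
  have [_ h1 h2 h3 h4] := right_spoke_realized hx; rewrite /=.
  case: k hk ht ok hP => //= z hk ht ok hP; exfalso; have zu := hk _ erefl.
  exact: (not_both_sides zu h1 h2 h3 (edges_mem hP (gap_left_link ok)) h4).
have -> : k' = y.2.
  case: hy => [ey|hy].
    by rewrite ey in ev *; case: k' hk' {ht ok hP} => //= z hk'; have := hk' _ erefl; rewrite ev /foot /=; lia.
  have [q [[e _]|[e _]]] := spoke_sides hy; rewrite e -ev in hy *.
    have [_ h1 h2 h3] := left_spoke_realized hy; rewrite /=.
    case: k' hk' ht ok hP => //= z hk' ht ok hP; exfalso; have /andP[vz hz'] := hk' _ erefl.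
    exact: (not_both_sides h1 vz hz' h2 h3 (edges_mem hP (gap_right_link ok))).
  have [[u0 [k0 ht0]] h1 h2 _ hin] := right_spoke_realized hy; rewrite /=.
  have [ok0 hP0] := ht0; have [uv0 _ _ _] := ok0.
  have r1 : u <= v.-1 < v by lia.
  have r2 : u0 <= v.-1 < v by lia.
  apply: (gap_right_eq ok h1 h2); rewrite (gap_tile_same ht ht0 r1 r2).
  exact: gap_right_link.
by [].
Qed.

Lemma tiles_realized : tiles l d \subset T.
Proof.
apply/subsetP => P; rewrite inE mem_cat => /orP[/mapP[t ht ->]|/mapP[t ht ->]].
  exact: tips_realized.
exact: rd.1.
Qed.

End Rigidity.

(** * The tiles of a dissection are pseudo-triangles *)

Section Simple.
Variables (R : realType) (l : nat).
Local Notation label := (option 'I_l.+2).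
Variables (a : label -> 'rV[R]_2) (s : R).
Hypothesis gp : general_position a.
Hypothesis s0 : (s != 0)%R.
Local Notation sgn3 := (sgn_of a s).
Local Notation lb := (chain_label l).
Hypothesis tip_pos : forall i j, i < j -> j <= l.+1 -> (0 < sgn3 None (lb i) (lb j))%R.
Hypothesis chain_neg : forall i j k, i < j -> j < k -> k <= l.+1 ->
  (sgn3 (lb i) (lb j) (lb k) < 0)%R.
Implicit Types P Q : {set {set label}}.

Lemma meet_at_endpoint (v x y : label) q : x != v -> y != v -> x != y ->
  conv a [set v; x] q -> conv a [set v; y] q -> q = a v.
Proof.
move=> xv yv xy /(conv_edgeP _ _)[|t _ ->]; first by rewrite eq_sym.
move=> /(@conv_edge_side R l a s) h; have := h (_ : v != y); rewrite eq_sym yv => /(_ isT).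
rewrite /side_of (_ : orient _ _ _ = t * orient (a v) (a y) (a x))%R; last first.
  by rewrite /orient !coE; ring.
move/eqP; rewrite !mulf_eq0 (negPf s0) /= => /orP[/eqP->|].
  by rewrite scale0r addr0 subr0 scale1r.
have /negPf-> // : orient (a v) (a y) (a x) != 0%R.
by apply: gp; rewrite // eq_sym.
Qed.

Lemma apart_by_line (i j x y : label) q : i != j -> x != y -> (0 < sgn3 i j x * sgn3 i j y)%R ->
  conv a [set i; j] q -> conv a [set x; y] q -> False.
Proof.
move=> ij xy h /(conv_edge_side s ij) e /(conv_edgeP _ _ xy)[t /andP[t0 t1] eq].
have : ((1 - t) * sgn3 i j x + t * sgn3 i j y = 0)%R.
  by rewrite -[RHS]e eq /sgn_of /side_of /orient !coE; ring.
move: h; move: (sgn3 i j x) (sgn3 i j y) => X Y h e'.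
have X0 : (0 < X * X)%R by rewrite -expr2 exprn_even_gt0 //=; apply: contraTneq h => ->; rewrite mul0r ltxx.
have e2 : ((1 - t) * (X * X) + t * (X * Y) = 0)%R by rewrite -[RHS](mulr0 X) -e'; ring.
have p1 : (0 <= (1 - t) * (X * X))%R by rewrite mulr_ge0 ?subr_ge0 // ltW.
have p2 : (0 <= t * (X * Y))%R by rewrite mulr_ge0 // ltW.
have z1 : ((1 - t) * (X * X) = 0)%R by lra.
have z2 : (t * (X * Y) = 0)%R by lra.
move/eqP: z1; rewrite mulf_eq0 (gt_eqF X0) orbF => /eqP z1.
move/eqP: z2; rewrite mulf_eq0 (gt_eqF h) orbF => /eqP z2.
by move: z1; rewrite z2 subr0 => /eqP; rewrite oner_eq0.
Qed.

Lemma sgn_nested i x j : i < x -> x < j -> j <= l.+1 -> (0 < sgn3 (lb i) (lb j) (lb x))%R.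
Proof. by move=> h1 h2 h3; rewrite sgn3_swap_last oppr_gt0 chain_neg. Qed.

Lemma sgn_beyond i j x : i < j -> j < x -> x <= l.+1 -> (sgn3 (lb i) (lb j) (lb x) < 0)%R.
Proof. exact: chain_neg. Qed.

(** The tip and the chain points between i and j are on the same side of the
    chord (i, j), so an edge at the tip does not cross chords. *)
Lemma tip_edge_meet x i j q : x <= l.+1 -> i < j -> j <= l.+1 ->
  conv a [set None; lb x] q -> conv a [set lb i; lb j] q ->
  exists2 k, k \in [set None; lb x] :&: [set lb i; lb j] & q = a k.
Proof.
move=> hx ij hj c1 c2; have hi : i <= l.+1 by lia.
have nij : lb i != lb j by rewrite lb_eq // neq_ltn ij.
have [xi|nxi] := eqVneq x i.
  exists (lb x); first by rewrite xi !inE !eqxx ?orbT.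
  apply: (@meet_at_endpoint (lb x) None (lb j)) => //; rewrite ?xi //; last by rewrite setUC -xi.
  by rewrite eq_sym.
have [xj|nxj] := eqVneq x j.
  exists (lb x); first by rewrite xj !inE !eqxx ?orbT.
  apply: (@meet_at_endpoint (lb x) None (lb i)) => //; rewrite ?xj //; first by rewrite setUC -xj.
  by rewrite setUC.
exfalso; have [in_|] := boolP (i < x < j).
  have /andP[ix xj] := in_.
  apply: (@apart_by_line (lb i) (lb j) None (lb x) q) => //.
  by rewrite mulr_gt0 ?sgn_nested // -sgn3_rot tip_pos.
move=> out; have out' : (x < i) || (j < x) by lia.
apply: (@apart_by_line None (lb x) (lb i) (lb j) q) => //.
case/orP: out' => h.
  by rewrite mulr_gt0 // tip_pos // (ltn_trans h).
by rewrite nmulr_rgt0 1?sgn3_swap_last ?oppr_lt0 ?tip_pos // -?sgn3_rot ?sgn3_swap_last ?oppr_lt0 ?tip_pos // (ltn_trans ij).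
Qed.

Lemma chain_edges_meet i j i' j' q : i < j -> j <= l.+1 -> i' < j' -> j' <= l.+1 ->
  (i, j) != (i', j') -> ~~ [&& i < i', i' < j & j < j'] -> ~~ [&& i' < i, i < j' & j' < j] ->
  conv a [set lb i; lb j] q -> conv a [set lb i'; lb j'] q ->
  exists2 k, k \in [set lb i; lb j] :&: [set lb i'; lb j'] & q = a k.
Proof.
wlog ii : i j i' j' / i <= i'.
  move=> W ij hj ij' hj' ne n1 n2 c1 c2; case: (leqP i i') => h; first exact: (W i j i' j').
  rewrite setIC; apply: (W i' j' i j) => //; first exact: ltnW.
  by rewrite eq_sym.
move=> ij hj ij' hj' ne n1 n2 c1 c2.
have hi : i <= l.+1 by lia.
have hi' : i' <= l.+1 by lia.
have nij : lb i != lb j by rewrite lb_eq // neq_ltn ij.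
have nij' : lb i' != lb j' by rewrite lb_eq // neq_ltn ij'.
have share x y z : x <= l.+1 -> y <= l.+1 -> z <= l.+1 -> y != x -> z != x -> y != z ->
    conv a [set lb x; lb y] q -> conv a [set lb x; lb z] q -> q = a (lb x).
  move=> hx hy hz yx zx yz; apply: meet_at_endpoint; by rewrite lb_eq.
have [e1|ne1] := eqVneq i i'.
  exists (lb i); first by rewrite e1 !inE !eqxx ?orbT.
  apply: (share i j j') => //; [lia|lia| |by rewrite e1].
  by apply: contraNneq ne => e2; rewrite e1 e2.
have [e2|ne2] := eqVneq j j'.
  exists (lb j); first by rewrite e2 !inE !eqxx ?orbT.
  by apply: (share j i i') => //; rewrite 1?setUC //; [lia|lia|rewrite e2].
have [e3|ne3] := eqVneq j i'.
  exists (lb j); first by rewrite e3 !inE !eqxx ?orbT.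
  by apply: (share j i j') => //; rewrite 1?setUC //; [lia|lia|lia|rewrite setUC e3].
exfalso; have [nest|out] := boolP (j' < j).
  by apply: (@apart_by_line (lb i) (lb j) (lb i') (lb j') q) => //; rewrite mulr_gt0 // sgn_nested //; lia.
apply: (@apart_by_line (lb i) (lb j) (lb i') (lb j') q) => //.
by rewrite nmulr_rgt0 ?sgn_beyond //; lia.
Qed.

(** Two disjoint chords that do not cross are separated by the line of
    one of them, and edges at the tip never cross chords. *)
Lemma simple_cycle_edges (t : seq label) : uniq t -> 2 < size t ->
  (forall i j i' j', [set lb i; lb j] \in cycle_edges t -> [set lb i'; lb j'] \in cycle_edges t ->
     i < i' -> i' < j -> j < j' -> j' <= l.+1 -> False) ->
  simple_polygon a (cycle_edges t).
Proof.
move=> ut st nc; exists t; split=> // e f q he hf ef c1 c2.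
have tr := cycle_two_regular ut st.
have [[j hj ee]|[i [j [ij hj ee]]]] := edge_case tr he; have [[j' hj' ff]|[i' [j' [ij' hj' ff]]]] := edge_case tr hf;
  rewrite ee ff in ef he hf c1 c2 *.
- exists None; first by rewrite !inE !eqxx.
  apply: (meet_at_endpoint _ _ _ c1 c2) => //; by apply: contraNneq ef => ->.
- exact: tip_edge_meet.
- by rewrite setIC; apply: tip_edge_meet.
apply: chain_edges_meet => //.
- by apply: contraNneq ef => -[-> ->].
- by apply/negP => /and3P[h1 h2 h3]; apply: (nc i j i' j').
- by apply/negP => /and3P[h1 h2 h3]; apply: (nc i' j' i j).
Qed.

End Simple.

Definition gap_interior u v k k' : seq nat := seq_of_opt k ++ iota u.+1 (v - u).-1 ++ seq_of_opt k'.

Lemma gap_pathE u v k k' : gap_path u v k k' = u :: rcons (gap_interior u v k k') v.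
Proof. by rewrite /gap_path -cats1 -!catA. Qed.

Lemma mem_gap_interior u v k k' x : u < v ->
  (x \in gap_interior u v k k') = [|| u < x < v, k == Some x | k' == Some x].
Proof.
move=> uv; have sE y : (Some y == Some x) = (x == y) by rewrite eq_sym.
have nE : (None == Some x) = false by [].
rewrite /gap_interior !mem_cat mem_iota.
by case: k => [y|]; case: k' => [z|] /=; rewrite ?sE ?nE ?mem_seq1 ?in_nil; lia.
Qed.

Lemma gap_head l u v k k' : gap_ok l u v k k' -> (u < head v (gap_interior u v k k')) = (k == None).
Proof.
move=> [uv hv hk hk']; rewrite /gap_interior; case: k hk => [x|] hk /=.
  by rewrite -[Some x == None]/false; have := hk _ erefl; lia.
rewrite eqxx; case e : (v - u).-1 => [|n] /=; last by lia.
by case: k' hk' => [y|] hk' //=; have := hk' _ erefl; lia.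
Qed.

Lemma gap_last l u v k k' : gap_ok l u v k k' -> (last u (gap_interior u v k k') < v) = (k' == None).
Proof.
move=> [uv hv hk hk']; rewrite /gap_interior catA last_cat; case: k' hk' => [y|] hk' /=.
  by rewrite -[Some y == None]/false; have := hk' _ erefl; lia.
rewrite eqxx last_cat; set z := last u _; have zu : z <= u.
  by rewrite {}/z; case: k hk => [x|] hk //=; have := hk _ erefl; lia.
by have := mem_last z (iota u.+1 (v - u).-1); rewrite inE mem_iota; move: (last z _) => y; lia.
Qed.

Section Tiles.
Variables (R : realType) (l : nat).
Local Notation label := (option 'I_l.+2).
Variables (a : label -> 'rV[R]_2) (s : R).
Hypothesis gp : general_position a.
Hypothesis s0 : (s != 0)%R.
Local Notation sgn3 := (sgn_of a s).
Local Notation lb := (chain_label l).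
Hypothesis tip_pos : forall i j, i < j -> j <= l.+1 -> (0 < sgn3 None (lb i) (lb j))%R.
Hypothesis chain_neg : forall i j k, i < j -> j < k -> k <= l.+1 ->
  (sgn3 (lb i) (lb j) (lb k) < 0)%R.

(** The corners next to the tip are u and v themselves exactly when there is no
    extra corner beyond them. *)
Lemma gap_convex u v k k' x : gap_ok l u v k k' -> x <= l.+1 ->
  convex_vertex a (gap_polygon l u v k k') (lb x) <-> (x == odflt u k) || (x == odflt v k').
Proof.
move=> ok hx; have [ut ht] := gap_path_ok ok; have [uv hv hk hk'] := ok.
have hk1 : odflt u k <= u by case: k hk {ok ut ht} => [y|] hk //=; apply: ltnW; apply: hk.
have hk1' : v <= odflt v k' by case: k' hk' {ok ut ht} => [y|] hk' //=; apply: ltnW; case/andP: (hk' _ erefl).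
have kE : (k == Some x) = (x == odflt u k) && (x != u).
  case: k hk {ok ut ht hk1} => [y|] hk /=; last by case: (x == u).
  have := hk _ erefl; rewrite -[Some y == Some x]/(y == x) eq_sym; lia.
have kE' : (k' == Some x) = (x == odflt v k') && (x != v).
  case: k' hk' {ok ut ht hk1'} => [y|] hk' /=; last by case: (x == v).
  have := hk' _ erefl; rewrite -[Some y == Some x]/(y == x) eq_sym; lia.
have kN : (k == None) = (odflt u k == u).
  case: k hk {ok ut ht hk1 kE} => [y|] hk /=; last by rewrite !eqxx.
  by have := hk _ erefl; rewrite -[Some y == None]/false; lia.
have kN' : (k' == None) = (odflt v k' == v).
  case: k' hk' {ok ut ht hk1' kE'} => [y|] hk' /=; last by rewrite !eqxx.
  by have := hk' _ erefl; rewrite -[Some y == None]/false; lia.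
have [xu|xu] := eqVneq x u.
  rewrite xu /gap_polygon gap_pathE; rewrite gap_pathE in ut ht.
  apply: (iff_trans (path_first_convex gp s0 tip_pos chain_neg ut ht uv)).
  rewrite (gap_head ok) kN (_ : (u == odflt u k) || (u == odflt v k') = (odflt u k == u)) //; lia.
have [xv|xv] := eqVneq x v.
  rewrite xv /gap_polygon gap_pathE; rewrite gap_pathE in ut ht.
  apply: (iff_trans (path_last_convex gp s0 tip_pos chain_neg ut ht uv)).
  rewrite (gap_last ok) kN' (_ : (v == odflt u k) || (v == odflt v k') = (odflt v k' == v)) //; lia.
rewrite xu andbT in kE; rewrite xv andbT in kE'; rewrite -kE -kE'.
have [xm|xm] := boolP (x \in gap_interior u v k k').
  rewrite /gap_polygon gap_pathE; rewrite gap_pathE in ut ht.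
  apply: (iff_trans (path_interior_convex gp s0 tip_pos chain_neg ut ht uv xm)).
  rewrite mem_gap_interior // in xm; rewrite (_ : (x < u) || (v < x) = (k == Some x) || (k' == Some x)) //.
  by rewrite kE kE' in xm *; lia.
rewrite mem_gap_interior // !negb_or in xm; have /and3P[n1 n2 n3] := xm; rewrite (negPf n2) (negPf n3).
split=> // /convex_cover; rewrite gap_cover // (negPf n2) (negPf n3) !orbF => h.
by exfalso; lia.
Qed.

Lemma gap_pseudo_triangle u v k k' : gap_ok l u v k k' -> pseudo_triangle a (gap_polygon l u v k k').
Proof.
move=> ok; have [ut ht] := gap_path_ok ok; have [uv hv hk hk'] := ok; split.
  apply: (simple_cycle_edges gp s0 tip_pos chain_neg).
  - exact: tip_uniq.
  - by rewrite gap_pathE /= size_map size_rcons.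
  move=> i j i' j' h1 h2 ii ij jj hj.
  have ij0 : i < j by lia.
  have ij0' : i' < j' by lia.
  have hj0 : j <= l.+1 by lia.
  have kb x : k = Some x -> x < u by move/hk.
  have kb' x : k' = Some x -> v < x by move/hk' => /andP[].
  have r1 := gap_edge ok ij0 hj0 h1; have r2 := gap_edge ok ij0' hj h2.
  have L : odflt u k <= u by case: k kb {ok ut ht hk h1 h2 r1 r2} => [y|] kb //=; apply/ltnW/kb.
  have M : v <= odflt v k' by case: k' kb' {ok ut ht hk' h1 h2 r1 r2} => [y|] kb' //=; apply/ltnW/kb'.
  have cases i0 j0 : [\/ k = Some i0 /\ j0 = u, i0 = v /\ k' = Some j0 |
      exists c, [/\ u <= c < v, i0 = core_left u k c & j0 = core_left v k' c.+1]] ->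
      [\/ i0 = odflt u k /\ j0 = u, i0 = v /\ j0 = odflt v k' |
        exists c, [/\ u <= c < v, i0 = if c == u then odflt u k else c &
                     j0 = if c.+1 == v then odflt v k' else c.+1]].
    by case=> [[-> ->]|[-> ->]|h]; [apply: Or31|apply: Or32|apply: Or33].
  have q1 := cases _ _ r1; have q2 := cases _ _ r2; clear cases r1 r2.
  move: q1 q2 L M {kb kb' h1 h2 hk hk' ut ht ok}.
  move: (odflt u k) (odflt v k') => L Rr.
  move=> q1 q2 hL hR; clear - q1 q2 hL hR ii ij jj uv.
  case: q1 => [[e1 e2]|[e1 e2]|[c [hc e1 e2]]]; case: q2 => [[e3 e4]|[e3 e4]|[c' [hc' e3 e4]]];
    move: e1 e2 e3 e4; do ?[case: eqP => ?]; lia.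
have hk1 : odflt u k <= u by case: k hk {ok ut ht} => [y|] hk //=; apply: ltnW; apply: hk.
have hk1' : v <= odflt v k' <= l.+1.
  by case: k' hk' {ok ut ht} => [y|] hk' //=; [have /andP[h1 ->] := hk' _ erefl; rewrite ltnW|rewrite leqnn].
have -> : [set x | `[< convex_vertex a (gap_polygon l u v k k') x >]] =
    None |: [set lb (odflt u k); lb (odflt v k')].
  apply/setP => x; rewrite !inE; have [->|[n hn ->]] := label_case x.
    rewrite eqxx /=; apply/asboolP; rewrite /gap_polygon gap_pathE; rewrite gap_pathE in ut ht.
    exact: (path_tip_convex gp s0 tip_pos ut ht uv).
  rewrite /= !lb_eq //; [|lia|lia].
  by apply/asboolP/idP => /(gap_convex ok hn).
rewrite cardsU1 cards2 !inE /= lb_eq; lia.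
Qed.

Lemma triangle_pseudo_triangle i k j : i < k -> k < j -> j <= l.+1 ->
  pseudo_triangle a (chain_triangle l (i, k, j)).
Proof.
move=> ik kj hj; have hi : i <= l.+1 by lia.
have hk : k <= l.+1 by lia.
have ut : uniq [:: lb i; lb k; lb j] by rewrite /= !inE !negb_or !lb_eq //; lia.
split.
  apply: (simple_cycle_edges gp s0 tip_pos chain_neg ut) => // i0 j0 i1 j1 h1 h2 ii ij jj hj'.
  have ij0 : i0 < j0 by lia.
  have ij0' : i1 < j1 by lia.
  have hj0 : j0 <= l.+1 by lia.
  by case: (chain_triangle_edge ik kj hj ij0 hj0 h1) => -[]; case: (chain_triangle_edge ik kj hj ij0' hj' h2) => -[]; lia.
have tr : two_regular (chain_triangle l (i, k, j)) by apply: cycle_two_regular.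
have cv : cover (chain_triangle l (i, k, j)) = [set x in [:: lb i; lb k; lb j]] by exact: cover_cycle_edges.
have e3 : #|cover (chain_triangle l (i, k, j))| = 3 by rewrite cv cardsE; have /card_uniqP -> := ut.
suff -> : [set x | `[< convex_vertex a (chain_triangle l (i, k, j)) x >]] = cover (chain_triangle l (i, k, j)) by [].
apply/setP => x; rewrite inE.
apply/asboolP/idP => [/convex_cover //|hx].
have [eN|[n hn en]] := label_case x.
  by case/negP: (chain_triangle_notip ik kj hj); rewrite -eN.
have [y [z nb]] := tr.2 _ hx; have [_ hy hz] := neighbours_cover nb.
have notip := chain_triangle_notip ik kj hj.
have [ey|[y' hy' ey]] := label_case y; first by case/negP: notip; rewrite -ey.
have [ez|[z' hz' ez]] := label_case z; first by case/negP: notip; rewrite -ez.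
rewrite en ey ez in nb *.
by apply/(convex_chain gp s0 tip_pos chain_neg tr nb hn hy' hz'); rewrite crossings_notip.
Qed.

End Tiles.

(** * The tiles of a dissection cover the hull once *)

Lemma tips_gap l d t : width d = l.+1 -> t \in tips d 0 ->
  exists u v k k', gap_ok l u v k k' /\ t = gap_path u v k k'.
Proof.
move=> wd /tips_spokes[x [y [-> xy hx hy _]]]; rewrite wd add0n in hy.
exists (foot x), (foot y), x.1.2, y.2; split=> //; split=> //.
- by case: hy => [->|/foot_bound] //; rewrite wd; lia.
- move=> k; case: hx => [-> //|/spoke_sides[k0 [[-> [_ h _ _]]|[-> _]]]] //= [<-] //.
- move=> k; case: hy => [-> //|/spoke_sides[k0 [[-> _]|[-> [h1 h2 _ _]]]]] //= [<-].
  by move: h1 h2; rewrite wd /foot /= => -> ->.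
Qed.

Lemma count_unique (T : eqType) (p : pred T) (r : seq T) (x y : T) :
  count p r <= 1 -> x \in r -> y \in r -> p x -> p y -> x = y.
Proof.
move=> h hx hy px py.
have hx' : x \in filter p r by rewrite mem_filter px.
have hy' : y \in filter p r by rewrite mem_filter py.
move: h hx' hy'; rewrite -size_filter; case: (filter p r) => [|z [|]] //= _.
by rewrite !inE => /eqP-> /eqP->.
Qed.

Section Cover.
Variables (R : realType) (l : nat).
Local Notation label := (option 'I_l.+2).
Variables (a : label -> 'rV[R]_2) (s : R).
Hypothesis gp : general_position a.
Hypothesis s0 : (s != 0)%R.
Local Notation sgn3 := (sgn_of a s).
Local Notation lb := (chain_label l).
Hypothesis tip_pos : forall i j, i < j -> j <= l.+1 -> (0 < sgn3 None (lb i) (lb j))%R.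
Hypothesis chain_neg : forall i j k, i < j -> j < k -> k <= l.+1 ->
  (sgn3 (lb i) (lb j) (lb k) < 0)%R.

Lemma under_hit B i j : i <= l.+1 -> j <= l.+1 -> i != j -> under B [set lb i; lb j] = hit B (i, j).
Proof.
move=> hi hj; rewrite /hit /=; case: ltngtP => // h _.
  by rewrite under_chain // (minn_idPl (ltnW h)) (maxn_idPr (ltnW h)).
by rewrite setUC under_chain // (minn_idPr (ltnW h)) (maxn_idPl (ltnW h)).
Qed.

Lemma count_links B x t : uniq (x :: t) -> {in x :: t, forall y, y <= l.+1} ->
  count (under B) (edge_list (lb x) (map lb t)) = count (hit B) (links (x :: t)).
Proof.
rewrite /links /edge_list; elim: t x => //= y t IH x; rewrite inE negb_or => /andP[/andP[xy _] ut] ht.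
have hx : x <= l.+1 by apply: ht; rewrite inE eqxx.
have hy : y <= l.+1 by apply: ht; rewrite !inE eqxx orbT.
rewrite under_hit // IH // => z hz; apply: ht; by rewrite inE hz orbT.
Qed.

Lemma encloses_tip q t : uniq t -> 1 < size t -> {in t, forall x, x <= l.+1} ->
  encloses a s (tip_polygon l t) q = odd_path (in_tip_triangle a s q) t.
Proof.
case: t => [|x [|y t]] // ut _ ht; rewrite /encloses /tip_polygon.
have us := tip_uniq ut ht.
rewrite (@parity_cycle _ None (lb x) (lb y :: map lb t)) // under_tip.
rewrite -[lb y :: map lb t]/(map lb (y :: t)) (count_links _ ut ht).
by rewrite [X in _ (+) _ (+) under _ X]setUC under_tip addbF.
Qed.

Lemma encloses_triangle q i k j : i < k -> k < j -> j <= l.+1 ->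
  encloses a s (chain_triangle l (i, k, j)) q = odd_triangle (in_tip_triangle a s q) (i, k, j).
Proof.
move=> ik kj hj; have hk : k <= l.+1 by lia.
have ut : uniq [:: lb i; lb k; lb j] by rewrite /= !inE !negb_or !lb_eq //; lia.
rewrite /encloses /chain_triangle /= (@parity_cycle _ (lb i) (lb k) [:: lb j]) // /odd_triangle /=.
rewrite [X in _ (+) _ (+) under _ X]setUC !under_chain //; last by lia.
by rewrite addn0 oddb.
Qed.

(** Interpolate the side of the line (x, y) between the vertices of the triangle
    that contains q. *)
Lemma below_side q u v x y : u < v -> v <= l.+1 -> in_tip_triangle a s q u v ->
  (0 <= sgn3 x y None)%R -> (0 <= sgn3 x y (lb u))%R -> (0 <= sgn3 x y (lb v))%R ->
  (0 < sgn3 x y None + sgn3 x y (lb u) + sgn3 x y (lb v))%R -> (0 < side_of a s x y q)%R.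
Proof.
move=> uv hv /and3P[h1 h2 h3] p1 p2 p3 p4; have h := tip_pos uv hv.
rewrite -(pmulr_rgt0 _ h).
have -> : (sgn3 None (lb u) (lb v) * side_of a s x y q =
  side_of a s (lb u) (lb v) q * sgn3 x y None + side_of a s (lb v) None q * sgn3 x y (lb u) +
  side_of a s None (lb u) q * sgn3 x y (lb v))%R by rewrite /sgn_of /side_of /orient; ring.
move: h1 h2 h3 p1 p2 p3 p4; move: (side_of a s _ _ _) (side_of a s _ _ _) (side_of a s _ _ _) => A B C.
move: (sgn3 x y None) (sgn3 x y (lb u)) (sgn3 x y (lb v)) => X Y Z hC hB hA hX hY hZ.
have pX : (0 <= A * X)%R by rewrite mulr_ge0 // ltW.
have pY : (0 <= B * Y)%R by rewrite mulr_ge0 // ltW.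
have pZ : (0 <= C * Z)%R by rewrite mulr_ge0 // ltW.
move=> hs; rewrite lt_neqAle (addr_ge0 (addr_ge0 pX pY) pZ) andbT eq_sym; apply/negP => /eqP e.
have zX : (A * X = 0)%R by lra.
have zY : (B * Y = 0)%R by lra.
have zZ : (C * Z = 0)%R by lra.
have q0 (u0 t : R) : (0 < u0 -> u0 * t = 0 -> t = 0)%R.
  by move=> hu /eqP; rewrite mulf_eq0 (gt_eqF hu) => /eqP.
by move: hs; rewrite (q0 _ _ hA zX) (q0 _ _ hB zY) (q0 _ _ hC zZ) !addr0 ltxx.
Qed.

Lemma in_tip_triangle_mono q i u v j : i <= u -> u < v -> v <= j -> j <= l.+1 ->
  in_tip_triangle a s q u v -> in_tip_triangle a s q i j.
Proof.
move=> iu uv vj hj hq.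
have hv : v <= l.+1 by lia.
have iv : i < v by lia.
have uj : u < j by lia.
have ij : i < j by lia.
have zz x y : sgn3 x y x = 0%R by rewrite sgn3_rot sgn3_same_last.
have n1 : (0 <= sgn3 None (lb i) (lb u))%R.
  by case: (ltngtP i u) iu => // [h _|-> _]; [rewrite ltW // tip_pos //; lia|rewrite sgn3_same_last].
have n2 : (0 <= sgn3 (lb j) None (lb v))%R.
  by rewrite sgn3_rot; case: (ltngtP v j) vj => // [h _|-> _]; [rewrite ltW // tip_pos //|rewrite sgn3_same_last].
have n3 : (0 <= sgn3 (lb i) (lb j) (lb u))%R.
  by case: (ltngtP i u) iu => // [h _|-> _]; [rewrite ltW // (sgn_nested chain_neg) //|rewrite zz].
have n4 : (0 <= sgn3 (lb i) (lb j) (lb v))%R.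
  by case: (ltngtP v j) vj => // [h _|-> _]; [rewrite ltW // (sgn_nested chain_neg) //|rewrite sgn3_same_last].
have p1 := tip_pos iv hv; have p2 : (0 < sgn3 (lb j) None (lb u))%R by rewrite sgn3_rot tip_pos.
have p3 : (0 < sgn3 (lb i) (lb j) None)%R by rewrite -sgn3_rot tip_pos.
apply/and3P; split; apply: (below_side uv hv hq); rewrite ?zz ?sgn3_same_last ?(ltW p1) ?(ltW p2) ?(ltW p3) //.
- by rewrite add0r ltr_wpDl.
- by rewrite add0r ltr_wpDr.
- by rewrite -addrA ltr_wpDr // addr_ge0.
Qed.

Lemma in_tip_triangle_disjoint q i k j : in_tip_triangle a s q i k -> in_tip_triangle a s q k j -> False.
Proof.
move=> /and3P[_ h _] /and3P[h' _ _]; move: h; rewrite side_swap oppr_gt0 => h.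
by have := lt_trans h h'; rewrite ltxx.
Qed.

Variable d : dissection.
Hypothesis wd : width d = l.+1.

Let tile_list := map (tip_polygon l) (tips d 0) ++ map (chain_triangle l) (triangles d 0).

(** This is cover_count for the predicate in_tip_triangle. *)
Lemma tiles_count q : count (fun P => encloses a s P q) tile_list = in_tip_triangle a s q 0 l.+1.
Proof.
rewrite count_cat !count_map.
rewrite -[in RHS]wd -[width d]add0n -(@cover_count l.+1 (in_tip_triangle a s q)); last by rewrite wd.
- congr (_ + _); apply: eq_in_count => t ht /=.
    have [u [v [k [k' [ok et]]]]] := tips_gap wd ht; have [ut hb] := gap_path_ok ok.
    by rewrite et encloses_tip // gap_pathE /= size_rcons.
  case: t ht => [[i k] j] /triangles_bound[_ ik kj]; rewrite wd add0n => hj.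
  exact: encloses_triangle.
- by move=> i u v j h1 h2 h3 h4; apply: in_tip_triangle_mono.
- by move=> i k j _ _ _; apply: in_tip_triangle_disjoint.
Qed.

Lemma tiles_pseudo_triangle P : P \in tiles l d -> pseudo_triangle a P.
Proof.
rewrite inE mem_cat => /orP[/mapP[t ht ->]|/mapP[[[i k] j] /triangles_bound[_ ik kj hj] ->]].
  have [u [v [k [k' [ok ->]]]]] := tips_gap wd ht.
  exact: (gap_pseudo_triangle gp s0 tip_pos chain_neg ok).
by rewrite wd add0n in hj; apply: (triangle_pseudo_triangle gp s0 tip_pos chain_neg).
Qed.

Lemma tiles_regular P : P \in tiles l d -> two_regular P.
Proof. by move=> /tiles_pseudo_triangle[/simple_regular]. Qed.

Lemma tiles_enclosing_unique q P Q : P \in tiles l d -> Q \in tiles l d -> encloses a s P q -> encloses a s Q q -> P = Q.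
Proof.
rewrite !inE => hP hQ; apply: (count_unique (r := tile_list) (p := fun P => encloses a s P q)) => //.
by rewrite tiles_count; case: (in_tip_triangle _ _ _ _ _).
Qed.

Lemma tiles_enclosing q : in_tip_triangle a s q 0 l.+1 <-> exists2 P, P \in tiles l d & encloses a s P q.
Proof.
have h := tiles_count q; split=> [hb|[P hP sP]].
  rewrite hb in h; have /hasP[P hP sP] : has (fun P => encloses a s P q) tile_list by rewrite has_count h.
  by exists P => //; rewrite inE.
by rewrite inE in hP; apply: contraT => /negPf e; move: h; rewrite e => /eqP; rewrite -leqn0 leqNgt -has_count => /hasP[]; exists P.
Qed.

End Cover.

(** * Edges of the tiles of a dissection *)

Section Edges.
Variable l : nat.
Local Notation label := (option 'I_l.+2).
Local Notation lb := (chain_label l).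
Variable d : dissection.
Hypothesis wd : width d = l.+1.

(** The tiles at the tip in terms of their polygons, with what is needed about
    feet: the bounding ones, and that no foot lies strictly between. *)
Lemma tips_feet t : t \in tips d 0 ->
  exists u v k k', [/\ gap_ok l u v k k', t = gap_path u v k k',
     u = 0 \/ u \in map foot (spokes d 0), v = l.+1 \/ v \in map foot (spokes d 0) &
     forall w, w \in map foot (spokes d 0) -> w <= u \/ v <= w].
Proof.
move=> ht; have [u [v [k [k' [ok et]]]]] := tips_gap wd ht; exists u, v, k, k'.
have [x [y [et' xy hx hy hz]]] := tips_spokes ht; rewrite wd add0n in hy.
have eu : u = foot x by move: et; rewrite et' => -[].
have ev : v = foot y.
  have := congr1 (last 0) et; rewrite et' /tile_path !gap_pathE !last_cons !last_rcons //.
split=> //.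
- by rewrite eu; case: hx => [->|h]; [left|right; apply: map_f].
- by rewrite ev; case: hy => [->|h]; [left|right; apply: map_f].
- by move=> w /mapP[z /hz h ->]; rewrite eu ev.
Qed.

Lemma tip_tile t : t \in tips d 0 -> tip_polygon l t \in tiles l d.
Proof. by move=> ht; rewrite inE mem_cat map_f. Qed.

Lemma triangle_tile t : t \in triangles d 0 -> chain_triangle l t \in tiles l d.
Proof. by move=> ht; rewrite inE mem_cat (map_f (chain_triangle l) ht) orbT. Qed.

Lemma tiles_case P : P \in tiles l d ->
  (exists2 t, t \in tips d 0 & P = tip_polygon l t) \/
  (exists i k j, [/\ (i, k, j) \in triangles d 0, i < k, k < j, j <= l.+1 & P = chain_triangle l (i, k, j)]).
Proof.
rewrite inE mem_cat => /orP[/mapP[t ht ->]|/mapP[[[i k] j] h ->]]; first by left; exists t.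
right; exists i, k, j; have [_ ik kj] := triangles_bound h; rewrite wd add0n => hj.
by split.
Qed.

Lemma tiles_tip w : w <= l.+1 ->
  ([set None; lb w] \in edges (tiles l d)) = [|| w == 0, w == l.+1 | w \in map foot (spokes d 0)].
Proof.
move=> hw; apply/idP/idP => [/bigcupP[P /tiles_case[[t ht ->]|[i [k [j [_ ik kj hj ->]]]]] hin]|h].
- have [u [v [k [k' [ok et hu hv _]]]]] := tips_feet ht; have [uv hv' _ _] := ok.
  have hul : u <= l.+1 by lia.
  move: hin; rewrite et; have [_ _ _ ->] := gap_neighbours ok; rewrite !lb_eq //.
  by case/orP => /eqP->; [case: hu => [->|->]|case: hv => [->|->]]; rewrite ?eqxx ?orbT.
- case/negP: (chain_triangle_notip ik kj hj); apply/bigcupP.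
  by exists [set None; lb w]; rewrite // !inE eqxx.
have hcov : 0 <= w <= 0 + width d by rewrite wd.
have [x [y [ht]]] := tips_cover hcov.
have [u [v [k [k' [ok et hu hv hz]]]]] := tips_feet ht.
have eu : u = foot x by move: et => -[].
have ev : v = foot y.
  by have := congr1 (last 0) et; rewrite /tile_path !gap_pathE !last_cons !last_rcons.
rewrite -eu -ev => /andP[uw wv]; have [uv hvl _ _] := ok; have hul : u <= l.+1 by lia.
apply/bigcupP; exists (tip_polygon l (tile_path x y)); first exact: tip_tile.
rewrite et; have [_ _ _ ->] := gap_neighbours ok; rewrite !lb_eq //.
by case/or3P: h => [/eqP w0|/eqP w0|/hz h]; lia.
Qed.

Lemma tiles_chord i j : i < j -> j <= l.+1 ->
  ([set lb i; lb j] \in edges (tiles l d)) = ((i, j) \in chords d 0).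
Proof.
move=> ij hj; have hi : i <= l.+1 by lia.
apply/idP/idP => [/bigcupP[P /tiles_case[[t ht ->]|[i0 [k0 [j0 [ht ik kj hj0 ->]]]]] hin]|h].
- have [u [v [k [k' [ok et _ _ _]]]]] := tips_feet ht; have [ut hb] := gap_path_ok ok; rewrite -et in ut hb.
  have tl e : e \in links t -> ordered e \in chords d 0.
    by move=> he; apply: tip_links_chords; rewrite -tips_links; apply/flattenP; exists (links t); rewrite ?map_f.
  have oij : ordered (i, j) = (i, j) by rewrite /ordered /= (minn_idPl (ltnW ij)) (maxn_idPr (ltnW ij)).
  have oji : ordered (j, i) = (i, j) by rewrite /ordered /= (minn_idPr (ltnW ij)) (maxn_idPl (ltnW ij)).
  by case/orP: (tip_polygon_edge ut hb hi hj hin) => /tl; rewrite ?oij ?oji.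
- have [c1 c2 c3] := triangle_chords ht.
  by case: (chain_triangle_edge ik kj hj0 ij hj hin) => -[-> ->].
have tl e : e \in tip_links d 0 -> e.1 <= l.+1 -> e.2 <= l.+1 -> [set lb e.1; lb e.2] \in edges (tiles l d).
  rewrite -tips_links => /flattenP[_ /mapP[t ht ->] he] h1 h2.
  have [u [v [k [k' [ok et _ _ _]]]]] := tips_feet ht; have [ut hb] := gap_path_ok ok; rewrite -et in ut hb.
  by apply: (edges_mem (tip_tile ht)); apply: links_edges => //; case: e he {h1 h2}.
case: (chords_tip_links h) => [/tl->|/tl|[u [k [v [ht he]]]]] //=; first by rewrite setUC => ->.
have [_ uk kv hv] := triangles_bound ht; rewrite wd add0n in hv.
have [e1 e2 e3] := chain_triangle_edges uk kv hv.
by move: he; rewrite !inE => /or3P[] /eqP[-> ->]; apply: edges_mem (triangle_tile ht) _.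
Qed.

Lemma tiles_vertices : \bigcup_(P in tiles l d) vertices P = [set: label].
Proof.
apply/setP => x; rewrite in_setT; apply/bigcupP.
have [->|[v hv ->]] := label_case x.
  have h : [set None; lb 0] \in edges (tiles l d) by rewrite tiles_tip.
  case/bigcupP: h => P hP he; exists P => //; apply/bigcupP; exists [set None; lb 0] => //.
  by rewrite !inE eqxx.
have hcov : 0 <= v <= 0 + width d by rewrite wd.
have [x0 [y [ht hxy]]] := tips_cover hcov.
exists (tip_polygon l (tile_path x0 y)); first exact: tip_tile.
have [u [w [k [k' [ok et _ _ _]]]]] := tips_feet ht.
have eu : u = foot x0 by move: et => -[].
have ev : w = foot y.
  by have := congr1 (last 0) et; rewrite /tile_path !gap_pathE !last_cons !last_rcons.
by rewrite /vertices et gap_cover // eu ev hxy.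
Qed.

End Edges.

(** * The tiles of a dissection form a pointed pseudo-triangulation *)

Section Triangulation.
Variables (R : realType) (l : nat).
Local Notation label := (option 'I_l.+2).
Variables (a : label -> 'rV[R]_2) (s : R).
Hypothesis gp : general_position a.
Hypothesis s0 : (s != 0)%R.
Local Notation sgn3 := (sgn_of a s).
Local Notation side := (side_of a s).
Local Notation lb := (chain_label l).
Hypothesis tip_pos : forall i j, i < j -> j <= l.+1 -> (0 < sgn3 None (lb i) (lb j))%R.
Hypothesis chain_neg : forall i j k, i < j -> j < k -> k <= l.+1 ->
  (sgn3 (lb i) (lb j) (lb k) < 0)%R.

Let same_first x y : sgn3 x y x = 0%R. Proof. by rewrite sgn3_rot sgn3_same_last. Qed.

Lemma hull_left k : k != None -> k != lb 0 -> (0 < sgn3 None (lb 0) k)%R.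
Proof.
have [->|[n hn ->]] := label_case k => // _; rewrite lb_eq // => n0.
by apply: tip_pos; rewrite // lt0n.
Qed.

Lemma hull_right k : k != lb l.+1 -> k != None -> (0 < sgn3 (lb l.+1) None k)%R.
Proof.
have [->|[n hn ->]] := label_case k => //; rewrite lb_eq // => n0 _.
by rewrite sgn3_rot; apply: tip_pos => //; rewrite ltn_neqAle n0.
Qed.

Lemma hull_base k : k != lb 0 -> k != lb l.+1 -> (0 < sgn3 (lb 0) (lb l.+1) k)%R.
Proof.
have [->|[n hn ->]] := label_case k; first by rewrite -sgn3_rot tip_pos.
rewrite !lb_eq // => n0 n1; apply: (sgn_nested chain_neg) => //; first by rewrite lt0n.
by rewrite ltn_neqAle n1.
Qed.

Lemma nonneg_sgn i j k : (k != i -> k != j -> 0 < sgn3 i j k)%R -> (0 <= sgn3 i j k)%R.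
Proof.
move=> h; have [->|ki] := eqVneq k i; first by rewrite same_first.
have [->|kj] := eqVneq k j; first by rewrite sgn3_same_last.
by rewrite ltW // h.
Qed.

Lemma conv_hull q : conv a [set: label] q ->
  [/\ 0 <= side None (lb 0) q, 0 <= side (lb l.+1) None q & 0 <= side (lb 0) (lb l.+1) q]%R.
Proof.
move=> hq; split; apply: (conv_side hq) => k; apply: nonneg_sgn; 
 [exact: hull_left|exact: hull_right|exact: hull_base].
Qed.

Variable d : dissection.
Hypothesis wd : width d = l.+1.

(** The three hull edges are edges of tiles. *)
Lemma on_hull_edge q : conv a [set: label] q -> ~ in_tip_triangle a s q 0 l.+1 ->
  exists2 P, P \in tiles l d & boundary a P q.
Proof.
move=> hq hn; have [h1 h2 h3] := conv_hull hq.
have out e : e \in edges (tiles l d) -> conv a e q -> exists2 P, P \in tiles l d & boundary a P q.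
  by case/bigcupP => P hP he hc; exists P => //; exists e.
have [e1|n1] := eqVneq (side None (lb 0) q) 0%R.
  apply: (out [set None; lb 0]); first by rewrite tiles_tip.
  by apply: (conv_support hq) e1 => k; [apply: nonneg_sgn; apply: hull_left|apply: hull_left].
have [e2|n2] := eqVneq (side (lb l.+1) None q) 0%R.
  apply: (out [set lb l.+1; None]); first by rewrite setUC tiles_tip // eqxx orbT.
  by apply: (conv_support hq) e2 => k; [apply: nonneg_sgn; apply: hull_right|apply: hull_right].
have [e3|n3] := eqVneq (side (lb 0) (lb l.+1) q) 0%R.
  apply: (out [set lb 0; lb l.+1]); first by rewrite tiles_chord // -wd -[width d]add0n chords_root.
  by apply: (conv_support hq) e3 => k; [apply: nonneg_sgn; apply: hull_base|apply: hull_base].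
by case: hn; rewrite /in_tip_triangle !lt_neqAle h1 h2 h3 ![(0 == _)%R]eq_sym n1 n2 n3.
Qed.

Lemma inside_hull P q : P \in tiles l d -> inside a P q -> conv a [set: label] q.
Proof.
move=> hP hin; have tr := tiles_regular gp s0 tip_pos chain_neg wd hP.
have [q' [g hc hs]] := perturb s gp q.
have hb : in_tip_triangle a s q' 0 l.+1.
  by apply: (tiles_enclosing s0 tip_pos chain_neg wd q').2; exists P => //; apply: (inside_encloses s0 tip_pos tr g hc hin).
have pos i j : (0 < side i j q')%R -> (0 <= side i j q)%R.
  by rewrite leNgt => h; apply/negP => h'; move: h (hs j i); rewrite !(side_swap _ _ i j) !oppr_gt0 => h /(_ h') /(lt_trans h); rewrite ltxx.
case/and3P: hb => /pos h1 /pos h2 /pos h3.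
exact: (hull_conv s0 tip_pos).
Qed.

(** An arbitrary point is moved to a generic one with the same ray
    crossings, where tiles_count applies; points on the boundary of the hull
    are covered by on_hull_edge. *)
Lemma tiles_pseudo_triangulation : pseudo_triangulation a (tiles l d).
Proof.
have reg P := @tiles_regular R l a s gp s0 tip_pos chain_neg d wd P.
split.
- by move=> P hP; apply: (tiles_pseudo_triangle gp s0 tip_pos chain_neg wd hP).
- move=> q; split=> [hq|[P hP [[e he [w [w0 wz w1 eq]]]|hin]]]; last 2 first.
  + by exists w; split=> // k; rewrite inE.
  + exact: (inside_hull hP hin).
  have [hb|hb] := boolP (in_tip_triangle a s q 0 l.+1); last first.
    have [P hP hB] := on_hull_edge hq (negP hb).
    by exists P => //; left.
  have [q' [g hc hs]] := perturb s gp q.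
  have hb' : in_tip_triangle a s q' 0 l.+1 by case/and3P: hb => /hs h1 /hs h2 /hs h3; apply/and3P.
  have [P hP sP] := (tiles_enclosing s0 tip_pos chain_neg wd q').1 hb'.
  exists P => //; have [hB|hB] := pselect (boundary a P q); first by left.
  by right; apply: (encloses_inside s0 tip_pos (reg _ hP) g hc hB sP).
- move=> P Q q hP hQ ne [inP inQ]; have [q' [g hc hs]] := perturb s gp q.
  case/eqP: ne; apply: (tiles_enclosing_unique s0 tip_pos chain_neg wd (q := q') hP hQ).
    exact: (inside_encloses s0 tip_pos (reg _ hP) g hc inP).
  exact: (inside_encloses s0 tip_pos (reg _ hQ) g hc inQ).
- exact: tiles_vertices.
Qed.

End Triangulation.

Section Pointed.
Variables (R : realType) (l : nat).
Local Notation label := (option 'I_l.+2).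
Variables (a : label -> 'rV[R]_2) (s : R).
Hypothesis gp : general_position a.
Hypothesis s0 : (s != 0)%R.
Local Notation sgn3 := (sgn_of a s).
Local Notation lb := (chain_label l).
Hypothesis tip_pos : forall i j, i < j -> j <= l.+1 -> (0 < sgn3 None (lb i) (lb j))%R.
Hypothesis chain_neg : forall i j k, i < j -> j < k -> k <= l.+1 ->
  (sgn3 (lb i) (lb j) (lb k) < 0)%R.

(** For negative s the roles of the two directions are exchanged, since
    counterclockwise becomes clockwise. *)
Lemma pointed_sgn (E : {set {set label}}) (v i j : label) :
  [set v; i] \in E -> [set v; j] \in E -> (sgn3 v i j < 0)%R ->
  (forall k, [set v; k] \in E -> (sgn3 v i k <= 0)%R /\ (sgn3 v k j <= 0)%R) -> pointed a E v.
Proof.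
move=> ei ej hij hk; have [sp|sn] : (0 < s)%R \/ (s < 0)%R by move: s0; rewrite neq_lt => /orP[]; [right|left].
  have sg x y z : ((sgn3 x y z < 0)%R = (orient (a x) (a y) (a z) < 0)%R) *
                  ((sgn3 x y z <= 0)%R = (orient (a x) (a y) (a z) <= 0)%R).
    by rewrite /sgn_of /side_of pmulr_rlt0 // pmulr_rle0.
  exists i, j; split=> // [k /hk[]|]; last by rewrite -sg.
  rewrite !sg => h1 h2; rewrite /in_ccw_angle; rewrite sg in hij.
  by rewrite ltNge (ltW hij) /= negb_or -!leNgt h1.
have sg x y z : ((sgn3 x y z < 0)%R = (orient (a x) (a z) (a y) < 0)%R) *
                ((sgn3 x y z <= 0)%R = (orient (a x) (a z) (a y) <= 0)%R).
  have -> : (orient (a x) (a z) (a y) = - orient (a x) (a y) (a z))%R by rewrite /orient; ring.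
  by rewrite /sgn_of /side_of nmulr_rlt0 // nmulr_rle0 // oppr_lt0 oppr_le0.
exists j, i; split=> // [k /hk[]|]; last by rewrite -sg.
rewrite !sg => h1 h2; rewrite /in_ccw_angle; rewrite sg in hij.
by rewrite ltNge (ltW hij) /= negb_or -!leNgt h2.
Qed.

Variable d : dissection.
Hypothesis wd : width d = l.+1.
Local Notation E := (edges (tiles l d)).

Lemma tiles_loopless x : [set x; x] \notin E.
Proof.
apply/negP => /bigcupP[P hP he].
have [/(_ _ he)[u [v [uv e]]] _] := tiles_regular gp s0 tip_pos chain_neg wd hP.
by have := congr1 (fun A : {set label} => #|A|) e; rewrite !cards2 eqxx uv.
Qed.

Lemma chain_neighbour v k : v <= l.+1 -> [set lb v; k] \in E ->
  [\/ k = None /\ [set None; lb v] \in E,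
      exists x, [/\ k = lb x, x < v & (x, v) \in chords d 0] |
      exists x, [/\ k = lb x, v < x, x <= l.+1 & (v, x) \in chords d 0]].
Proof.
move=> hv; have [->|[x hx ->]] := label_case k.
  by rewrite setUC => h; apply: Or31.
have [xv|vx|->] := ltngtP x v.
- by rewrite setUC tiles_chord // => h; apply: Or32; exists x.
- by rewrite tiles_chord // => h; apply: Or33; exists x.
- by rewrite (negPf (tiles_loopless _)).
Qed.

(** The reflex angle lies to the right, between the leftmost chord and the edge
    to the tip. *)
Lemma pointed_left v k : v <= l.+1 -> [set None; lb v] \in E -> (k, v) \in chords d 0 ->
  (forall y, (v, y) \notin chords d 0) -> pointed a E (lb v).
Proof.
move=> hv htip hk hno; have ex : exists x, (x, v) \in chords d 0 by exists k.
have [x hx hmin] := ex_minnP ex; have [_ xv _] := chords_bound hx.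
have neg y : y < v -> (sgn3 (lb v) (lb y) None < 0)%R by move=> yv; apply: (sgn_vlp tip_pos).
apply: (@pointed_sgn _ _ (lb x) None).
- by rewrite setUC tiles_chord.
- by rewrite setUC.
- exact: neg.
move=> z /(chain_neighbour hv)[[-> _]|[y [-> yv hy]]|[y [_ _ _ hy]]]; last by have := hno y; rewrite hy.
  by rewrite sgn3_same_last ltW // neg.
split; last by rewrite ltW // neg.
have := hmin _ hy; rewrite leq_eqVlt => /orP[/eqP->|lt]; first by rewrite sgn3_same_last.
by rewrite ltW // (sgn_vll chain_neg).
Qed.

(** The mirror image of pointed_left. *)
Lemma pointed_right v k : v <= l.+1 -> [set None; lb v] \in E -> (v, k) \in chords d 0 ->
  (forall x, (x, v) \notin chords d 0) -> pointed a E (lb v).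
Proof.
move=> hv htip hk hno; have ex : exists x, (v, x) \in chords d 0 by exists k.
have bd x : (v, x) \in chords d 0 -> x <= l.+1 by move=> /chords_bound[_ _]; rewrite wd.
have [x hx hmax] := ex_maxnP ex bd; have [_ vx _] := chords_bound hx; have hxl := bd _ hx.
have neg y : v < y -> y <= l.+1 -> (sgn3 (lb v) None (lb y) < 0)%R by move=> *; apply: (sgn_vpr tip_pos).
apply: (@pointed_sgn _ _ None (lb x)).
- by rewrite setUC.
- by rewrite tiles_chord.
- exact: neg.
move=> z /(chain_neighbour hv)[[-> _]|[y [_ _ hy]]|[y [-> vy hyl hy]]].
- by rewrite sgn3_same_last lexx ltW // neg.
- by have := hno y; rewrite hy.
split; first by rewrite ltW // neg.
have := hmax _ hy; rewrite leq_eqVlt => /orP[/eqP->|lt]; first by rewrite sgn3_same_last.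
by rewrite ltW // (sgn_vrr chain_neg).
Qed.

(** The reflex angle contains the direction of the tip and lies between the
    nearest neighbours on either side. *)
Lemma pointed_both v x0 y0 : v <= l.+1 -> [set None; lb v] \notin E -> (x0, v) \in chords d 0 ->
  (v, y0) \in chords d 0 -> pointed a E (lb v).
Proof.
move=> hv htip hx0 hy0; have exx : exists x, (x, v) \in chords d 0 by exists x0.
have exy : exists y, (v, y) \in chords d 0 by exists y0.
have bd x : (x, v) \in chords d 0 -> x <= v by move=> /chords_bound[_ /ltnW].
have [x hx hmax] := ex_maxnP exx bd; have [_ xv _] := chords_bound hx.
have [y hy hmin] := ex_minnP exy; have [_ vy] := chords_bound hy; rewrite wd add0n => hyl.
have neg x' y' : x' < v -> v < y' -> y' <= l.+1 -> (sgn3 (lb v) (lb y') (lb x') < 0)%R.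
  by move=> *; rewrite sgn3_swap_last oppr_lt0 (sgn_vlr chain_neg).
apply: (@pointed_sgn _ _ (lb y) (lb x)).
- by rewrite tiles_chord.
- by rewrite setUC tiles_chord.
- exact: neg.
move=> z /(chain_neighbour hv)[[_ h]|[x' [-> xv' hx']]|[y' [-> vy' hyl' hy']]]; first by rewrite h in htip.
  split; first by rewrite ltW // neg.
  have := hmax _ hx'; rewrite leq_eqVlt => /orP[/eqP->|lt]; first by rewrite sgn3_same_last.
  by rewrite ltW // (sgn_vll chain_neg).
split; last by rewrite ltW // neg.
have := hmin _ hy'; rewrite leq_eqVlt => /orP[/eqP->|lt]; first by rewrite sgn3_same_last.
by rewrite ltW // (sgn_vrr chain_neg).
Qed.

Lemma tiles_pointed v : pointed a E v.
Proof.
have root : (0, l.+1) \in chords d 0 by rewrite -wd -[width d]add0n chords_root.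
have [->|[n hn ->]] := label_case v.
  have neg x y : x < y -> y <= l.+1 -> (sgn3 None (lb y) (lb x) < 0)%R.
    by move=> h1 h2; rewrite sgn3_swap_last oppr_lt0 tip_pos.
  apply: (@pointed_sgn _ _ (lb l.+1) (lb 0)).
  - by rewrite tiles_tip // eqxx orbT.
  - by rewrite tiles_tip.
  - exact: neg.
  move=> k; have [->|[x hx ->]] := label_case k; first by rewrite (negPf (tiles_loopless _)).
  move=> _; split.
    have [->|nx] := eqVneq x l.+1; first by rewrite sgn3_same_last.
    by rewrite ltW // neg // ltn_neqAle nx.
  have [->|nx] := eqVneq x 0; first by rewrite sgn3_same_last.
  by rewrite ltW // neg // lt0n.
have [n0|n0] := eqVneq n 0.
  rewrite n0; apply: (pointed_right (k := l.+1)) => //; first by rewrite tiles_tip.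
  by move=> x; apply/negP => /chords_bound[].
have [nl|nl] := eqVneq n l.+1.
  rewrite nl; apply: (pointed_left (k := 0)) => //; first by rewrite tiles_tip // eqxx orbT.
  by move=> x; apply/negP => /chords_bound[_ h1]; rewrite wd leqNgt h1.
have [hf|hf] := boolP (n \in map foot (spokes d 0)).
  have htip : [set None; lb n] \in E by rewrite tiles_tip // hf !orbT.
  have /mapP[x hx en] := hf; have [k [[_ [_ _ h1 h2]]|[_ [_ _ h1 h2]]]] := spoke_sides hx; rewrite en in hn htip *.
    exact: (pointed_left hn htip h1 h2).
  exact: (pointed_right hn htip h1 h2).
have htip : [set None; lb n] \notin E by rewrite tiles_tip // (negPf n0) (negPf nl).
have [|i [j hij]] := triangle_apex (d := d) (a := 0) _ hf.
  by rewrite wd add0n lt0n n0 ltn_neqAle nl.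
have [c1 c2 _] := triangle_chords hij.
exact: (pointed_both hn htip c1 c2).
Qed.

Lemma tiles_ppt : pointed_pseudo_triangulation a (tiles l d).
Proof. by split; [apply: (tiles_pseudo_triangulation gp s0 tip_pos chain_neg)|exact: tiles_pointed]. Qed.

(** The decoded tiles belong to T.  They already cover the hull, so T has no
    others: a generic interior point of a tile of T lies in one of them. *)
Lemma ppt_tiles T : pointed_pseudo_triangulation a T -> exists2 d', width d' = l.+1 & T = tiles l d'.
Proof.
move=> [hT hpt].
have [||d' [wd' rd]] := @realize l T l.+1 0 (ltn0Sn l) _ (step_holds gp s0 tip_pos chain_neg hT) _; first by [].
  by rewrite add0n !eqxx orbT.
exists d' => //; apply/eqP; rewrite eqEsubset (tiles_realized gp s0 tip_pos chain_neg hT hpt wd' rd) andbT.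
apply/subsetP => P hP; have [hps _ _ _] := hT; have [_ h3] := hps _ hP.
have [v] : exists v, v \in [set v : label | `[< convex_vertex a P v >]].
  by apply/set0Pn; rewrite -card_gt0 h3.
rewrite inE => /asboolP[u [w [_ _ _ [eps e0 hin]]]].
have e2 : (0 < eps / 2%:R < eps)%R by apply/andP; split; lra.
have {}hin := hin _ _ e2 e2; move: hin; set q := (_ + _)%R => hin.
have tr := tile_regular hT hP.
(* a generic interior point of P *)
have [q' [g hc hs]] := perturb s gp q; have sP := inside_encloses s0 tip_pos tr g hc hin.
have hin' : inside a P q' by apply/(inside_generic s0 tip_pos tr g).
have hq' : conv a [set: label] q' by have [_ h _ _] := hT; apply/(h q'); exists P => //; right.
have [h1 h2 h3'] := conv_hull tip_pos chain_neg hq'.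
have hb : in_tip_triangle a s q' 0 l.+1.
  rewrite /in_tip_triangle !lt_neqAle h1 h2 h3' ![(0 == _)%R]eq_sym.
  by rewrite !(generic_side s0 g) ?lb_eq.
have [Q hQ sQ] := (tiles_enclosing s0 tip_pos chain_neg wd' q').1 hb.
have hQT : Q \in T by apply: (subsetP (tiles_realized gp s0 tip_pos chain_neg hT hpt wd' rd)).
by rewrite (tile_unique s0 tip_pos hT g hP hQT sP sQ).
Qed.

End Pointed.

Lemma tiles_inj l d d' : width d = l.+1 -> width d' = l.+1 -> tiles l d = tiles l d' -> d = d'.
Proof.
move=> wd wd' e; apply: (chords_inj (a := 0)); first by rewrite wd.
have bd d0 i j : width d0 = l.+1 -> (i, j) \in chords d0 0 -> i < j /\ j <= l.+1.
  by move=> w /chords_bound[_ h1]; rewrite w.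
move=> [i j]; apply/idP/idP => h.
  by have [ij hj] := bd _ _ _ wd h; rewrite -(tiles_chord wd') // -e (tiles_chord wd).
by have [ij hj] := bd _ _ _ wd' h; rewrite -(tiles_chord wd) // e (tiles_chord wd').
Qed.

(** * Counting and the signs of a single chain *)

Section Count.
Variables (R : realType) (l : nat).
Local Notation label := (option 'I_l.+2).
Variables (a : label -> 'rV[R]_2) (s : R).
Hypothesis gp : general_position a.
Hypothesis s0 : (s != 0)%R.
Local Notation sgn3 := (sgn_of a s).
Local Notation lb := (chain_label l).
Hypothesis tip_pos : forall i j, i < j -> j <= l.+1 -> (0 < sgn3 None (lb i) (lb j))%R.
Hypothesis chain_neg : forall i j k, i < j -> j < k -> k <= l.+1 ->
  (sgn3 (lb i) (lb j) (lb k) < 0)%R.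

(** The set W to which a pseudo-triangulation belongs; it is determined by the
    pseudo-triangulation, so summing over W of a given size counts each one
    once. *)
Definition joined (T : {set {set {set label}}}) : {set 'I_l.+2} :=
  [set k in chain_interior l | [set None; Some k] \in edges T].

Lemma num_PPT_joined i :
  num_PPT a i = #|[set T : {set {set {set label}}} | `[< pointed_pseudo_triangulation a T >] && (#|joined T| == i)]|.
Proof.
rewrite -sum1dep_card (partition_big joined (fun W => (W \subset chain_interior l) && (#|W| == i))) /=; last first.
  by move=> T /andP[_ ->]; rewrite andbT; apply/subsetP => k; rewrite inE => /andP[].
apply: eq_bigr => W /andP[hW hi]; rewrite -sum1_card; apply: eq_bigl => T; rewrite inE -andbA; congr (_ && _).
apply/forallP/andP => [h|[_ /eqP eW] k].
  have eW : joined T = W.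
    apply/setP => k; rewrite inE; have := h k; case: (boolP (k \in chain_interior l)) => /= [_ /eqP //|hk _].
    by apply/esym; apply: contraNF hk => /(subsetP hW).
  by rewrite eW hi eqxx.
by apply/implyP => hk; rewrite -eW inE hk.
Qed.

Lemma card_ord_mem n (r : seq nat) : uniq r -> {in r, forall w, w <= n} ->
  #|[set k : 'I_n.+1 | (k : nat) \in r]| = size r.
Proof.
move=> ur hr; rewrite -(size_map (@inord n)).
have um : uniq (map (@inord n) r).
  rewrite map_inj_in_uniq // => x y hx hy /(congr1 val) /=; by rewrite !inordK ?ltnS ?hr.
have /card_uniqP <- := um; apply: eq_card => k; rewrite inE.
apply/idP/mapP => [hk|[w hw ->]]; first by exists (val k); rewrite ?inord_val.
by rewrite inordK // ltnS hr.
Qed.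

Lemma card_joined d : width d = l.+1 -> #|joined (tiles l d)| = tip_degree d.
Proof.
move=> wd; have fb w : w \in map foot (spokes d 0) -> 0 < w <= l.
  by move=> /mapP[x /foot_bound + ->]; rewrite wd add0n ltnS.
rewrite -(size_spokes d 0) -(size_map foot) -(@card_ord_mem l.+1 (map foot (spokes d 0))).
- apply: eq_card => k; rewrite !inE -lbK tiles_tip //; last by rewrite -ltnS.
  case: (boolP (_ \in map _ _)) => [/fb ->|_]; first by rewrite !orbT.
  rewrite orbF; apply/negbTE; lia.
- have := spokes_path d 0; rewrite -cats1 cat_path => /andP[hp _].
  exact: (sorted_uniq ltn_trans ltnn (path_sorted hp)).
- by move=> w /fb /andP[_ h]; apply: leqW.
Qed.

Lemma num_PPT_dissections i : num_PPT a i = dissection_count l.+1 i.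
Proof.
rewrite num_PPT_joined /dissection_count.
set D := [seq d <- _ | _].
have hD d : d \in D = (width d == l.+1) && (tip_degree d == i).
  rewrite mem_filter mem_dissections andbC; congr (_ && _).
  by case: eqP => //= <-; apply: depth_width.
have ut : uniq (map (tiles l) D).
  rewrite map_inj_in_uniq; first by apply/filter_uniq/dissections_uniq.
  by move=> d d'; rewrite !hD => /andP[/eqP w _] /andP[/eqP w' _]; apply: tiles_inj.
rewrite -(size_map (tiles l)); have /card_uniqP <- := ut.
apply: eq_card => T; rewrite inE; apply/andP/mapP => [[/asboolP hT hi]|[d hd ->]].
  have [d wd eT] := ppt_tiles gp s0 tip_pos chain_neg hT.
  by exists d => //; rewrite hD wd eqxx -(card_joined wd) -eT hi.
move: hd; rewrite hD => /andP[/eqP wd hi]; split.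
  by apply/asboolP; apply: (tiles_ppt gp s0 tip_pos chain_neg).
by rewrite card_joined.
Qed.

End Count.

Section Signs.
Variables (R : realType) (l : nat).
Local Notation label := (option 'I_l.+2).
Variable a : label -> 'rV[R]_2.
Hypothesis gp : general_position a.
Local Notation lb := (chain_label l).

(** Perturbing the weights 1/2 and 1/2 slightly keeps them nonnegative. *)
Lemma small_weight (A B : R) : exists2 t : R, (0 < t <= 1)%R &
  (0 <= (1 - t) / 2%:R + t * A)%R /\ (0 <= (1 - t) / 2%:R + t * B)%R.
Proof.
pose N := (1 + 2%:R * `|A| + 2%:R * `|B|)%R.
have hA := normr_ge0 A; have hB := normr_ge0 B.
have lA : (- `|A| <= A)%R by rewrite lerNl -normrN ler_norm.
have lB : (- `|B| <= B)%R by rewrite lerNl -normrN ler_norm.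
have N1 : (1 <= N)%R by rewrite /N; lra.
have N0 : (0 < N)%R by lra.
exists (N^-1)%R; first by rewrite invr_gt0 N0 invf_le1.
have E C : ((1 - N^-1) / 2%:R + N^-1 * C = N^-1 * ((N - 1) / 2%:R + C))%R.
  by field; rewrite gt_eqF.
by rewrite !E; split; apply: mulr_ge0; rewrite ?invr_ge0 ?(ltW N0) // /N; lra.
Qed.

(** If the tip were on the same side of the edge as a third chain point,
    moving from the midpoint of the edge a little towards the tip would stay in
    the triangle on these three chain points, so the midpoint would be hidden. *)
Lemma sees_other_side (i j k : 'I_l.+2) : sees a [set Some i; Some j] ->
  (0 < orient (a (Some i)) (a (Some j)) (a None) * orient (a (Some i)) (a (Some j)) (a (Some k)))%R -> False.
Proof.
set p := a None; set u := a (Some i); set v := a (Some j); set w := a (Some k) => hs h.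
have D0 : orient u v w != 0%R by apply: contraTneq h => ->; rewrite mulr0 ltxx.
have p0 : orient u v p != 0%R by apply: contraTneq h => ->; rewrite mul0r ltxx.
pose X := (orient v w p / orient u v w)%R; pose Y := (orient w u p / orient u v w)%R.
pose Z := (orient u v p / orient u v w)%R.
have Z0 : (0 < Z)%R.
  have -> : (Z = (orient u v p * orient u v w) / (orient u v w * orient u v w))%R by rewrite /Z; field.
  by rewrite divr_gt0 // -expr2 exprn_even_gt0.
have XYZ : (X + Y + Z = 1)%R.
  by rewrite -!mulrDl; apply: (mulIf D0); rewrite mulfVK // mul1r /orient; ring.
have ep : p = (X *: u + Y *: v + Z *: w)%R by exact: barycentric.
have [t /andP[t0 t1] [hX hY]] := small_weight X Y.
pose m := (2%:R^-1 *: u + 2%:R^-1 *: v)%R.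
have cm : conv a [set Some i; Some j] m.
  have := @conv3 R l a [set Some i; Some j] (Some i) (Some j) (Some j) 2%:R^-1 2%:R^-1 0.
  rewrite scale0r !addr0; apply; rewrite ?inE ?eqxx ?orbT ?invr_ge0 ?ler0n //; lra.
have cx : conv a (chain l) ((1 - (1 - t)) *: p + (1 - t) *: m)%R.
  have -> : ((1 - (1 - t)) *: p + (1 - t) *: m =
     ((1 - t) / 2%:R + t * X) *: u + ((1 - t) / 2%:R + t * Y) *: v + (t * Z) *: w)%R.
    by apply: point_ext; rewrite ep /m !coE; field.
  apply: conv3; rewrite ?imset_f ?inE //.
    by rewrite mulr_ge0 // ltW.
  have -> : ((1 - t) / 2%:R + t * X + ((1 - t) / 2%:R + t * Y) + t * Z = 1 - t + t * (X + Y + Z))%R by field.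
  by rewrite XYZ mulr1 subrK.
have os : on_segment (a None) m ((1 - (1 - t)) *: p + (1 - t) *: m)%R.
  by exists (1 - t)%R => //; apply/andP; split; lra.
have e := hs _ _ cm os cx.
have : orient u v ((1 - (1 - t)) *: p + (1 - t) *: m)%R = 0%R.
  by rewrite e /m /orient !coE; field.
have -> : orient u v ((1 - (1 - t)) *: p + (1 - t) *: m)%R = (t * orient u v p)%R.
  by rewrite /m /orient !coE; field.
by move/eqP; rewrite mulf_eq0 (negPf p0) orbF gt_eqF.
Qed.

(** Visibility puts the tip beyond each side of the chain, and the relation
    between the orientations of four points extends this to all chords by
    induction on j; the case l = 0 only needs the triangle to be
    nondegenerate. *)
Lemma chain_signs : single_chain a -> exists s : R, [/\ (s != 0)%R,
  forall i j, i < j -> j <= l.+1 -> (0 < sgn_of a s None (lb i) (lb j))%R &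
  forall i j k, i < j -> j < k -> k <= l.+1 -> (sgn_of a s (lb i) (lb j) (lb k) < 0)%R].
Proof.
move=> [_ hl]; have [l0|lp] := posnP l.
  pose s := orient (a None) (a (lb 0)) (a (lb l.+1)).
  have s0 : (s != 0)%R by apply: gp => //; rewrite lb_eq.
  exists s; split=> // [i j ij hj|i j k]; last by move=> h1 h2 h3; clear - l0 h1 h2 h3; lia.
  have [-> ->] : i = 0 /\ j = l.+1 by lia.
  by rewrite /sgn_of /side_of -/s -expr2 exprn_even_gt0.
have [cp _ vis _] := hl lp.
have [s [s0 neg]] : exists s : R, (s != 0)%R /\ forall i j k, i < j -> j < k -> k <= l.+1 -> (sgn_of a s (lb i) (lb j) (lb k) < 0)%R.
  case: cp => cp; [exists (-1)%R|exists 1%R]; split; rewrite ?oppr_eq0 ?oner_eq0 // => i j k ij jk hk;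
    have hj := ltnW (leq_trans jk hk); have hi := ltnW (leq_trans ij hj);
    have := cp (inord i) (inord j) (inord k); rewrite !inordK // ij jk => /(_ isT);
    by rewrite /sgn_of /side_of ?mulN1r ?mul1r ?oppr_lt0.
have s2 : (0 < s * s)%R by rewrite -expr2 exprn_even_gt0.
exists s; split=> //.
have adj i : i <= l -> (0 < sgn_of a s None (lb i) (lb i.+1))%R.
  move=> hi; have hi' := leqW hi.
  have ne : lb i != lb i.+1 by rewrite lb_eq // neq_ltn leqnn.
  have vi : sees a [set lb i; lb i.+1] by apply: vis; rewrite !inordK.
  have [k [hk kn]] : exists k, k <= l.+1 /\ (sgn_of a s (lb i) (lb i.+1) (lb k) < 0)%R.
    have [i0|i0] := posnP i; first by exists i.+2; rewrite i0; split; [lia|apply: neg => //; lia].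
    by exists 0; split=> //; rewrite -sgn3_rot; apply: neg.
  rewrite sgn3_rot lt_neqAle eq_sym; apply/andP; split.
    by apply: (sgn3_neq0 gp s0).
  rewrite leNgt; apply/negP => h; apply: (sees_other_side vi (k := inord k)).
  rewrite -(pmulr_rgt0 _ s2).
  have -> x y z t : (s * s * (orient x y z * orient x y t) = (s * orient x y z) * (s * orient x y t))%R by ring.
  by rewrite nmulr_rgt0.
move=> i; elim=> // j IH; rewrite ltnS leq_eqVlt => /orP[/eqP->|ij] hj; first exact: adj.
have h1 := IH ij (ltnW hj); have h2 := adj j hj; have h3 := neg i j j.+1 ij (ltnSn j) hj.
have -> : sgn_of a s None (lb i) (lb j.+1) = (sgn_of a s None (lb i) (lb j) + sgn_of a s None (lb j) (lb j.+1)
   - sgn_of a s (lb i) (lb j) (lb j.+1))%R by rewrite /sgn_of /side_of /orient; ring.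
by rewrite addr_gt0 ?oppr_gt0 // addr_gt0.
Qed.

End Signs.

Lemma num_PPT_count (R : realType) (l : nat) (a : option 'I_l.+2 -> 'rV[R]_2) i :
  single_chain a -> num_PPT a i = dissection_count l.+1 i.
Proof.
move=> ha; have [gp _] := ha; have [s [s0 tp cn]] := chain_signs gp ha.
exact: (num_PPT_dissections gp s0 tp cn).
Qed.

Local Open Scope ring_scope.
Theorem theorem14 (R : realType)
    (A : forall l : nat, option 'I_l.+2 -> 'rV[R]_2)
    (hA : forall l : nat, single_chain (A l))
    (l : nat) (hl : (1 <= l)%N) :
  num_PPT (A l) 0 = catalan l /\
  num_PPT (A l) 1 = (l.+1 * catalan l)%N /\
  (forall i : nat, (2 <= i)%N ->
    (num_PPT (A l) i)%:Z =
      ('C(l.+1, i) * catalan l)%N%:Z - (num_PPT (A l.-1) (i - 2))%:Z).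
Proof.
have count m i : num_PPT (A m) i = dissection_count m.+1 i by apply: num_PPT_count.
rewrite !count; split; first by have := dissection_count_rec 0 hl; rewrite addn0 bin0 mul1n.
split; first by have := dissection_count_rec 1 hl; rewrite addn0 bin1.
case=> [|[|i]] // _; rewrite !count prednK // subn2 /=.
by rewrite -(dissection_count_rec i.+2 hl) PoszD addrK.
Qed.
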